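(* Let $a\in\mathbb{R}\setminus\{0,1,-1\}$. There exists a complete flat front $f\colon M=\mathbb{C}\setminus\{0,1,-1\}\to\mathcal{H}^3$ whose hyperbolic Gauss maps are $$(G,G_* )=\left(z^2,\ \frac{z(z+a)}{az+1}\right).$$ In particular, the totally ramified value numbers of $G$ and $G_*$ on $M$ are $\nu_G=3$ and $\nu_{G_*}=2$, and all ends of $f$ (the points $0,1,-1,\infty$ of $\mathbb{C}\cup\{\infty\}$) are regular and embedded.
   Context: Hyperbolic space: identify Lorentz-Minkowski space $\mathbb{R}^4_1$ (metric $-x_0y_0+x_1y_1+x_2y_2+x_3y_3$) with the $2\times2$ Hermitian matrices via $(x_0,x_1,x_2,x_3)\leftrightarrow\begin{pmatrix}x_0+x_3& x_1+ix_2\\ x_1-ix_2& x_0-x_3\end{pmatrix}$; then $\mathcal{H}^3=\{bb^*: b\in SL(2,\mathbb{C})\}$, where $b^*={}^t\bar b$, with the induced metric of constant curvature $-1$. Flat fronts: let $M$ be a connected oriented $2$-manifold. A smooth map $f\colon M\to\mathcal{H}^3$ is a front if there is a unit vector field $n$ along $f$ with $\langle df,n\rangle=0$ such that $(f,n)\colon M\to T_1\mathcal{H}^3$ is an immersion. Its parallel fronts are $f_t=(\cosh t)f+(\sinh t)n$, $t\in\mathbb{R}$. A front $f$ is a flat front if for each $p\in M$ there is $t\in\mathbb{R}$ such that $f_t$ is a flat immersion at $p$. For a flat front there is a unique complex structure on $M$, always used on $M$ (here it is the standard one on $\mathbb{C}\setminus\{0,1,-1\}$, with coordinate $z$), and a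 holomorphic immersion $\mathcal{E}=(E_{ij})\colon\widetilde M\to SL(2,\mathbb{C})$ on the universal cover $\widetilde{M}$ such that $\mathcal{E}^{-1}d\mathcal{E}$ is off-diagonal, $f=\mathcal{E}\mathcal{E}^*$ and $n=\mathcal{E}e_3\mathcal{E}^*$ with $e_3=\mathrm{diag}(1,-1)$. The hyperbolic Gauss maps $G=E_{11}/E_{21}$ and $G_*=E_{12}/E_{22}$ are well-defined holomorphic maps $M\to\mathbb{C}\cup\{\infty\}$. Completeness: with $ds^2=\langle df,df\rangle$ (degenerate at singular points of $f$), the front $f$ is complete if there is a symmetric $2$-tensor $T$ on $M$ vanishing outside a compact subset of $M$ such that $ds^2+T$ is a complete Riemannian metric on $M$. If $f$ is a complete flat front, $M$ is biholomorphic to a closed Riemann surface $\overline{M}$ minus finitely many points, called the ends of $f$. Ends: an end $p$ of a complete flat front is regular if $G$ extends meromorphically across $p$ (equivalently, $G_*$ does; equivalently, the Hopf differential $Q=\omega\theta$, where $\mathcal{E}^{-1}d\mathcal{E}=\begin{pmatrix}0&\theta\\ \omega&0\end{pmatrix}$, has at most a pole of order $2$ at $p$). An end $p$ is embedded if there is a neighborhood $U$ of $p$ in $\overline{M}$ such that $f|_{U\setminus\{p\}}$ is an embedding. Totally ramified value number: let $h\colon M\to\mathbb{C}\cup\{\infty\}$ be a nonconstant meromorphic function on a Riemann surface $M$. A value $b\in\mathbb{C}\cup\{\infty\}$ is a totally ramified value of $h$ if $h$ branches (has multiplicity at least $2$) at every point of $h^{-1}(b)$; omitted (exceptional) values, i.e.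 values with $h^{-1}(b)=\emptyset$, are included. Let $a_1,\ldots,a_{r_0}$ be the exceptional values and $b_1,\ldots,b_{l_0}$ the other totally ramified values, and let $\nu_j\ge2$ be the minimum of the multiplicities of $h$ at the points of $h^{-1}(b_j)$. Then $\nu_h:=r_0+\sum_{j=1}^{l_0}\left(1-\frac1{\nu_j}\right)$. *)

(* Defs.v *)
From HB Require Import structures.
From mathcomp Require Import all_boot all_order all_algebra.
From mathcomp Require Import all_classical all_reals all_analysis.
From mathcomp Require Import complex.

Set Implicit Arguments.
Unset Strict Implicit.
Unset Printing Implicit Defensive.

Import Order.TTheory GRing.Theory Num.Theory.
Import numFieldNormedType.Exports.
Local Open Scope classical_set_scope.
Local Open Scope ring_scope.
Local Open Scope complex_scope.
Local Open Scope sesquilinear_scope.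

(* R[i] carries its topology and its normed-space structure through the
   regular-algebra alias ^o; all surfaces below are open subsets M of C, with
   z = x + i y as global coordinate and values outside M irrelevant. *)
Notation Cplane R := (R[i]^o).

Notation sphere R := (one_point_compactification (Cplane R)).

Section SmoothCalculus.
Variable R : realType.
Local Notation C := (Cplane R).

Definition dir (i : 'I_2) : C := if i == 0 then 1 else 0 +i* 1.

Definition pd (V : normedModType R) (i : 'I_2) (h : C -> V) (z : C) : V :=
  derive1 (fun t : R => h (z + t%:C * dir i)) 0.

Fixpoint Ck (V : normedModType R) (k : nat) (M : set C) (h : C -> V) : Prop :=
  (forall z, M z -> {for z, continuous h}) /\
  if k is k'.+1 then
    forall i : 'I_2,
      (forall z, M z -> derivable (fun t : R => h (z + t%:C * dir i)) 0 1) /\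
      Ck k' M (pd i h)
  else True.

Definition smooth (V : normedModType R) (M : set C) (h : C -> V) : Prop :=
  forall k, Ck k M h.

End SmoothCalculus.

Section RiemannianSurface.
Variable R : realType.
Local Notation C := (Cplane R).
Implicit Types (M : set C) (g : C -> 'M[R]_2).

Definition quad (A : 'M[R]_2) (v : 'rV[R]_2) : R := (v *m A *m v^T) 0 0.

Definition riemannian_metric M g : Prop :=
  smooth M g /\
  forall z, M z -> (g z)^T = g z /\ forall v, v != 0 -> 0 < quad (g z) v.

(* Gamma^k_ij *)
Definition christoffel g (k i j : 'I_2) (z : C) : R :=
  2^-1 * \sum_l invmx (g z) k l *
    (pd i (fun w => g w j l) z + pd j (fun w => g w i l) z
     - pd l (fun w => g w i j) z).

(* R(d_i, d_j) d_k = \sum_l (curvature_tensor g l k i j) d_l *)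
Definition curvature_tensor g (l k i j : 'I_2) (z : C) : R :=
  pd i (christoffel g l j k) z - pd j (christoffel g l i k) z
  + \sum_m (christoffel g l i m z * christoffel g m j k z
            - christoffel g l j m z * christoffel g m i k z).

(* <R(d_0, d_1) d_1, d_0> / det g *)
Definition gauss_curvature g (z : C) : R :=
  (\sum_l g z 0 l * curvature_tensor g l 1 0 1 z) / \det (g z).

(* A C^1 curve on [0, 1], taken as a C^1 map on the whole line of which only
   the restriction to [0, 1] matters.  It need not be regular, so it can stop at
   corners: piecewise C^1 curves give the same distance. *)
Definition velocity (c : R -> C) (t : R) : 'rV[R]_2 :=
  \row_i derive1 (fun s => if i == 0 then complex.Re (c s) else complex.Im (c s)) t.

Definition C1_curve M (p q : C) (c : R -> C) : Prop :=
  [/\ (forall t, derivable (fun s => complex.Re (c s)) t 1 /\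
                 derivable (fun s => complex.Im (c s)) t 1),
      continuous (derive1 (fun s => complex.Re (c s))),
      continuous (derive1 (fun s => complex.Im (c s))),
      (forall t, 0 <= t <= 1 -> M (c t)) &
      c 0 = p /\ c 1 = q].

Definition curve_length g (c : R -> C) : R :=
  \int[lebesgue_measure]_(t in `[0, 1])
    Num.sqrt (quad (g (c t)) (velocity c t)).

Definition riemannian_dist M g (p q : C) : \bar R :=
  ereal_inf [set (curve_length g c)%:E | c in C1_curve M p q].

Definition complete_metric M g : Prop :=
  riemannian_metric M g /\
  forall u : nat -> C, (forall k, M (u k)) ->
    (forall e : R, 0 < e -> exists N, forall k m, (N <= k)%N -> (N <= m)%N ->
       (riemannian_dist M g (u k) (u m) < e%:E)%E) ->
    exists2 l, M l & forall e : R, 0 < e ->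
      \forall k \near \oo, (riemannian_dist M g (u k) l < e%:E)%E.

End RiemannianSurface.

Section HyperbolicSpace.
Variable R : realType.
Local Notation C := (Cplane R).

Definition lorentz (x y : 'rV[R]_4) : R :=
  - (x 0 0 * y 0 0) + x 0 1 * y 0 1 + x 0 2 * y 0 2 + x 0 3 * y 0 3.

Definition herm (x : 'rV[R]_4) : 'M[R[i]]_2 :=
  \matrix_(i, j)
    if i == 0 then if j == 0 then (x 0 0 + x 0 3)%:C else x 0 1 +i* x 0 2
    else if j == 0 then x 0 1 -i* x 0 2 else (x 0 0 - x 0 3)%:C.

Definition H3 : set 'rV[R]_4 :=
  [set x | exists2 b : 'M[R[i]]_2, \det b = 1 & herm x = b *m b^t*].

Definition e3 : 'M[R[i]]_2 := diag_mx (\row_(j < 2) (-1) ^+ j).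

End HyperbolicSpace.

Section Fronts.
Variable R : realType.
Local Notation C := (Cplane R).
Implicit Types (M : set C) (f n : C -> 'rV[R]_4).

Definition jacobian f (z : C) : 'M[R]_(2, 4) := \matrix_i pd i f z.

Definition immersion_at f (z : C) : Prop := row_free (jacobian f z).

Definition first_form f (z : C) : 'M[R]_2 :=
  \matrix_(i, j) lorentz (pd i f z) (pd j f z).

(* f is a front in H3 with unit normal n; lorentz (f z) (n z) = 0 says that n z
   is tangent to H3 at f z. *)
Definition front M f n : Prop :=
  [/\ smooth M f, smooth M n,
      (forall z, M z -> H3 (f z)),
      (forall z, M z -> [/\ lorentz (f z) (n z) = 0, lorentz (n z) (n z) = 1 &
                            forall i, lorentz (pd i f z) (n z) = 0]) &
      (forall z, M z -> row_free (row_mx (jacobian f z) (jacobian n z)))].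

Definition cosh (t : R) : R := (expR t + expR (- t)) / 2.
Definition sinh (t : R) : R := (expR t - expR (- t)) / 2.

Definition parallel_front f n (t : R) (z : C) : 'rV[R]_4 :=
  cosh t *: f z + sinh t *: n z.

Definition flat_immersion_at f (z : C) : Prop :=
  \forall w \near z,
    immersion_at f w /\ gauss_curvature (first_form f) w = 0.

Definition flat_front M f n : Prop :=
  front M f n /\
  forall p, M p -> exists t, flat_immersion_at (parallel_front f n t) p.

Definition complete_front M f : Prop :=
  exists (T : C -> 'M[R]_2) (K : set C),
    [/\ smooth M T, (forall z, M z -> (T z)^T = T z),
        compact K /\ K `<=` M,
        (forall z, M z -> ~ K z -> T z = 0) &
        complete_metric M (fun z => first_form f z + T z)].

Definition embedding_on (V : set C) f : Prop :=
  [/\ (forall z, V z -> immersion_at f z),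
      {in V &, injective f} &
      forall z (A : set C), V z -> nbhs z A ->
        \forall x \near f z, forall w, V w -> f w = x -> A w].

Definition embedded_end M f (p : sphere R) : Prop :=
  exists U : set (sphere R),
    [/\ nbhs p U, U `\ p `<=` Some @` M &
        embedding_on [set z | (U `\ p) (Some z)] f].

End Fronts.

(* Universal cover of M: a point over z is the homotopy class, with fixed
   endpoints, of a path in M from the base point z0 to z; the coordinate near the
   class of c sends z to the class of c followed by a short segment to z.  A
   function on the universal cover is a homotopy-invariant function on paths. *)
Section UniversalCover.
Variable R : realType.
Local Notation C := (Cplane R).
Implicit Types (M : set C) (c d : R -> C).

Definition is_path M (p : C) c : Prop :=
  [/\ {within `[0, 1], continuous c},
      (forall t, 0 <= t <= 1 -> M (c t)) & c 0 = p].

Definition homotopic M c d : Prop :=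
  exists H : R * R -> C,
    [/\ {within `[0, 1] `*` `[0, 1], continuous H},
        (forall s t, 0 <= s <= 1 -> 0 <= t <= 1 -> M (H (s, t))),
        (forall t, 0 <= t <= 1 -> H (0, t) = c t /\ H (1, t) = d t) &
        (forall s, 0 <= s <= 1 -> H (s, 0) = c 0 /\ H (s, 1) = c 1)].

Definition path_cat c d (t : R) : C :=
  if t <= 2^-1 then c (2 * t) else d (2 * t - 1).

Definition segment (p q : C) (t : R) : C := p + t%:C * (q - p).

Definition sheet c (z : C) : R -> C := path_cat c (segment (c 1) z).

Definition cover_fun (E : (R -> C) -> 'M[R[i]]_2) M (z0 : C) : Prop :=
  forall c d, is_path M z0 c -> is_path M z0 d -> homotopic M c d -> E c = E d.

Definition cover_derivable (E : (R -> C) -> 'M[R[i]]_2) c : Prop :=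
  forall i j, derivable (fun z : C => E (sheet c z) i j : C) (c 1) 1.

Definition cover_derive (E : (R -> C) -> 'M[R[i]]_2) c : 'M[R[i]]_2 :=
  \matrix_(i, j) derive1 (fun z : C => E (sheet c z) i j : C) (c 1).

(* The holomorphic immersion of the universal cover into SL(2, C) attached to
   the flat front f with unit normal n. *)
Definition holomorphic_lift M (z0 : C) (f n : C -> 'rV[R]_4)
    (E : (R -> C) -> 'M[R[i]]_2) : Prop :=
  cover_fun E M z0 /\
  forall c, is_path M z0 c ->
    [/\ \det (E c) = 1,
        cover_derivable E c /\ cover_derive E c != 0,
        (forall i, (invmx (E c) *m cover_derive E c) i i = 0),
        herm (f (c 1)) = E c *m (E c)^t* &
        herm (n (c 1)) = E c *m e3 R *m (E c)^t*].

End UniversalCover.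

Section MeromorphicFunctions.
Variable R : realType.
Local Notation C := (Cplane R).
Implicit Types (M : set C) (h : C -> sphere R).

Definition sphere_div (u v : C) : sphere R :=
  if v == 0 then None else Some (u / v).

Definition hyperbolic_gauss_maps M (f n : C -> 'rV[R]_4)
    (G Gs : C -> sphere R) : Prop :=
  forall z0, M z0 -> exists2 E, holomorphic_lift M z0 f n E &
    forall c, is_path M z0 c ->
      sphere_div (E c 0 0) (E c 1 0) = G (c 1) /\
      sphere_div (E c 0 1) (E c 1 1) = Gs (c 1).

Definition holomorphic_at (k : C -> C) (z : C) : Prop :=
  \forall w \near z, derivable k w 1.

Definition meromorphic_at h (z : C) : Prop :=
  exists2 k : C -> C, holomorphic_at k z &
    (\forall w \near z, h w = Some (k w)) \/
    (\forall w \near z, h w = sphere_div 1 (k w)).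

Definition has_multiplicity h (z : C) (m : nat) : Prop :=
  exists k : C -> C,
    [/\ holomorphic_at k z, k z != 0 &
        \forall w \near z,
          h w = if h z is Some b then Some (b + (w - z) ^+ m * k w)
                else sphere_div 1 ((w - z) ^+ m * k w)].

Definition exceptional M h : set (sphere R) :=
  [set b | forall z, M z -> h z <> b].

Definition totally_ramified M h : set (sphere R) :=
  [set b | forall z, M z -> h z = b ->
     exists2 m, (2 <= m)%N & has_multiplicity h z m].

Definition multiplicities M h (b : sphere R) : set nat :=
  [set m | exists z, [/\ M z, h z = b & has_multiplicity h z m]].

Definition min_multiplicity M h (b : sphere R) : nat :=
  xget 0%N [set m | multiplicities M h b m /\
                    forall m', multiplicities M h b m' -> (m <= m')%N].

Definition totally_ramified_value_number M h : \bar R :=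
  (\esum_(b in exceptional M h) 1 +
   \esum_(b in totally_ramified M h `\` exceptional M h)
      (1 - (min_multiplicity M h b)%:R^-1)%:E)%E.

(* Coordinate of the Riemann sphere centred at p; not meaningful at w = 0 for
   p = infinity, where it is used for w != 0 only. *)
Definition sphere_chart (p : sphere R) (w : C) : C :=
  if p is Some b then b + w else w^-1.

Definition regular_end M (G : C -> sphere R) (p : sphere R) : Prop :=
  (\forall w \near (0 : C)^', M (sphere_chart p w)) /\
  exists2 H : C -> sphere R, meromorphic_at H 0 &
    \forall w \near (0 : C)^', H w = G (sphere_chart p w).

End MeromorphicFunctions.

Definition thrice_punctured_plane (R : realType) : set (Cplane R) :=
  [set z | [/\ z != 0, z != 1 & z != -1]].
Arguments thrice_punctured_plane : clear implicits.

(* Main.v *)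
Require Import Defs.
From HB Require Import structures.
From mathcomp Require Import all_boot all_order all_algebra.
From mathcomp Require Import all_classical all_reals all_analysis.
From mathcomp Require Import complex.
From mathcomp Require Import ring lra.

Set Implicit Arguments.
Unset Strict Implicit.
Unset Printing Implicit Defensive.

Import Order.TTheory GRing.Theory Num.Theory.
Import numFieldNormedType.Exports.
Local Open Scope classical_set_scope.
Local Open Scope ring_scope.
Local Open Scope complex_scope.

(** Put k = 1/a and let h be a branch of ((z-1)/(z+1))^k. The frame E with rows z^2/((z^2-1)h),
    h(kz+1) and 1/((z^2-1)h), h(z+k)/z has determinant 1, and its column quotients are G = z^2 and
    Gs = z(kz+1)/(z+k) = z(z+a)/(az+1). It comes from the classical recipe: (z^2-1)h is the
    exponential of the integral of dG/(G - Gs), which makes E^{-1}dE off-diagonal, with entries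
    [omega] and [theta] ([cderiv_e11] to [cderiv_e22]).

    As k is real, continuation around a puncture multiplies h by a number of modulus 1, so f = E E^*
    and n = E e3 E^* are defined on M. Concretely f = [mu] + [nu] and n = [mu] - [nu], where [mu]
    and [nu] are the light-like vectors of the two columns, functions of |h| alone. The parallel
    front e^t mu + e^{-t} nu induces |e^t omega dz + conj(e^{-t} theta dz)|^2 ([first_form_surf]).
    Locally this is the pull-back of the Euclidean metric by a holomorphic plus an antiholomorphic
    function, hence of curvature 0 ([gauss_curvature_flat]) wherever the two moduli differ; since
    [omega] has no zero on M, some t works at each point ([surf_flat]). The frame itself is a
    function on the universal cover because the change of argument of (z-1)/(z+1) along a path is a
    homotopy invariant ([total_angle_homotopic]), and it is holomorphic because a short final
    segment changes that angle by an explicit local argument ([total_angle_sheet]).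

    Completeness: the metric of f dominates (|omega| - |theta|)^2 |dz|^2. This factor is at least a
    constant times |z-b|^{-2} near b = 1 and -1, and |z|^{-4} near 0, and is bounded below near
    infinity ([gap_lower]); a bump metric repairs the compact rest. Then Re z, Im z and ln|z-b|^2
    are Lipschitz for the distance, so a Cauchy sequence converges in the plane and stays away from
    the punctures ([complete_of_lower_bounds]).

    Ramification: G omits 0, 1 and infinity on M and is unramified there; Gs omits 1 and has two
    critical points, each alone in its fibre, whence 1 + 1/2 + 1/2.

    Ends: a stereographic coordinate of f is the mean of G and Gs weighted by the squared moduli of
    the bottom entries of E ([surf_chart]). As G - Gs vanishes at 0, 1 and -1, the limit of the
    weight suffices to compare this coordinate near the puncture with a linear map of nonzero slope,
    up to a small Lipschitz error ([blend_lower]); so f is injective with continuous inverse there.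
    The estimate is made at 1 and 0; the symmetries z -> -z with k -> -k, and z -> 1/z, carry it to
    -1 and infinity. *)

Notation re := (@complex.Re _).
Notation im := (@complex.Im _).

(** * The plane as a product of two real lines *)

Section ComplexPlane.
Variable R : realType.
Local Notation C := (Cplane R).

Lemma re_addE (z w : C) : re (z + w) = re z + re w.
Proof. by case: z; case: w. Qed.

Lemma im_addE (z w : C) : im (z + w) = im z + im w.
Proof. by case: z; case: w. Qed.

Lemma re_oppE (z : C) : re (- z) = - re z.
Proof. by case: z. Qed.

Lemma im_oppE (z : C) : im (- z) = - im z.
Proof. by case: z. Qed.

Lemma re_mulE (z w : C) : re (z * w) = re z * re w - im z * im w.
Proof. by case: z; case: w. Qed.

Lemma im_mulE (z w : C) : im (z * w) = re z * im w + im z * re w.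
Proof. by case: z => a b; case: w => c d. Qed.

Lemma re_conjE (z : C) : re (z^*) = re z.
Proof. by case: z. Qed.

Lemma im_conjE (z : C) : im (z^*) = - im z.
Proof. by case: z. Qed.

Definition reimE :=
  (re_conjE, im_conjE, re_addE, im_addE, re_oppE, im_oppE, re_mulE, im_mulE).

Lemma eqC (z w : C) : re z = re w -> im z = im w -> z = w.
Proof. by case: z; case: w => a b c d /= -> ->. Qed.

Lemma cplane_norm (z : C) :
  `|z| = (Num.sqrt (re z ^+ 2 + im z ^+ 2))%:C.
Proof. exact: normc_def. Qed.

Lemma cnormD (z w : C) : Num.sqrt (re (z + w) ^+ 2 + im (z + w) ^+ 2) <=
  Num.sqrt (re z ^+ 2 + im z ^+ 2) + Num.sqrt (re w ^+ 2 + im w ^+ 2).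
Proof.
have := ler_normD z w.
by rewrite !cplane_norm -rmorphD /= lecR.
Qed.

Lemma abs_re_le (z : C) : `|re z| <= Num.sqrt (re z ^+ 2 + im z ^+ 2).
Proof. by rewrite -sqrtr_sqr ler_wsqrtr// lerDl sqr_ge0. Qed.

Lemma abs_im_le (z : C) : `|im z| <= Num.sqrt (re z ^+ 2 + im z ^+ 2).
Proof. by rewrite -sqrtr_sqr ler_wsqrtr// lerDr sqr_ge0. Qed.

Lemma cnorm_le (z : C) :
  Num.sqrt (re z ^+ 2 + im z ^+ 2) <= `|re z| + `|im z|.
Proof.
rewrite -(ger0_norm (addr_ge0 (normr_ge0 (re z)) (normr_ge0 (im z)))).
rewrite -sqrtr_sqr ler_wsqrtr// sqrrD !real_normK ?num_real//.
by rewrite -addrA lerD2l lerDr mulrn_wge0// mulr_ge0.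
Qed.

(** The norm of [Cplane R] takes values in [R[i]]; squares replace its balls by two inequalities in
    [R], the form in which neighbourhoods are handled below. *)
Lemma nbhs_square (z : C) (A : set C) : nbhs z A <->
  exists2 e : R, 0 < e &
    forall w : C, `|re w - re z| < e -> `|im w - im z| < e -> A w.
Proof.
split.
  move=> /nbhs_ballP[e /= e0 zA].
  have er : e = (re e)%:C by move/gtr0_real: e0 => /RRe_real.
  have re0 : 0 < re e by move: e0; rewrite er ltcR.
  exists (re e / 2); first by rewrite divr_gt0.
  move=> w hx hy; apply: zA; rewrite /ball /= cplane_norm er ltcR.
  apply: le_lt_trans (cnorm_le _) _.
  rewrite !reimE -(opprB (re w)) -(opprB (im w)) !normrN.
  by rewrite (splitr (re e)) ltrD.
case=> e e0 zA; apply/nbhs_ballP; exists (e%:C); first by rewrite /= ltcR.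
move=> w; rewrite /ball /= cplane_norm ltcR !reimE => h; apply: zA.
  apply: le_lt_trans h; rewrite distrC; have := abs_re_le (z - w).
  by rewrite !reimE.
apply: le_lt_trans h; rewrite distrC; have := abs_im_le (z - w).
by rewrite !reimE.
Qed.

Lemma re_continuous : continuous (re : C -> R).
Proof.
move=> z; apply/(@cvgrPdist_lt _ _ _ (nbhs z) (nbhs_filter z)) => e e0.
apply: (nbhs_square z _).2; exists e => // w h _.
by rewrite distrC.
Qed.

Lemma im_continuous : continuous (im : C -> R).
Proof.
move=> z; apply/(@cvgrPdist_lt _ _ _ (nbhs z) (nbhs_filter z)) => e e0.
apply: (nbhs_square z _).2; exists e => // w _ h.
by rewrite distrC.
Qed.

Lemma cvg_reim (T : Type) (F : set_system T) (FF : Filter F) (h : T -> C)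
    (l : C) :
  (fun t => re (h t)) @ F --> re l -> (fun t => im (h t)) @ F --> im l ->
  h @ F --> l.
Proof.
move=> hr hi A /(nbhs_square l)[e e0 lA].
have {}hr := ((cvgrPdist_lt _ _).1 hr) e e0; have {}hi := ((cvgrPdist_lt _ _).1 hi) e e0.
near=> t; apply: lA.
  by rewrite distrC; near: t; exact: hr.
by rewrite distrC; near: t; exact: hi.
Unshelve. all: by end_near. Qed.

Lemma cvg_re (T : Type) (F : set_system T) (FF : Filter F) (h : T -> C)
    (l : C) : h @ F --> l -> (fun t => re (h t)) @ F --> re l.
Proof. move=> hl; exact: (cvg_comp _ _ hl (@re_continuous l)). Qed.

Lemma cvg_im (T : Type) (F : set_system T) (FF : Filter F) (h : T -> C)
    (l : C) : h @ F --> l -> (fun t => im (h t)) @ F --> im l.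
Proof. move=> hl; exact: (cvg_comp _ _ hl (@im_continuous l)). Qed.

Lemma continuous_reim (T : topologicalType) (h : T -> C) (t : T) :
  {for t, continuous (fun s => re (h s))} ->
  {for t, continuous (fun s => im (h s))} -> {for t, continuous h}.
Proof. exact: (@cvg_reim T (nbhs t) (nbhs_filter t) h (h t)). Qed.

Lemma re_dir (z : C) (t : R) (i : 'I_2) :
  re (z + t%:C * dir R i) = re z + t * (i == 0)%:R.
Proof.
rewrite re_addE re_mulE /dir /=; case: ifP => _ /=.
all: by rewrite ?mulr1 ?mulr0 ?mul0r ?subr0.
Qed.

Lemma im_dir (z : C) (t : R) (i : 'I_2) :
  im (z + t%:C * dir R i) = im z + t * (i != 0)%:R.
Proof.
rewrite im_addE im_mulE /dir /=; case: ifP => _ /=.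
all: by rewrite ?mulr1 ?mulr0 ?mul0r ?addr0.
Qed.

Lemma dir_continuous (z : C) (i : 'I_2) :
  continuous (fun t : R => z + t%:C * dir R i).
Proof.
move=> t; apply: cvg_reim.
  under eq_fun do rewrite re_dir.
  by rewrite re_dir; apply: cvgD; [exact: cvg_cst|apply: cvgMl].
under eq_fun do rewrite im_dir.
by rewrite im_dir; apply: cvgD; [exact: cvg_cst|apply: cvgMl].
Qed.

Lemma add0dir (z : C) (i : 'I_2) : z + (0 : R)%:C * dir R i = z.
Proof. by rewrite mul0r addr0. Qed.

Lemma near_dir (z : C) (i : 'I_2) (A : set C) : nbhs z A ->
  \forall t \near (0 : R), A (z + t%:C * dir R i).
Proof.
move=> zA; apply: (dir_continuous (i := i)).
by rewrite add0dir.
Qed.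

Lemma comp_dir_continuous (V : normedModType R) (h : C -> V) z i :
  {for z, continuous h} -> {for 0, continuous (fun t : R => h (z + t%:C * dir R i))}.
Proof.
move=> hz; apply: continuous_comp; first exact: dir_continuous.
by rewrite add0dir.
Qed.

End ComplexPlane.

(** * Rules for partial derivatives *)

Section PartialDerivatives.
Variable R : realType.
Local Notation C := (Cplane R).

(** Existence and value in a single predicate, so that the one-variable rules apply along the line
    through [z]. *)
Definition has_pd (V : normedModType R) (i : 'I_2) (h : C -> V) (z : C) (l : V) :=
  is_derive (0 : R) (1 : R) (fun t : R => h (z + t%:C * dir R i)) l.

Lemma has_pdE (V : normedModType R) i (h : C -> V) z l :
  has_pd i h z l -> pd i h z = l.
Proof. by move=> H; rewrite /pd derive1E; apply: derive_val. Qed.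

Lemma has_pd_ex (V : normedModType R) i (h : C -> V) z l :
  has_pd i h z l -> derivable (fun t : R => h (z + t%:C * dir R i)) 0 1.
Proof. by case. Qed.

Lemma ex_has_pd (V : normedModType R) i (h : C -> V) z :
  derivable (fun t : R => h (z + t%:C * dir R i)) 0 1 ->
  has_pd i h z (pd i h z).
Proof. by move=> H; rewrite /pd derive1E; apply/derivableP. Qed.

Lemma has_pd_near (V : normedModType R) i (h1 h2 : C -> V) z l :
  (\forall w \near z, h1 w = h2 w) -> has_pd i h1 z l -> has_pd i h2 z l.
Proof.
move=> h12; apply: near_eq_is_derive.
exact: near_dir h12.
Qed.

Lemma pd_near (V : normedModType R) i (h1 h2 : C -> V) z :
  (\forall w \near z, h1 w = h2 w) -> pd i h1 z = pd i h2 z.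
Proof.
move=> h12; rewrite /pd !derive1E; apply: near_eq_derive.
exact: near_dir h12.
Qed.

Lemma has_pd_eq (V : normedModType R) i (h : C -> V) z l l' :
  has_pd i h z l -> l = l' -> has_pd i h z l'.
Proof. by move=> H <-. Qed.

Lemma has_pd_cst (V : normedModType R) i z (k : V) : has_pd i (fun=> k) z 0.
Proof. exact: is_derive_cst. Qed.

Lemma has_pd_re i z : has_pd i (re : C -> R) z (i == 0)%:R.
Proof.
rewrite /has_pd; under eq_fun do rewrite re_dir.
apply: is_derive_eq.
by rewrite scaler0 !add0r mul1r [_%:A]mulr1.
Qed.

Lemma has_pd_im i z : has_pd i (im : C -> R) z (i != 0)%:R.
Proof.
rewrite /has_pd; under eq_fun do rewrite im_dir.
apply: is_derive_eq.
by rewrite scaler0 !add0r mul1r [_%:A]mulr1.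
Qed.

Lemma has_pdD (V : normedModType R) i (f g : C -> V) z a b :
  has_pd i f z a -> has_pd i g z b -> has_pd i (fun w => f w + g w) z (a + b).
Proof. move=> fa gb; exact: is_deriveD. Qed.

Lemma has_pdN (V : normedModType R) i (f : C -> V) z a :
  has_pd i f z a -> has_pd i (fun w => - f w) z (- a).
Proof. move=> fa; exact: is_deriveN. Qed.

Lemma has_pdB (V : normedModType R) i (f g : C -> V) z a b :
  has_pd i f z a -> has_pd i g z b -> has_pd i (fun w => f w - g w) z (a - b).
Proof. move=> fa gb; exact: is_deriveB. Qed.

Lemma has_pdZ (V : normedModType R) i (k : R) (g : C -> V) z b :
  has_pd i g z b -> has_pd i (fun w => k *: g w) z (k *: b).
Proof. move=> gb; exact: is_deriveZ. Qed.

Lemma has_pdM i (f g : C -> R) z a b :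
  has_pd i f z a -> has_pd i g z b ->
  has_pd i (fun w => f w * g w) z (f z * b + g z * a).
Proof.
move=> fa gb; rewrite /has_pd.
have := is_deriveM fa gb; rewrite /= !add0dir; exact.
Qed.

Lemma has_pd_comp i (g : R -> R) (f : C -> R) z a b :
  has_pd i f z a -> is_derive (f z) 1 g b ->
  has_pd i (fun w => g (f w)) z (b * a).
Proof.
move=> fa gb; rewrite /has_pd.
pose F := fun t : R => f (z + t%:C * dir R i).
have gb' : is_derive (F 0) 1 g b by rewrite /F add0dir.
exact: (@is_derive1_comp _ g F 0 b a gb' fa).
Qed.

Lemma has_pdX i (f : C -> R) z a n :
  has_pd i f z a -> has_pd i (fun w => f w ^+ n) z (n%:R * f z ^+ n.-1 * a).
Proof.
move=> fa; apply: (has_pd_comp (g := fun x => x ^+ n) fa).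
have := @is_deriveX _ _ id n (f z) 1 1 (is_derive_id _ _).
by rewrite [_%:A]mulr1 exprfctE.
Qed.

Lemma has_pdV i (f : C -> R) z a : f z != 0 ->
  has_pd i f z a -> has_pd i (fun w => (f w)^-1) z (- (f z) ^- 2 * a).
Proof.
move=> fz fa; apply: (has_pd_comp (g := fun x => x^-1) fa).
have := @is_deriveV _ id (f z) 1 1 fz (is_derive_id _ _).
by rewrite [_ *: _]mulr1.
Qed.

End PartialDerivatives.

(** * Smooth functions on an open set *)

Section Smoothness.
Variable R : realType.
Local Notation C := (Cplane R).
Variable M : set C.
Hypothesis oM : open M.

Lemma Ck_continuous (V : normedModType R) k (h : C -> V) z :
  Ck k M h -> M z -> {for z, continuous h}.
Proof. by case: k => [|k] [H _] Mz; exact: H. Qed.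

Lemma CkW (V : normedModType R) k (h : C -> V) : Ck k.+1 M h -> Ck k M h.
Proof.
elim: k h => [|k IH] h [hc hd]; first by split.
split=> // i; have [hi Hi] := hd i; split=> //; exact: IH.
Qed.

Lemma near_continuous_at (T U : topologicalType) (h1 h2 : T -> U) z :
  (\forall w \near z, h1 w = h2 w) ->
  {for z, continuous h1} -> {for z, continuous h2}.
Proof.
move=> h12; rewrite /prop_for /continuous_at -(nbhs_singleton h12) => h1c A zA.
rewrite /nbhs /=; apply: filterS2 h12 (h1c A zA) => w; rewrite /= => ->; exact.
Qed.

Lemma Ck_ext (V : normedModType R) k (h1 h2 : C -> V) :
  (forall z, M z -> h1 z = h2 z) -> Ck k M h1 -> Ck k M h2.
Proof.
elim: k h1 h2 => [|k IH] h1 h2 h12.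
  have near12 z : M z -> \forall w \near z, h1 w = h2 w.
    by move=> Mz; apply: filterS (open_nbhs_nbhs (conj oM Mz)) => w /h12.
  move=> [h1c _]; split=> // z Mz; exact: near_continuous_at (near12 z Mz) (h1c z Mz).
have near12 z : M z -> \forall w \near z, h1 w = h2 w.
  by move=> Mz; apply: filterS (open_nbhs_nbhs (conj oM Mz)) => w /h12.
move=> [h1c h1d]; split=> [z Mz|i].
  exact: near_continuous_at (near12 z Mz) (h1c z Mz).
have [hi Hi] := h1d i; split=> [z Mz|].
  apply: has_pd_ex (has_pd_near (near12 z Mz) (ex_has_pd (hi z Mz))).
apply: IH Hi => z Mz; apply: pd_near; exact: near12.
Qed.

(** [Ck] is phrased with [pd]; this trades [pd] for explicit formulas valid on [M], on which an
    induction on the order can work. *)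
Lemma CkS_intro (V : normedModType R) k (h : C -> V) (d : 'I_2 -> C -> V) :
  (forall z, M z -> {for z, continuous h}) ->
  (forall i z, M z -> has_pd i h z (d i z)) ->
  (forall i, Ck k M (d i)) -> Ck k.+1 M h.
Proof.
move=> hc hd dk; split=> // i; split=> [z Mz|].
  exact: has_pd_ex (hd i z Mz).
apply: Ck_ext (dk i) => z Mz; apply/esym; apply: has_pdE; exact: hd.
Qed.

Lemma CkS_has_pd (V : normedModType R) k (h : C -> V) i z :
  Ck k.+1 M h -> M z -> has_pd i h z (pd i h z).
Proof. by move=> [_ /(_ i)[H _]] Mz; apply: ex_has_pd; exact: H. Qed.

Lemma CkS_pd (V : normedModType R) k (h : C -> V) i :
  Ck k.+1 M h -> Ck k M (pd i h).
Proof. by move=> [_ /(_ i)[_]]. Qed.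

Lemma Ck_cst (V : normedModType R) k (v : V) : Ck k M (fun=> v).
Proof.
elim: k v => [|k IH] v; first by split=> // z _; exact: cst_continuous.
apply: (@CkS_intro _ _ _ (fun _ _ => 0)) => [z _|i z _|i].
- exact: cst_continuous.
- exact: has_pd_cst.
- exact: IH.
Qed.

Lemma Ck_re k : Ck k M (re : C -> R).
Proof.
case: k => [|k]; first by split=> // z _; exact: re_continuous.
apply: (@CkS_intro _ _ _ (fun i _ => (i == 0)%:R : R)) => [z _|i z _|i].
- exact: re_continuous.
- exact: has_pd_re.
- exact: Ck_cst.
Qed.

Lemma Ck_im k : Ck k M (im : C -> R).
Proof.
case: k => [|k]; first by split=> // z _; exact: im_continuous.
apply: (@CkS_intro _ _ _ (fun i _ => (i != 0)%:R : R)) => [z _|i z _|i].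
- exact: im_continuous.
- exact: has_pd_im.
- exact: Ck_cst.
Qed.

Lemma CkD (V : normedModType R) k (f g : C -> V) :
  Ck k M f -> Ck k M g -> Ck k M (fun z => f z + g z).
Proof.
elim: k f g => [|k IH] f g fk gk.
  by split=> // z Mz; apply: continuousD; [exact: Ck_continuous fk Mz|exact: Ck_continuous gk Mz].
apply: (@CkS_intro _ _ _ (fun i z => pd i f z + pd i g z)).
- by move=> z Mz; apply: continuousD; [exact: Ck_continuous fk Mz|exact: Ck_continuous gk Mz].
- by move=> i z Mz; apply: has_pdD; [exact: CkS_has_pd fk Mz|exact: CkS_has_pd gk Mz].
- by move=> i; apply: IH; apply: CkS_pd.
Qed.

Lemma CkM k (f g : C -> R) :
  Ck k M f -> Ck k M g -> Ck k M (fun z => f z * g z).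
Proof.
elim: k f g => [|k IH] f g fk gk.
  by split=> // z Mz; apply: continuousM; [exact: Ck_continuous fk Mz|exact: Ck_continuous gk Mz].
apply: (@CkS_intro _ _ _ (fun i z => f z * pd i g z + g z * pd i f z)).
- by move=> z Mz; apply: continuousM; [exact: Ck_continuous fk Mz|exact: Ck_continuous gk Mz].
- by move=> i z Mz; apply: has_pdM; [exact: CkS_has_pd fk Mz|exact: CkS_has_pd gk Mz].
- by move=> i; apply: CkD; apply: IH; by [apply: CkW|apply: CkS_pd].
Qed.

Lemma CkZ (V : normedModType R) k (c : R) (f : C -> V) :
  Ck k M f -> Ck k M (fun z => c *: f z).
Proof.
elim: k f => [|k IH] f fk.
  by split=> // z Mz; apply: continuousZr; exact: Ck_continuous fk Mz.
apply: (@CkS_intro _ _ _ (fun i z => c *: pd i f z)).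
- by move=> z Mz; apply: continuousZr; exact: Ck_continuous fk Mz.
- by move=> i z Mz; apply: has_pdZ; exact: CkS_has_pd fk Mz.
- by move=> i; apply: IH; apply: CkS_pd.
Qed.

Lemma CkN k (f : C -> R) : Ck k M f -> Ck k M (fun z => - f z).
Proof.
move=> fk; apply: Ck_ext (CkZ (-1) fk) => z _.
by rewrite [_ *: _]mulN1r.
Qed.

Lemma CkV k (f : C -> R) : (forall z, M z -> f z != 0) ->
  Ck k M f -> Ck k M (fun z => (f z)^-1).
Proof.
move=> f0; elim: k f f0 => [|k IH] f f0 fk.
  by split=> // z Mz; apply: continuousV; [exact: f0|exact: Ck_continuous fk Mz].
apply: (@CkS_intro _ _ _ (fun i z => - ((f z)^-1 * (f z)^-1) * pd i f z)).
- by move=> z Mz; apply: continuousV; [exact: f0|exact: Ck_continuous fk Mz].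
- move=> i z Mz; apply: has_pd_eq.
    by apply: has_pdV; [exact: f0|exact: CkS_has_pd fk Mz].
  by rewrite -invfM -expr2.
- move=> i; apply: CkM; last exact: CkS_pd.
  by apply: CkN; apply: CkM; apply: IH => //; apply: CkW.
Qed.

(** Bootstrapping: when the partials are [h] times regular factors, each order of regularity of [h]
    yields the next. This is what makes exponentials smooth. *)
Lemma Ck_logder k (h : C -> R) (l : 'I_2 -> C -> R) :
  (forall z, M z -> {for z, continuous h}) ->
  (forall i z, M z -> has_pd i h z (h z * l i z)) ->
  (forall i, Ck k M (l i)) -> Ck k M h.
Proof.
move=> hc hd; elim: k => [|k IH] lk; first by split.
apply: (CkS_intro hc hd) => i; apply: CkM; last exact/CkW/lk.
by apply: IH => j; apply/CkW.
Qed.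

Lemma has_pd_expR i (f : C -> R) z a :
  has_pd i f z a -> has_pd i (fun w => expR (f w)) z (expR (f z) * a).
Proof. by move=> fa; apply: (has_pd_comp (g := @expR R) fa). Qed.

Lemma has_pd_ln i (f : C -> R) z a : 0 < f z ->
  has_pd i f z a -> has_pd i (fun w => ln (f w)) z ((f z)^-1 * a).
Proof.
by move=> fz fa; apply: (has_pd_comp (g := @ln R) fa); apply: is_derive1_ln.
Qed.

Lemma Ck_expR k (f : C -> R) : Ck k M f -> Ck k M (fun z => expR (f z)).
Proof.
have H j (g : C -> R) : Ck j M g -> forall z, M z ->
    {for z, continuous (fun z => expR (g z))}.
  move=> gk z Mz; apply: (@continuous_comp _ _ _ g expR).
    exact: Ck_continuous gk Mz.
  exact: continuous_expR.
case: k => [|k] fk; first by split=> //; exact: H fk.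
apply: (@CkS_intro _ _ _ (fun i z => expR (f z) * pd i f z)).
- exact: H fk.
- by move=> i z Mz; apply: has_pd_expR; exact: CkS_has_pd fk Mz.
- move=> i; apply: CkM; last exact: CkS_pd.
  apply: (@Ck_logder _ _ (fun i z => pd i f z)); first exact: H fk.
    by move=> j z Mz; apply: has_pd_expR; exact: CkS_has_pd fk Mz.
  by move=> j; exact: CkS_pd.
Qed.

Lemma Ck_ln k (f : C -> R) : (forall z, M z -> 0 < f z) ->
  Ck k M f -> Ck k M (fun z => ln (f z)).
Proof.
move=> f0 fk.
have H z : M z -> {for z, continuous (fun z => ln (f z))}.
  move=> Mz; apply: (@continuous_comp _ _ _ f (@ln R)).
    exact: Ck_continuous fk Mz.
  by apply: continuous_ln; exact: f0.
case: k fk => [|k] fk; first by split.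
apply: (@CkS_intro _ _ _ (fun i z => (f z)^-1 * pd i f z)) => //.
- move=> i z Mz; apply: has_pd_ln; first exact: f0.
  by exact: CkS_has_pd fk Mz.
- move=> i; apply: CkM; last exact: CkS_pd.
  by apply: CkV; [move=> z /f0; rewrite lt0r => /andP[]|exact: CkW].
Qed.

Lemma Ck_sum k (I : Type) (s : seq I) (f : I -> C -> R) :
  (forall i, Ck k M (f i)) -> Ck k M (fun z => \sum_(i <- s) f i z).
Proof.
move=> fk; elim: s => [|i s IH].
  by apply: (Ck_ext _ (Ck_cst k (0 : R))) => z _; rewrite big_nil.
apply: (Ck_ext _ (CkD (fk i) IH)) => z _; by rewrite big_cons.
Qed.

Lemma has_pd_mx m n i (F : C -> 'M[R]_(m.+1, n.+1)) z (L : 'M[R]_(m.+1, n.+1)) :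
  (forall a b, has_pd i (fun w => F w a b) z (L a b)) -> has_pd i F z L.
Proof.
move=> H.
have D : derivable (fun t : R => F (z + t%:C * dir R i)) 0 1.
  by apply/derivable_mxP => a b; exact: has_pd_ex (H a b).
apply: DeriveDef => //; rewrite derive_mx //.
apply/matrixP => a b; rewrite mxE -(has_pdE (H a b)) /pd derive1E //.
Qed.

Lemma pd_mx m n i (F : C -> 'M[R]_(m.+1, n.+1)) z :
  derivable (fun t : R => F (z + t%:C * dir R i)) 0 1 ->
  forall a b, has_pd i (fun w => F w a b) z (pd i F z a b).
Proof.
move=> D a b; rewrite /pd derive1E derive_mx // mxE.
apply: (@DeriveDef _ _ _ (0 : R) (1 : R) (fun t : R => F (z + t%:C * dir R i) a b)).
  by move/derivable_mxP : D.
by [].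
Qed.

Lemma continuous_mx (T : topologicalType) m n (F : T -> 'M[R]_(m.+1, n.+1)) z :
  (forall a b, {for z, continuous (fun w => F w a b)}) -> {for z, continuous F}.
Proof.
move=> H; apply/(@cvgrPdist_lt _ _ _ (nbhs z) (nbhs_filter z)) => e e0.
near=> w; rewrite [ltLHS]/Num.Def.normr /= mx_normrE.
apply/bigmax_ltP; split => // i _; rewrite /= !mxE.
move: i; near: w; apply: filter_forall => -[a b] /=.
exact: ((@cvgrPdist_lt _ _ _ (nbhs z) (nbhs_filter z) _ _).1 (H a b)).
Unshelve. all: by end_near. Qed.

Lemma Ck_mx m n k (F : C -> 'M[R]_(m.+1, n.+1)) :
  (forall a b, Ck k M (fun z => F z a b)) -> Ck k M F.
Proof.
elim: k F => [|k IH] F FK.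
  split=> // z Mz; apply: continuous_mx => a b; exact: Ck_continuous (FK a b) Mz.
apply: (@CkS_intro _ _ _ (fun i z => \matrix_(a, b) pd i (fun w => F w a b) z)).
- by move=> z Mz; apply: continuous_mx => a b; exact: Ck_continuous (FK a b) Mz.
- move=> i z Mz; apply: has_pd_mx => a b; rewrite mxE; exact: CkS_has_pd (FK a b) Mz.
- move=> i; apply: IH => a b.
  apply: (Ck_ext _ (CkS_pd i (FK a b))) => z _; by rewrite mxE.
Qed.

End Smoothness.

(** * Lipschitz bounds from partial derivatives off one point *)

Section AxisParallelMVT.
Variable R : realType.
Local Notation C := (Cplane R).

Lemma lipschitz_off_endpoint (g : R -> R) (a b e : R) : a <= b ->
  (forall t, a <= t <= b -> {for t, continuous g}) ->
  (forall t, a < t < b -> exists2 l, is_derive t (1 : R) g l & `|l| <= e) ->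
  `|g b - g a| <= e * (b - a).
Proof.
rewrite le_eqVlt => /predU1P[-> _ _|ab gc gd]; first by rewrite !subrr mulr0 normr0.
pose dg t := 'D_1 g t.
have [t|t|t tab ->] := @MVT R g dg a b ab.
- rewrite in_itv /= => /gd[l gl _]; by apply/derivableP; case: gl.
- apply: continuous_in_subspaceT => u; rewrite inE /= in_itv /=; exact: gc.
- rewrite normrM (gtr0_norm (_ : 0 < b - a)) ?subr_gt0// ler_pM2r ?subr_gt0//.
  by move: tab; rewrite in_itv /= => /gd[l gl]; rewrite /dg (derive_val (is_derive := gl)).
Qed.

(** Cut the interval at [c] and use the mean value theorem on both pieces, where [c] is only an
    endpoint. *)
Lemma lipschitz_off_point (g : R -> R) (a b c e : R) : a <= b ->
  (forall t, a <= t <= b -> {for t, continuous g}) ->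
  (forall t, a < t < b -> t != c ->
    exists2 l, is_derive t (1 : R) g l & `|l| <= e) ->
  `|g b - g a| <= e * (b - a).
Proof.
move=> ab gc gd.
have [acb|acb] := boolP (a < c < b); last first.
  apply: lipschitz_off_endpoint => // t tab; apply: gd => //.
  by apply: contra acb => /eqP <-.
move/andP: acb => [ac cb].
rewrite -(subrKA (g c)) (le_trans (ler_normD _ _))//.
rewrite -(subrKA c b) mulrDr lerD//; apply: lipschitz_off_endpoint (ltW _) _ _ => // t.
- by move=> /andP[t1 t2]; apply: gc; rewrite t2 (le_trans (ltW ac)).
- by move=> /andP[t1 t2]; apply: gd; rewrite ?gt_eqF// t2 (lt_trans ac).
- by move=> /andP[t1 t2]; apply: gc; rewrite t1 (le_trans t2 (ltW cb)).
- by move=> /andP[t1 t2]; apply: gd; rewrite ?lt_eqF// t1 (lt_trans t2).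
Qed.

Lemma has_pd_is_derive (V : normedModType R) i (h : C -> V) (z : C) (t : R) l :
  has_pd i h (z + t%:C * dir R i) l ->
  is_derive t (1 : R) (fun s => h (z + s%:C * dir R i)) l.
Proof.
rewrite /has_pd => -[D <-].
have E (s : R) : h (z + t%:C * dir R i + s%:C * dir R i) =
    h (z + (s + t)%:C * dir R i).
  by rewrite -addrA -mulrDl -rmorphD addrC /= [t + s]addrC // addrC.
have H : (fun h0 : R => h0^-1 *: (h (z + (h0 *: (1 : R) + t)%:C * dir R i) -
    h (z + t%:C * dir R i))) = (fun h0 : R => h0^-1 *:
    (h (z + t%:C * dir R i + (h0 *: (1 : R) + 0)%:C * dir R i) -
     h (z + t%:C * dir R i + (0 : R)%:C * dir R i))).
  by apply: funext => h0; rewrite !E add0r addr0.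
apply: DeriveDef.
  by move: D; rewrite /derivable H.
by rewrite /derive H.
Qed.

(** Join the points by a horizontal and a vertical segment inside the square; each meets [b] for at
    most one parameter, where continuity is enough. At the ends of the surface, [b] will be a
    puncture at which the function is continuous but perhaps not differentiable. *)
Lemma square_lipschitz (f : C -> R) (b : C) (r e : R) :
  (forall z : C, `|re z - re b| < r -> `|im z - im b| < r -> z != b ->
     forall i, exists2 l, has_pd i f z l & `|l| <= e) ->
  {for b, continuous f} ->
  forall z1 z2 : C, `|re z1 - re b| < r -> `|im z1 - im b| < r ->
    `|re z2 - re b| < r -> `|im z2 - im b| < r ->
    `|f z2 - f z1| <= e * (`|re z2 - re z1| + `|im z2 - im z1|).
Proof.
move=> fd fb.
have line i (z : C) (s t : R) : s <= t ->
    (forall u, s <= u <= t -> `|re (z + u%:C * dir R i) - re b| < r /\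
                              `|im (z + u%:C * dir R i) - im b| < r) ->
    `|f (z + t%:C * dir R i) - f (z + s%:C * dir R i)| <= e * (t - s).
  move=> st sq.
  (* The only parameter at which this line can pass through [b]. *)
  pose cu := if i == 0 then re b - re z else im b - im z.
  have neb u : u != cu -> z + u%:C * dir R i != b.
    rewrite /cu; apply: contra => /eqP <-; rewrite re_dir im_dir.
    by case: (i == 0); rewrite /= mulr1 addrC addKr.
  apply: (@lipschitz_off_point (fun u => f (z + u%:C * dir R i)) s t cu) => // u su.
    have [ub|ub] := eqVneq (z + u%:C * dir R i) b.
      apply: continuous_comp; first exact: dir_continuous.
      by rewrite ub.
    have [s1 s2] := sq u su.
    have [l hl _] := fd _ s1 s2 ub i.
    by apply/differentiable_continuous/derivable1_diffP; by case: (has_pd_is_derive hl).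
  move=> uc; have [|s1 s2] := sq u; first by case/andP: su => /ltW -> /ltW ->.
  have [l hl le] := fd _ s1 s2 (neb u uc) i.
  by exists l => //; exact: has_pd_is_derive.
move=> z1 z2 x1 y1 x2 y2.
have mid (a c d u : R) : `|a - d| < r -> `|c - d| < r -> a <= u <= c -> `|u - d| < r.
  rewrite !ltr_norml => /andP[a1 a2] /andP[c1 c2] /andP[u1 u2].
  by apply/andP; split; lra.
have gen i (z : C) (s t : R) :
    `|re (z + s%:C * dir R i) - re b| < r -> `|im (z + s%:C * dir R i) - im b| < r ->
    `|re (z + t%:C * dir R i) - re b| < r -> `|im (z + t%:C * dir R i) - im b| < r ->
    `|f (z + t%:C * dir R i) - f (z + s%:C * dir R i)| <= e * `|t - s|.
  wlog st : s t / s <= t.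
    move=> H ? ? ? ?; have [st|/ltW ts] := leP s t; first exact: H.
    by rewrite distrC [`|t - s|]distrC; apply: H.
  move=> a1 a2 a3 a4; rewrite (ger0_norm (_ : 0 <= t - s)) ?subr_ge0//.
  apply: line => // u sut; split.
    apply: mid a1 a3 _; rewrite !re_dir !lerD2l.
    by case: (i == 0); rewrite /= ?mulr1 ?mulr0 ?lexx.
  apply: mid a2 a4 _; rewrite !im_dir !lerD2l.
  by case: (i == 0); rewrite /= ?mulr1 ?mulr0 ?lexx.
(* The corner of the path from [z1] to [z2]. *)
pose zm : C := re z2 +i* im z1.
rewrite -(subrKA (f zm)) (le_trans (ler_normD _ _))// mulrDr [leRHS]addrC lerD//.
  have := @gen 1 (re z2 +i* 0) (im z1) (im z2).
  have E (u : R) : (re z2 +i* 0 : C) + u%:C * dir R 1 = re z2 +i* u.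
    by apply: eqC; rewrite ?re_dir ?im_dir /= ?mulr0 ?mulr1 ?addr0 ?add0r.
  rewrite !E /=; have -> : (re z2 +i* im z2) = z2 by case: (z2).
  exact.
have := @gen 0 (0 +i* im z1) (re z1) (re z2).
have E (u : R) : (0 +i* im z1 : C) + u%:C * dir R 0 = u +i* im z1.
  by apply: eqC; rewrite ?re_dir ?im_dir /= ?mulr0 ?mulr1 ?addr0 ?add0r.
rewrite !E /=; have -> : (re z1 +i* im z1) = z1 by case: (z1).
exact.
Qed.

End AxisParallelMVT.

(** * Complex derivatives and the Cauchy-Riemann criterion *)

Section ComplexDerivative.
Variable R : realType.
Local Notation C := (Cplane R).

Lemma dir_neq0 (i : 'I_2) : dir R i != 0.
Proof. by rewrite /dir; case: ifP => _; rewrite ?oner_neq0// eq_complex /= oner_eq0 andbF. Qed.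

Lemma is_derive_cvg (f : C -> C) (z l : C) : is_derive z (1 : C) f l <->
  (fun h : C => h^-1 * (f (z + h) - f z)) @ (0 : C)^' --> l.
Proof.
have E : (fun h : C => h^-1 * (f (z + h) - f z)) =
    (fun h : C => h^-1 *: (f (h *: (1 : C) + z) - f z)).
  apply: funext => h; rewrite [_ *: (_ - _)]/(_ * _) [h *: _]mulr1.
  by rewrite [h + z]addrC.
rewrite E; split=> [[D <-]|H]; first exact: D.
apply: DeriveDef; first by apply/cvg_ex; exists l.
exact/cvg_lim.
Qed.

Lemma is_derive_has_pd (f : C -> C) (z l : C) i : is_derive z (1 : C) f l ->
  has_pd i (fun w => re (f w)) z (re (dir R i * l)) /\
  has_pd i (fun w => im (f w)) z (im (dir R i * l)).
Proof.
move=> /is_derive_cvg fl.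
have tdir : (fun t : R => t%:C * dir R i) @ (0 : R)^' --> (0 : C)^'.
  move=> A /= [e /= e0 eA].
  have er : e = (re e)%:C by move/gtr0_real: e0 => /RRe_real.
  have re0 : 0 < re e by move: e0; rewrite er ltcR.
  exists (re e) => // t /= te t0; apply: eA; last first.
    by rewrite /= mulf_neq0 ?dir_neq0// eq_complex /= eqxx andbT.
  rewrite /= sub0r normrN normrM er.
  have -> : `|dir R i| = 1.
    rewrite cplane_norm /dir; case: ifP => _ /=;
    by rewrite expr0n /= expr1n ?addr0 ?add0r sqrtr1.
  rewrite mulr1 cplane_norm /= expr0n addr0 sqrtr_sqr ltcR.
  by rewrite -normrN -sub0r.
have lim1 : (fun t : R => dir R i * ((t%:C * dir R i)^-1 *
    (f (z + t%:C * dir R i) - f z))) @ (0 : R)^' --> dir R i * l.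
  apply: cvgMr.
  exact: (cvg_comp _ _ tdir fl).
have E (t : R) : t != 0 -> dir R i * ((t%:C * dir R i)^-1 *
    (f (z + t%:C * dir R i) - f z)) = (t^-1)%:C * (f (z + t%:C * dir R i) - f z).
  move=> t0; rewrite mulrA invfM mulrCA mulfV ?dir_neq0// mulr1.
  by rewrite -fmorphV.
split.
  have {}lim1 := cvg_re (dnbhs_filter _) lim1.
  have lim2 : (fun h : R => h^-1 *: (re (f (z + (h *: (1 : R) + 0)%:C * dir R i)) -
       re (f (z + (0 : R)%:C * dir R i)))) @ (0 : R)^' --> re (dir R i * l).
    move: lim1; apply: cvg_trans; apply: near_eq_cvg; near=> t.
    rewrite E; last by near: t; exact: nbhs_dnbhs_neq.
    rewrite add0dir re_mulE /= mul0r subr0 re_addE re_oppE addr0.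
    by rewrite [t *: _]mulr1.
  apply: DeriveDef; first by apply/cvg_ex; exists (re (dir R i * l)).
  exact/cvg_lim.
have {}lim1 := cvg_im (dnbhs_filter _) lim1.
have lim2 : (fun h : R => h^-1 *: (im (f (z + (h *: (1 : R) + 0)%:C * dir R i)) -
     im (f (z + (0 : R)%:C * dir R i)))) @ (0 : R)^' --> im (dir R i * l).
  move: lim1; apply: cvg_trans; apply: near_eq_cvg; near=> t.
  rewrite E; last by near: t; exact: nbhs_dnbhs_neq.
  rewrite add0dir im_mulE /= mul0r addr0 im_addE im_oppE addr0.
  by rewrite [t *: _]mulr1.
apply: DeriveDef; first by apply/cvg_ex; exists (im (dir R i * l)).
exact/cvg_lim.
Unshelve. all: by end_near. Qed.

(** Subtract the linear map [d z0 * w]. By continuity of [d] both parts of the difference have small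
    partials near [z0], so [square_lipschitz] makes the remainder small compared with the
    increment. *)
Lemma cauchy_riemann (f d : C -> C) (z0 : C) :
  (\forall z \near z0, forall i,
     has_pd i (fun w => re (f w)) z (re (dir R i * d z)) /\
     has_pd i (fun w => im (f w)) z (im (dir R i * d z))) ->
  {for z0, continuous f} -> {for z0, continuous d} ->
  is_derive z0 (1 : C) f (d z0).
Proof.
move=> fpd fc dc.
have key (p : C -> R) (pc : continuous p) (pD : forall z w, p (z + w) = p z + p w)
    (pN : forall z, p (- z) = - p z)
    (p_pd : \forall z \near z0, forall i,
      has_pd i (fun w => p (f w)) z (p (dir R i * d z)))
    (p_lin : forall (c : C) z i, has_pd i (fun w => p (c * w)) z (p (dir R i * c)))
    (e : R) : 0 < e -> \forall h \near (0 : C),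
    `|p (f (z0 + h) - f z0 - d z0 * h)| <= e * (`|re h| + `|im h|).
  move=> e0.
  have near1 : \forall z \near z0, forall i : 'I_2,
      `|p (dir R i * d z) - p (dir R i * d z0)| <= e.
    apply: (@filter_forall _ _ (fun i : 'I_2 => [set z : C |
      `|p (dir R i * d z) - p (dir R i * d z0)| <= e]) (nbhs z0)) => i.
    have H : {for z0, continuous (fun z => p (dir R i * d z))}.
      apply: (@continuous_comp _ _ _ (fun z => dir R i * d z) p); last exact: pc.
      by apply: (@continuousM _ _ (fun=> dir R i) d); [exact: cst_continuous|exact: dc].
    have := (@cvgrPdist_le _ _ _ (nbhs z0) (nbhs_filter z0) _ _).1 H _ e0.
    by apply: filterS => w; rewrite distrC.
  have [r r0 rP] := (nbhs_square z0 _).1 (filterI p_pd near1).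
  have pdP z : `|re z - re z0| < r -> `|im z - im z0| < r -> forall i,
      exists2 l, has_pd i (fun w => p (f w) - p (d z0 * w)) z l & `|l| <= e.
    move=> x y i; have [h1 h2] := rP z x y.
    exists (p (dir R i * d z) - p (dir R i * d z0)); last exact: h2.
    exact: has_pdB.
  have lip := @square_lipschitz _ (fun w => p (f w) - p (d z0 * w)) z0 r e
    (fun z x y _ => pdP z x y).
  have lip2 : {for z0, continuous (fun w => p (f w) - p (d z0 * w))}.
    apply: continuousB.
      by apply: (@continuous_comp _ _ _ f p); [exact: fc|exact: pc].
    apply: (@continuous_comp _ _ _ (fun w => d z0 * w) p); last exact: pc.
    by apply: (@continuousM _ _ (fun=> d z0) id); [exact: cst_continuous|exact: cvg_id].
  have {}lip := lip lip2.
  apply: (nbhs_square 0 _).2; exists r => // h; rewrite !subr0 => hx hy.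
  have := lip z0 (z0 + h); rewrite !subrr normr0 !reimE.
  rewrite ![_ + _ - re z0]addrAC ![_ + _ - im z0]addrAC !subrr !add0r.
  move=> /(_ r0 r0 hx hy); apply: le_trans.
  by rewrite !pD !pN mulrDr pD le_eqVlt; apply/orP; left; apply/eqP; congr `|_|; ring.
have lin (c z : C) : is_derive z (1 : C) (fun w : C => c * w) c.
  apply/is_derive_cvg; have := @cvg_cst _ c _ (0 : C)^' (dnbhs_filter _).
  apply: cvg_trans; apply: near_eq_cvg; near=> h.
  rewrite [c * (z + h)]mulrDr addrAC subrr add0r mulrCA mulVf ?mulr1//.
  by near: h; exact: nbhs_dnbhs_neq.
have lin_re (c : C) z i : has_pd i (fun w => re (c * w)) z (re (dir R i * c)).
  exact: (is_derive_has_pd i (lin c z)).1.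
have lin_im (c : C) z i : has_pd i (fun w => im (c * w)) z (im (dir R i * c)).
  exact: (is_derive_has_pd i (lin c z)).2.
have fpdr : \forall z \near z0, forall i,
    has_pd i (fun w => re (f w)) z (re (dir R i * d z)).
  by apply: filterS fpd => z H i; exact: (H i).1.
have fpdi : \forall z \near z0, forall i,
    has_pd i (fun w => im (f w)) z (im (dir R i * d z)).
  by apply: filterS fpd => z H i; exact: (H i).2.
have kr := key _ (@re_continuous R) (@re_addE R) (@re_oppE R) fpdr lin_re.
have ki := key _ (@im_continuous R) (@im_addE R) (@im_oppE R) fpdi lin_im.
apply/is_derive_cvg.
apply/(@cvgrPdist_le _ _ _ (0 : C)^' (dnbhs_filter _)) => e e0.
have er : e = (re e)%:C by move/gtr0_real: e0 => /RRe_real.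
have re0 : 0 < re e by move: e0; rewrite er ltcR.
(* Two parts, each at most this times [|re h| + |im h|], which is at most twice the modulus of
   [h]. *)
have e4 : 0 < re e / 4 by rewrite divr_gt0.
near=> h.
have h0 : h != 0 by near: h; exact: nbhs_dnbhs_neq.
have -> : d z0 - h^-1 * (f (z0 + h) - f z0) =
    - (h^-1 * (f (z0 + h) - f z0 - d z0 * h)).
  by rewrite [in RHS]mulrBr [h^-1 * (d z0 * h)]mulrCA mulVf// mulr1 opprB.
rewrite normrN normrM normfV mulrC ler_pdivrMr ?normr_gt0// er.
rewrite !cplane_norm -rmorphM /= lecR (le_trans (cnorm_le _))//.
have hr : `|re (f (z0 + h) - f z0 - d z0 * h)| <= re e / 4 * (`|re h| + `|im h|).
  near: h; apply: nbhs_dnbhs; exact: kr e4.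
have hi : `|im (f (z0 + h) - f z0 - d z0 * h)| <= re e / 4 * (`|re h| + `|im h|).
  near: h; apply: nbhs_dnbhs; exact: ki e4.
rewrite (le_trans (lerD hr hi))// -mulrDl.
have := abs_re_le h; have := abs_im_le h.
set s := Num.sqrt _; move=> a1 a2.
rewrite (le_trans (_ : _ <= (re e / 4 + re e / 4) * (s + s)))//.
  by rewrite ler_pM2l ?addr_gt0// lerD.
by rewrite le_eqVlt; apply/orP; left; apply/eqP; field.
Unshelve. all: by end_near. Qed.

End ComplexDerivative.

(** * Light-like vectors of the columns of a frame *)

Section LorentzAlgebra.
Variable R : realType.
Local Notation C := (Cplane R).

Definition vec4 (a b c d : R) : 'rV[R]_4 := \row_(j < 4) [:: a; b; c; d]`_j.

Lemma vec4E a b c d : ((vec4 a b c d) 0 0 = a) * ((vec4 a b c d) 0 1 = b) *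
  ((vec4 a b c d) 0 2 = c) * ((vec4 a b c d) 0 3 = d).
Proof. by rewrite !mxE. Qed.

Lemma ord4P (P : 'I_4 -> Prop) : P 0 -> P 1 -> P 2 -> P 3 -> forall i, P i.
Proof.
move=> P0 P1 P2 P3 [[|[|[|[|//]]]] i].
- by have -> : Ordinal i = 0 by exact: val_inj.
- by have -> : Ordinal i = 1 by exact: val_inj.
- by have -> : Ordinal i = 2 by exact: val_inj.
- by have -> : Ordinal i = 3 by exact: val_inj.
Qed.

Lemma ord2P (P : 'I_2 -> Prop) : P 0 -> P 1 -> forall i, P i.
Proof.
move=> P0 P1 [[|[|//]] i].
- by have -> : Ordinal i = 0 by exact: val_inj.
- by have -> : Ordinal i = 1 by exact: val_inj.
Qed.

Lemma lorentzC (x y : 'rV[R]_4) : lorentz x y = lorentz y x.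
Proof. by rewrite /lorentz; ring. Qed.

Lemma lorentzDl (x y z : 'rV[R]_4) : lorentz (x + y) z = lorentz x z + lorentz y z.
Proof. by rewrite /lorentz !mxE; ring. Qed.

Lemma lorentzZl (a : R) (x z : 'rV[R]_4) : lorentz (a *: x) z = a * lorentz x z.
Proof. by rewrite /lorentz !mxE; ring. Qed.

Lemma lorentzDr (x y z : 'rV[R]_4) : lorentz z (x + y) = lorentz z x + lorentz z y.
Proof. by rewrite !(lorentzC z) lorentzDl. Qed.

Lemma lorentzZr (a : R) (x z : 'rV[R]_4) : lorentz z (a *: x) = a * lorentz z x.
Proof. by rewrite !(lorentzC z) lorentzZl. Qed.

(* The light-like vector x with herm x = (u, v)^T (conj u, conj v). *)
Definition nullv (u v : C) : 'rV[R]_4 :=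
  vec4 ((re u ^+ 2 + im u ^+ 2 + (re v ^+ 2 + im v ^+ 2)) / 2)
       (re u * re v + im u * im v) (im u * re v - re u * im v)
       ((re u ^+ 2 + im u ^+ 2 - (re v ^+ 2 + im v ^+ 2)) / 2).

(** The differential of [nullv] at [(u, v)] applied to [(du, dv)]. *)
Definition dnullv (u v du dv : C) : 'rV[R]_4 :=
  vec4 (re u * re du + im u * im du + (re v * re dv + im v * im dv))
       (re du * re v + im du * im v + (re u * re dv + im u * im dv))
       (im du * re v - re du * im v + (im u * re dv - re u * im dv))
       (re u * re du + im u * im du - (re v * re dv + im v * im dv)).

Lemma herm_nullv (u v : C) : herm (nullv u v) =
  \matrix_(i, j) ((if i == 0 then u else v) *
                  (if j == 0 then u else v)^*).
Proof.
apply/matrixP; apply: ord2P; apply: ord2P; rewrite !mxE /=.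
all: case: u => u1 u2; case: v => v1 v2; apply: eqC; by rewrite /=; field.
Qed.

Variables (a b c d : C).
(* The frame is ((a, b), (c, d)), with columns (a, c) and (b, d). *)
Let D2 := re (a * d - b * c) ^+ 2 + im (a * d - b * c) ^+ 2.

Lemma lorentz_nullv : lorentz (nullv a c) (nullv b d) = - D2 / 2.
Proof.
rewrite /lorentz !vec4E /D2 !reimE.
by case: a b c d => [? ?] [? ?] [? ?] [? ?] /=; field.
Qed.

Lemma lorentz_nullv0 : lorentz (nullv a c) (nullv a c) = 0.
Proof.
rewrite /lorentz !vec4E.
by case: a c => [? ?] [? ?] /=; field.
Qed.

(** Increments [b * p], [d * p] are those of an off-diagonal logarithmic derivative: each column
    moves in the direction of the other. *)
Lemma lorentz_nullv_dnullv (p : C) :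
  lorentz (dnullv a c (b * p) (d * p)) (nullv a c) = 0.
Proof.
rewrite /lorentz !vec4E !reimE.
by case: a b c d p => [? ?] [? ?] [? ?] [? ?] [? ?] /=; field.
Qed.

Lemma lorentz_nullv_dnullv' (p : C) :
  lorentz (dnullv a c (b * p) (d * p)) (nullv b d) = 0.
Proof.
rewrite /lorentz !vec4E !reimE.
by case: a b c d p => [? ?] [? ?] [? ?] [? ?] [? ?] /=; field.
Qed.

Lemma lorentz_dnullv (p q : C) :
  lorentz (dnullv a c (b * p) (d * p)) (dnullv a c (b * q) (d * q)) =
  D2 * re (p * q^*).
Proof.
rewrite /lorentz !vec4E /D2 !reimE.
by case: a b c d p q => [? ?] [? ?] [? ?] [? ?] [? ?] [? ?] /=; ring.
Qed.

Lemma lorentz_dnullv_mixed (p r : C) :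
  lorentz (dnullv a c (b * p) (d * p)) (dnullv b d (a * r) (c * r)) =
  D2 * re (p * r).
Proof.
rewrite /lorentz !vec4E /D2 !reimE.
by case: a b c d p r => [? ?] [? ?] [? ?] [? ?] [? ?] [? ?] /=; ring.
Qed.

End LorentzAlgebra.

Section NullCurves.
Variable R : realType.
Local Notation C := (Cplane R).

Lemma has_pd_nullv (u v : C -> C) (z du dv : C) i :
  is_derive z (1 : C) u du -> is_derive z (1 : C) v dv ->
  has_pd i (fun w => nullv (u w) (v w)) z
    (dnullv (u z) (v z) (dir R i * du) (dir R i * dv)).
Proof.
move=> /(is_derive_has_pd i)[ur ui] /(is_derive_has_pd i)[vr vi].
pose rw := fun w => re (u w); pose iw := fun w => im (u w).
apply: has_pd_mx => r; rewrite ord1; apply: ord4P; rewrite vec4E.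
- under eq_fun do rewrite vec4E.
  apply: has_pd_eq.
    apply: has_pdM; last exact: has_pd_cst.
    by apply: has_pdD; (apply: has_pdD; apply: has_pdX; eassumption).
  by rewrite /=; field.
- under eq_fun do rewrite vec4E.
  apply: has_pd_eq.
    by apply: has_pdD; apply: has_pdM; eassumption.
  by rewrite /=; ring.
- under eq_fun do rewrite vec4E.
  apply: has_pd_eq.
    by apply: has_pdB; apply: has_pdM; eassumption.
  by rewrite /=; ring.
- under eq_fun do rewrite vec4E.
  apply: has_pd_eq.
    apply: has_pdM; last exact: has_pd_cst.
    by apply: has_pdB; (apply: has_pdD; apply: has_pdX; eassumption).
  by rewrite /=; field.
Qed.

End NullCurves.

(** * Curvature of the metrics |om dz + conj(th dz)|^2 *)

Section FlatMetric.
Variable R : realType.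
Local Notation C := (Cplane R).

Lemma sum2E (V : nmodType) (F : 'I_2 -> V) : \sum_(i < 2) F i = F 0 + F 1.
Proof.
rewrite !big_ord_recl big_ord0 addr0; congr (F _ + F _); exact: val_inj.
Qed.

Lemma invmx2 (A : 'M[R]_2) : A 0 0 * A 1 1 - A 0 1 * A 1 0 != 0 ->
  invmx A = (A 0 0 * A 1 1 - A 0 1 * A 1 0)^-1 *:
    \matrix_(i, j) if i == 0 then if j == 0 then A 1 1 else - A 0 1
                   else if j == 0 then - A 1 0 else A 0 0.
Proof.
move=> d0; set d := (X in X^-1); set B := (X in d^-1 *: X).
have AB : A *m (d^-1 *: B) = 1%:M.
  by apply/matrixP; apply: ord2P; apply: ord2P;
    rewrite !mxE sum2E /B !mxE /= /d; field.
by have [uA _] := mulmx1_unit AB; rewrite -[RHS](mulKmx uA) AB mulmx1.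
Qed.

(* The matrix of |om dz + conj (th dz)|^2. *)
Definition flat_form (om th : C) : 'M[R]_2 :=
  \matrix_(i, j) re ((dir R i * om + (dir R i * th)^*) *
                     (dir R j * om + (dir R j * th)^*)^*).

Lemma dirE (z : C) : (re (dir R 0 * z) = re z) * (im (dir R 0 * z) = im z) *
  (re (dir R 1 * z) = - im z) * (im (dir R 1 * z) = re z).
Proof. by rewrite /dir /= !reimE /= !mul1r !mul0r sub0r addr0 add0r subr0. Qed.

Lemma flat_formE (om th : C) :
  (flat_form om th 0 0 = ((re om + re th) ^+ 2 + (im om - im th) ^+ 2)%R) *
  (flat_form om th 0 1 = (- 2 * (re om * im th + im om * re th))%R) *
  (flat_form om th 1 0 = (- 2 * (re om * im th + im om * re th))%R) *
  (flat_form om th 1 1 = ((re om - re th) ^+ 2 + (im om + im th) ^+ 2)%R).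
Proof.
rewrite !mxE !re_mulE !(re_addE, im_addE, re_conjE, im_conjE) !dirE.
by move: (re om) (im om) (re th) (im th) => a1 a2 b1 b2; repeat split; ring.
Qed.

Definition cnorm2 (z : C) : R := re z ^+ 2 + im z ^+ 2.

(** [p1], [p2] are the real and imaginary parts of conj(om) om' - conj(th) th', and [r1], [r2] those
    of om th' - om' th, all divided by |om|^2 - |th|^2. *)
Definition flat_christoffel (om th om' th' : C) (k i j : 'I_2) : R :=
  let D := cnorm2 om - cnorm2 th in
  let p1 := (re om * re om' + im om * im om' - re th * re th' - im th * im th') / D in
  let p2 := (re om * im om' - im om * re om' - re th * im th' + im th * re th') / D in
  let r1 := (re om * re th' - im om * im th' - re om' * re th + im om' * im th) / D in
  let r2 := (re om * im th' + im om * re th' - re om' * im th - im om' * re th) / D in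
  if k == 0 then
    if i == 0 then if j == 0 then p1 + r1 else - (p2 + r2)
    else if j == 0 then - (p2 + r2) else - (p1 + r1)
  else
    if i == 0 then if j == 0 then p2 - r2 else p1 - r1
    else if j == 0 then p1 - r1 else - (p2 - r2).

Lemma christoffel_flat (g : C -> 'M[R]_2) (om th : C -> C) (om' th' w : C) k i j :
  (\forall z \near w, g z = flat_form (om z) (th z)) ->
  is_derive w (1 : C) om om' -> is_derive w (1 : C) th th' ->
  cnorm2 (om w) - cnorm2 (th w) != 0 ->
  christoffel g k i j w = flat_christoffel (om w) (th w) om' th' k i j.
Proof.
move=> gE dom dth D0.
have pdg l a b : pd l (fun z => g z a b) w =
    pd l (fun z => flat_form (om z) (th z) a b) w.
  by apply: pd_near; apply: filterS gE => z ->.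
have or l := (is_derive_has_pd l dom).1.
have oi l := (is_derive_has_pd l dom).2.
have tr l := (is_derive_has_pd l dth).1.
have ti l := (is_derive_has_pd l dth).2.
have pd00 l : pd l (fun z => flat_form (om z) (th z) 0 0) w =
    2 * (re (om w) + re (th w)) * (re (dir R l * om') + re (dir R l * th')) +
    2 * (im (om w) - im (th w)) * (im (dir R l * om') - im (dir R l * th')).
  under eq_fun do rewrite flat_formE.
  apply: has_pdE; apply: has_pd_eq.
    apply: has_pdD; apply: has_pdX; [apply: has_pdD|apply: has_pdB].
    - exact: or.
    - exact: tr.
    - exact: oi.
    - exact: ti.
  by rewrite /= !expr1.
have pd11 l : pd l (fun z => flat_form (om z) (th z) 1 1) w =
    2 * (re (om w) - re (th w)) * (re (dir R l * om') - re (dir R l * th')) +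
    2 * (im (om w) + im (th w)) * (im (dir R l * om') + im (dir R l * th')).
  under eq_fun do rewrite flat_formE.
  apply: has_pdE; apply: has_pd_eq.
    apply: has_pdD; apply: has_pdX; [apply: has_pdB|apply: has_pdD].
    - exact: or.
    - exact: tr.
    - exact: oi.
    - exact: ti.
  by rewrite /= !expr1.
have pd01_ l : pd l (fun z => - 2 * (re (om z) * im (th z) + im (om z) * re (th z))) w =
    - 2 * (re (dir R l * om') * im (th w) + re (om w) * im (dir R l * th') +
           im (dir R l * om') * re (th w) + im (om w) * re (dir R l * th')).
  apply: has_pdE; apply: has_pd_eq.
    apply: has_pdM; first exact: has_pd_cst.
    apply: has_pdD; apply: has_pdM; by [].
  by rewrite /=; ring.
have pd01 l : pd l (fun z => flat_form (om z) (th z) 0 1) w =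
    - 2 * (re (dir R l * om') * im (th w) + re (om w) * im (dir R l * th') +
           im (dir R l * om') * re (th w) + im (om w) * re (dir R l * th')).
  by under eq_fun do rewrite flat_formE.
have pd10 l : pd l (fun z => flat_form (om z) (th z) 1 0) w =
    - 2 * (re (dir R l * om') * im (th w) + re (om w) * im (dir R l * th') +
           im (dir R l * om') * re (th w) + im (om w) * re (dir R l * th')).
  by under eq_fun do rewrite flat_formE.
have gw := nbhs_singleton gE.
have detE : flat_form (om w) (th w) 0 0 * flat_form (om w) (th w) 1 1 -
    flat_form (om w) (th w) 0 1 * flat_form (om w) (th w) 1 0 =
    (cnorm2 (om w) - cnorm2 (th w)) ^+ 2.
  by rewrite !flat_formE /cnorm2; ring.
have [[[F00 F01] F10] F11] := flat_formE (om w) (th w).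
rewrite /christoffel sum2E gw invmx2 ?detE ?expf_neq0//.
move: (flat_form (om w) (th w)) F00 F01 F10 F11 {gw detE} => F F00 F01 F10 F11.
rewrite !mxE !pdg.
set D := cnorm2 (om w) - cnorm2 (th w) in D0 *.
(* The inverse metric brings the denominator [D ^+ 2], but every numerator is divisible by [D]. *)
have clear (A P B Q N : R) : A * P + B * Q = 2 * N * D ->
    2^-1 * ((D ^+ 2)^-1 * A * P + (D ^+ 2)^-1 * B * Q) = N / D.
  move=> E; have -> : (D ^+ 2)^-1 * A * P + (D ^+ 2)^-1 * B * Q = (A * P + B * Q) / D ^+ 2.
    by ring.
  by rewrite E; field.
have frac (x y : R) : (x / D + y / D = (x + y) / D) * (x / D - y / D = (x - y) / D) *
    (- (x / D + y / D) = - (x + y) / D) * (- (x / D - y / D) = - (x - y) / D).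
  by repeat split; ring.
rewrite /flat_christoffel -/D.
move: k i j; apply: ord2P; apply: ord2P; apply: ord2P => /=;
  rewrite [RHS]frac; apply: clear;
  rewrite /D /cnorm2 ?F00 ?F01 ?F10 ?F11 ?pd00 ?pd01 ?pd10 ?pd11 ?dirE;
  move: (re (om w)) (im (om w)) (re (th w)) (im (th w)) (re om') (im om') (re th') (im th');
  by move=> *; ring.
Qed.

End FlatMetric.

Section FlatCurvature.
Variable R : realType.
Local Notation C := (Cplane R).

(** Locally the metric is the pull-back of the Euclidean one by F + conj(H) with F' = om and H' =
    th. The vanishing is checked by differentiating the closed Christoffel symbols and clearing the
    denominators. *)
Lemma gauss_curvature_flat (g : C -> 'M[R]_2) (om th om' th' : C -> C)
    (om2 th2 z0 : C) :
  (\forall z \near z0, [/\ g z = flat_form (om z) (th z),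
     is_derive z (1 : C) om (om' z), is_derive z (1 : C) th (th' z) &
     cnorm2 (om z) - cnorm2 (th z) != 0]) ->
  is_derive z0 (1 : C) om' om2 -> is_derive z0 (1 : C) th' th2 ->
  gauss_curvature g z0 = 0.
Proof.
move=> H dom dth.
have chE k i j : \forall z \near z0, christoffel g k i j z =
    flat_christoffel (om z) (th z) (om' z) (th' z) k i j.
  have H2 := near_join H; apply: filterS H2 => w Hw.
  have [_ d1 d2 D0] := nbhs_singleton Hw.
  by apply: christoffel_flat => //; apply: filterS Hw => z [].
have [_ dom0 dth0 D0] := nbhs_singleton H.
have or l := (is_derive_has_pd l dom0).1.
have oi l := (is_derive_has_pd l dom0).2.
have tr l := (is_derive_has_pd l dth0).1.
have ti l := (is_derive_has_pd l dth0).2.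
have or' l := (is_derive_has_pd l dom).1.
have oi' l := (is_derive_has_pd l dom).2.
have tr' l := (is_derive_has_pd l dth).1.
have ti' l := (is_derive_has_pd l dth).2.
move: or oi tr ti or' oi' tr' ti'.
(* Real and imaginary parts become opaque functions, so that the rules for products and sums can be
   selected syntactically. *)
move Eo1 : (fun w => re (om w)) => o1; move Eo2 : (fun w => im (om w)) => o2.
move Et1 : (fun w => re (th w)) => t1; move Et2 : (fun w => im (th w)) => t2.
move Ep1 : (fun w => re (om' w)) => p1; move Ep2 : (fun w => im (om' w)) => p2.
move Es1 : (fun w => re (th' w)) => s1; move Es2 : (fun w => im (th' w)) => s2.
move=> or oi tr ti or' oi' tr' ti'.
pose D w := o1 w ^+ 2 + o2 w ^+ 2 - (t1 w ^+ 2 + t2 w ^+ 2).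
pose D' l := 2 * o1 z0 * re (dir R l * om' z0) + 2 * o2 z0 * im (dir R l * om' z0)
  - (2 * t1 z0 * re (dir R l * th' z0) + 2 * t2 z0 * im (dir R l * th' z0)).
have {}D0 : D z0 != 0 by move: D0; rewrite /D -Eo1 -Eo2 -Et1 -Et2.
have pdD l : has_pd l D z0 (D' l).
  apply: has_pd_eq.
    by apply: has_pdB; apply: has_pdD; apply: has_pdX; eauto.
  by rewrite /D' /= !expr1.
pose u1 w := o1 w * p1 w + o2 w * p2 w - t1 w * s1 w - t2 w * s2 w.
pose u2 w := o1 w * p2 w - o2 w * p1 w - t1 w * s2 w + t2 w * s1 w.
pose v1 w := o1 w * s1 w - o2 w * s2 w - p1 w * t1 w + p2 w * t2 w.
pose v2 w := o1 w * s2 w + o2 w * s1 w - p1 w * t2 w - p2 w * t1 w.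
pose dm (f1 f2 : C -> R) a1 a2 := f1 z0 * a2 + f2 z0 * a1 : R.
pose du1 l :=
   (dm o1 p1 (re (dir R l * om' z0)) (re (dir R l * om2)) +
    dm o2 p2 (im (dir R l * om' z0)) (im (dir R l * om2)) -
    dm t1 s1 (re (dir R l * th' z0)) (re (dir R l * th2)) -
    dm t2 s2 (im (dir R l * th' z0)) (im (dir R l * th2))).
have pdu1 l : has_pd l u1 z0 (du1 l).
  by repeat (apply: has_pdB || apply: has_pdD || apply: has_pdM); eauto.
pose du2 l :=
   (dm o1 p2 (re (dir R l * om' z0)) (im (dir R l * om2)) -
    dm o2 p1 (im (dir R l * om' z0)) (re (dir R l * om2)) -
    dm t1 s2 (re (dir R l * th' z0)) (im (dir R l * th2)) +
    dm t2 s1 (im (dir R l * th' z0)) (re (dir R l * th2))).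
have pdu2 l : has_pd l u2 z0 (du2 l).
  by repeat (apply: has_pdB || apply: has_pdD || apply: has_pdM); eauto.
pose dv1 l :=
   (dm o1 s1 (re (dir R l * om' z0)) (re (dir R l * th2)) -
    dm o2 s2 (im (dir R l * om' z0)) (im (dir R l * th2)) -
    dm p1 t1 (re (dir R l * om2)) (re (dir R l * th' z0)) +
    dm p2 t2 (im (dir R l * om2)) (im (dir R l * th' z0))).
have pdv1 l : has_pd l v1 z0 (dv1 l).
  by repeat (apply: has_pdB || apply: has_pdD || apply: has_pdM); eauto.
pose dv2 l :=
   (dm o1 s2 (re (dir R l * om' z0)) (im (dir R l * th2)) +
    dm o2 s1 (im (dir R l * om' z0)) (re (dir R l * th2)) -
    dm p1 t2 (re (dir R l * om2)) (im (dir R l * th' z0)) -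
    dm p2 t1 (im (dir R l * om2)) (re (dir R l * th' z0))).
have pdv2 l : has_pd l v2 z0 (dv2 l).
  by repeat (apply: has_pdB || apply: has_pdD || apply: has_pdM); eauto.
have pdDV l : has_pd l (fun w => (D w)^-1) z0 (- (D z0) ^- 2 * D' l).
  exact: has_pdV.
have quot (f : C -> R) df l : has_pd l f z0 df ->
    has_pd l (fun w => f w / D w) z0 ((df * D z0 - f z0 * D' l) / D z0 ^+ 2).
  by move=> fl; apply: has_pd_eq; [exact: has_pdM fl (pdDV l)|rewrite /=; field].
have pdch k i j l : pd l (christoffel g k i j) z0 = pd l (fun z =>
   flat_christoffel (om z) (th z) (om' z) (th' z) k i j) z0.
  exact: pd_near (chE k i j).
have fcE k i j : (fun z => flat_christoffel (om z) (th z) (om' z) (th' z) k i j) =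
    if k == 0 then
      if i == 0 then if j == 0 then fun z => u1 z / D z + v1 z / D z
                     else fun z => - (u2 z / D z + v2 z / D z)
      else if j == 0 then fun z => - (u2 z / D z + v2 z / D z)
           else fun z => - (u1 z / D z + v1 z / D z)
    else
      if i == 0 then if j == 0 then fun z => u2 z / D z - v2 z / D z
                     else fun z => u1 z / D z - v1 z / D z
      else if j == 0 then fun z => u1 z / D z - v1 z / D z
           else fun z => - (u2 z / D z - v2 z / D z).
  rewrite /u1 /u2 /v1 /v2 /D -Eo1 -Eo2 -Et1 -Et2 -Ep1 -Ep2 -Es1 -Es2.
  by rewrite /flat_christoffel /cnorm2; move: k i j; apply: ord2P; apply: ord2P; apply: ord2P.
have pd_uv f h (df dh : R) l : has_pd l f z0 df -> has_pd l h z0 dh ->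
    (pd l (fun z => f z / D z - h z / D z) z0 =
      (df * D z0 - f z0 * D' l) / D z0 ^+ 2 - (dh * D z0 - h z0 * D' l) / D z0 ^+ 2) *
    (pd l (fun z => - (f z / D z + h z / D z)) z0 =
      - ((df * D z0 - f z0 * D' l) / D z0 ^+ 2 + (dh * D z0 - h z0 * D' l) / D z0 ^+ 2)) *
    (pd l (fun z => - (f z / D z - h z / D z)) z0 =
      - ((df * D z0 - f z0 * D' l) / D z0 ^+ 2 - (dh * D z0 - h z0 * D' l) / D z0 ^+ 2)).
  move=> fl hl; split; first split; apply: has_pdE; do ?apply: has_pdN;
    by [apply: has_pdB; exact: quot|apply: has_pdD; exact: quot].
have curv l : curvature_tensor g l 1 0 1 z0 = 0.
  rewrite /curvature_tensor !pdch !sum2E.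
  have ch k i j := nbhs_singleton (chE k i j).
  have fc k i j := congr1 (fun F => F z0) (fcE k i j).
  rewrite !ch !fc !fcE; move: l.
  apply: ord2P; rewrite /= ?(pd_uv _ _ _ _ _ (pdu1 _) (pdv1 _)) ?(pd_uv _ _ _ _ _ (pdu2 _) (pdv2 _)).
    rewrite /du1 /du2 /dv1 /dv2 /dm /D' /u1 /u2 /v1 /v2 /dir !reimE /=.
    move: D0; rewrite /D => D0.
    rewrite -Ep1 -Ep2 -Es1 -Es2.
    by field.
  rewrite /du1 /du2 /dv1 /dv2 /dm /D' /u1 /u2 /v1 /v2 /dir !reimE /=.
  move: D0; rewrite /D => D0.
  rewrite -Ep1 -Ep2 -Es1 -Es2.
  by field.
by rewrite /gauss_curvature !sum2E !curv !mulr0 addr0 mul0r.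
Qed.

End FlatCurvature.

Section SquaredModulus.
Variable R : realType.
Local Notation C := (Cplane R).

Lemma cnorm2M (z w : C) : cnorm2 (z * w) = cnorm2 z * cnorm2 w.
Proof. by rewrite /cnorm2 !reimE; ring. Qed.

Lemma cnorm2_ge0 (z : C) : 0 <= cnorm2 z.
Proof. by rewrite addr_ge0 ?sqr_ge0. Qed.

Lemma cnorm2_eq0 (z : C) : (cnorm2 z == 0) = (z == 0).
Proof.
by rewrite paddr_eq0 ?sqr_ge0// !sqrf_eq0; case: z => x y; rewrite eq_complex.
Qed.

Lemma cnorm2_gt0 (z : C) : (0 < cnorm2 z) = (z != 0).
Proof. by rewrite lt0r cnorm2_ge0 andbT cnorm2_eq0. Qed.

Lemma cnorm2_conj (z : C) : cnorm2 (z^*) = cnorm2 z.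
Proof. by rewrite /cnorm2 !reimE sqrrN. Qed.

Lemma re_invE (z : C) : re (z^-1) = re z / cnorm2 z.
Proof. by case: z. Qed.

Lemma im_invE (z : C) : im (z^-1) = - im z / cnorm2 z.
Proof. by case: z => x y; rewrite /= mulNr. Qed.

Lemma cnorm2V (z : C) : cnorm2 (z^-1) = (cnorm2 z)^-1.
Proof.
have [->|z0] := eqVneq z 0; first by rewrite !invr0 /cnorm2 /= expr0n /= addr0 invr0.
have nz : cnorm2 z != 0 by rewrite cnorm2_eq0.
by apply: (mulfI nz); rewrite -cnorm2M !mulfV// /cnorm2 /= expr0n /= addr0 expr1n.
Qed.

Lemma has_pd_cnorm2 (f : C -> C) (z l : C) i : is_derive z (1 : C) f l ->
  has_pd i (fun w => cnorm2 (f w)) z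
    (2 * (re (f z) * re (dir R i * l) + im (f z) * im (dir R i * l))).
Proof.
move=> /(is_derive_has_pd i)[fr fi]; apply: has_pd_eq.
  by apply: has_pdD; apply: has_pdX; eassumption.
by rewrite /=; ring.
Qed.

Lemma is_derive_addr (c z : C) : is_derive z (1 : C) (fun w : C => w + c) 1.
Proof. by apply: is_derive_eq; rewrite addr0. Qed.

Lemma is_derive_continuous (f : C -> C) (z l : C) :
  is_derive z (1 : C) f l -> {for z, continuous f}.
Proof. by move=> [+ _] => /derivable1_diffP/differentiable_continuous. Qed.

Lemma sqr_sub1 (z : C) : z ^+ 2 - 1 = (z - 1) * (z + 1).
Proof. by ring. Qed.

End SquaredModulus.

(** * The logarithm of (z - 1)/(z + 1), locally *)

Section Branch.
Variable R : realType.
Local Notation C := (Cplane R).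
Variable k : R.

(** The branch of the power is regular at 0 as well, so it is studied on this larger set. *)
Definition twice_punctured : set C := [set z | z != 1 /\ z != -1].

Lemma sub_neq0 (z c : C) : z != c -> z - c != 0.
Proof. by rewrite subr_eq0. Qed.

Lemma twice_puncturedP z : twice_punctured z ->
  0 < cnorm2 (z - 1) /\ 0 < cnorm2 (z + 1).
Proof. by move=> [z1 z2]; rewrite !cnorm2_gt0 subr_eq0 addr_eq0. Qed.

Lemma open_neq (c : C) : open [set z : C | z != c].
Proof.
have -> : [set z : C | z != c] = ~` [set c].
  by apply/seteqP; split => z /= /eqP.
by apply: closed_openC; apply: accessible_closed_set1; exact: hausdorff_accessible (@norm_hausdorff _ _).
Qed.

Lemma open_twice_punctured : open twice_punctured.
Proof.
have -> : twice_punctured = [set z : C | z != 1] `&` [set z : C | z != -1] by [].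
by apply: openI; exact: open_neq.
Qed.

(** Twice the real part of log((z-1)/(z+1)), whose derivative is 2/(z^2-1). *)
Definition logq (z : C) : R := ln (cnorm2 (z - 1)) - ln (cnorm2 (z + 1)).

(* A positive multiple of (z - 1) / (z + 1). *)
Definition moebius_dir (z : C) : C := (cnorm2 z - 1) +i* (2 * im z).

Lemma moebius_dirE z : moebius_dir z = (z - 1) * (z + 1)^*.
Proof. by apply: eqC; rewrite !reimE /= /cnorm2 /=; ring. Qed.

Lemma has_pd_logq i z : twice_punctured z ->
  has_pd i logq z (2 * re (dir R i * (2 / (z ^+ 2 - 1)))).
Proof.
move=> /twice_puncturedP[A0 B0]; apply: has_pd_eq.
  apply: has_pdB; apply: has_pd_ln => //; apply: has_pd_cnorm2; exact: is_derive_addr.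
rewrite sqr_sub1 !reimE !re_invE !im_invE cnorm2M.
move: A0 B0; rewrite /cnorm2 !reimE /= !lt0r => /andP[A0 _] /andP[B0 _].
case: z A0 B0 => x y /=; rewrite subr0 addr0 => A0 B0.
by field; rewrite A0 B0.
Qed.

(** Its argument is the difference of the arguments of (z-1)/(z+1) at [z] and at [z0]. Near [z0] it
    lies in the right half-plane, where [local_arg] computes this difference by [atan]. *)
Definition rel_dir (z0 z : C) : C := moebius_dir z * (moebius_dir z0)^*.
Definition local_arg (z0 z : C) : R := atan (im (rel_dir z0 z) / re (rel_dir z0 z)).

Lemma has_pd_local_arg i z0 z : twice_punctured z ->
  twice_punctured z0 -> 0 < re (rel_dir z0 z) ->
  has_pd i (local_arg z0) z (im (dir R i * (2 / (z ^+ 2 - 1)))).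
Proof.
move=> /twice_puncturedP[A0 B0] Pz0 u0.
have {}u0 : re (rel_dir z0 z) != 0 by rewrite gt_eqF.
have n0 : cnorm2 (moebius_dir z0) != 0.
  have [Az Bz] := twice_puncturedP Pz0.
  by rewrite moebius_dirE cnorm2M cnorm2_conj mulf_neq0// gt_eqF.
have pN : has_pd i (fun w => cnorm2 w - 1 : R) z
    (2 * (re z * (i == 0)%:R + im z * (i != 0)%:R)).
  apply: has_pd_eq.
    apply: has_pdB; last exact: has_pd_cst.
    by apply: has_pdD; apply: has_pdX; [exact: has_pd_re|exact: has_pd_im].
  by rewrite /=; ring.
have pY : has_pd i (fun w : C => 2 * im w : R) z (2 * (i != 0)%:R).
  exact: has_pdZ (has_pd_im _ _).
pose c1 := re (moebius_dir z0); pose c2 := im (moebius_dir z0).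
have uE w : re (rel_dir z0 w) = (cnorm2 w - 1) * c1 + (2 * im w) * c2.
  by rewrite /rel_dir !reimE /= mulrN opprK.
have vE w : im (rel_dir z0 w) = (2 * im w) * c1 - (cnorm2 w - 1) * c2.
  by rewrite /rel_dir !reimE /= mulrN addrC.
have E : local_arg z0 = fun w => atan
    (((2 * im w) * c1 - (cnorm2 w - 1) * c2) * ((cnorm2 w - 1) * c1 + (2 * im w) * c2)^-1).
  by apply: funext => w; rewrite /local_arg uE vE.
rewrite E; move: u0; rewrite uE => u0.
apply: has_pd_eq.
  apply: (has_pd_comp (g := @atan R)).
  apply: has_pdM; last (apply: has_pdV; first exact: u0).
    by apply: has_pdB; (apply: has_pdM; [eassumption|exact: has_pd_cst]).
  by apply: has_pdD; (apply: has_pdM; [eassumption|exact: has_pd_cst]).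
move: n0; rewrite /cnorm2 -/c1 -/c2 => n0.
rewrite /= sqr_sub1 !reimE !re_invE !im_invE cnorm2M.
move: A0 B0 u0; rewrite /dir /cnorm2 !reimE /= !lt0r => /andP[A0 _] /andP[B0 _].
case: z {pN pY} A0 B0 => x y /= A0 B0 u0.
(* The left side is the squared modulus of [rel_dir], which is multiplicative; it is the denominator
   of the derivative of [atan]. *)
have E2 : ((x ^+ 2 + y ^+ 2 - 1) * c1 + 2 * y * c2) ^+ 2 +
   (2 * y * c1 - (x ^+ 2 + y ^+ 2 - 1) * c2) ^+ 2 =
   (c1 ^+ 2 + c2 ^+ 2) * (((x - 1) ^+ 2 + (y - 0) ^+ 2) * ((x + 1) ^+ 2 + (y + 0) ^+ 2)).
  by ring.
have n1 : ((x ^+ 2 + y ^+ 2 - 1) * c1 + 2 * y * c2) ^+ 2 +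
   (2 * y * c1 - (x ^+ 2 + y ^+ 2 - 1) * c2) ^+ 2 != 0.
  by rewrite E2 !mulf_neq0.
set U := _ * c1 + _ * c2 in u0 n1 E2 *; set V := _ * c1 - _ * c2 in n1 E2 *.
have -> : (1 + (V * U^-1) ^+ 2)^-1 = U ^+ 2 / (U ^+ 2 + V ^+ 2).
  field; rewrite ?u0 ?n1 //.
have H X : U ^+ 2 / (U ^+ 2 + V ^+ 2) * X = (U ^+ 2 * X) / (U ^+ 2 + V ^+ 2).
  by rewrite mulrAC.
rewrite H; apply: (canLR (mulfK n1)); rewrite E2.
case: (i == 0); rewrite /= ?mulr0 ?mulr1 ?addr0 ?add0r.
  by rewrite /U /V; move: A0 B0; rewrite subr0 addr0 => A0 B0; field; rewrite A0 B0 u0.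
by rewrite /U /V; move: A0 B0; rewrite subr0 addr0 => A0 B0; field; rewrite A0 B0 u0.
Qed.

End Branch.

(** * Rules for complex derivatives *)

Section DerivativeRules.
Variable R : realType.
Local Notation C := (Cplane R).

Definition cderiv (f : C -> C) (z l : C) := is_derive z (1 : C) f l.

Lemma cderiv_eq f z l l' : cderiv f z l -> l = l' -> cderiv f z l'.
Proof. by move=> ? <-. Qed.

Lemma cderiv_cst (c z : C) : cderiv (fun=> c) z 0.
Proof. exact: is_derive_cst. Qed.

Lemma cderiv_id (z : C) : cderiv id z 1.
Proof. exact: is_derive_id. Qed.

Lemma cderivD f g z a b : cderiv f z a -> cderiv g z b ->
  cderiv (fun w => f w + g w) z (a + b).
Proof. by move=> ? ?; exact: is_deriveD. Qed.

Lemma cderivN f z a : cderiv f z a -> cderiv (fun w => - f w) z (- a).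
Proof. by move=> ?; exact: is_deriveN. Qed.

Lemma cderivB f g z a b : cderiv f z a -> cderiv g z b ->
  cderiv (fun w => f w - g w) z (a - b).
Proof. by move=> ? ?; exact: is_deriveB. Qed.

Lemma cderivM f g z a b : cderiv f z a -> cderiv g z b ->
  cderiv (fun w => f w * g w) z (f z * b + g z * a).
Proof. by move=> fa gb; exact: (is_deriveM fa gb). Qed.

Lemma cderivX f z a n : cderiv f z a ->
  cderiv (fun w => f w ^+ n) z (n%:R * f z ^+ n.-1 * a).
Proof.
by move=> fa; have := @is_deriveX _ _ f n z 1 a fa; rewrite exprfctE.
Qed.

Lemma cderivV f z a : f z != 0 -> cderiv f z a ->
  cderiv (fun w => (f w)^-1) z (- (f z) ^- 2 * a).
Proof.
move=> f0 [Df <-]; apply: DeriveDef; first exact: derivableV.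
by rewrite deriveV.
Qed.

Lemma cderiv_near f g z l : (\forall w \near z, f w = g w) ->
  cderiv f z l -> cderiv g z l.
Proof. exact: near_eq_is_derive. Qed.

Lemma cderiv_sqr_sub1 (z : C) : cderiv (fun w : C => w ^+ 2 - 1) z (2 * z).
Proof.
apply: cderiv_eq.
  by apply: cderivB; [exact: (cderivX 2 (cderiv_id z))|exact: cderiv_cst].
by rewrite /= mulr1 subr0 expr1.
Qed.

End DerivativeRules.

Lemma has_pdMl (R : realType) i (c : R) (f : Cplane R -> R) z a :
  has_pd i f z a -> has_pd i (fun w => c * f w) z (c * a).
Proof. exact: has_pdZ. Qed.

(** * Local branches of ((z - 1)/(z + 1))^k *)

Section LocalFrame.
Variable R : realType.
Local Notation C := (Cplane R).
Variable k : R.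
Local Notation M := (thrice_punctured_plane R).
Local Notation K := (k%:C : C).

Lemma open_thrice_punctured : open M.
Proof.
have -> : M = [set z : C | z != 0] `&` @twice_punctured R.
  by apply/seteqP; split => z /=; [case|case=> ? []].
by apply: openI; [exact: open_neq|exact: open_twice_punctured].
Qed.

Lemma thrice_twice (z : C) : M z -> twice_punctured z.
Proof. by case. Qed.

(** The squared modulus of every branch of ((z-1)/(z+1))^k, single-valued because [k] is real. *)
Definition qfun (z : C) : R := expR (k * logq z).

(** Near [z0], a branch of ((z-1)/(z+1))^k up to a constant of modulus 1, normalised to have
    argument [psi] at [z0]. *)
Definition eta (z0 : C) (psi : R) (z : C) : C :=
  (expR (k / 2 * logq z) * cos (psi + k * local_arg z0 z)) +i*
  (expR (k / 2 * logq z) * sin (psi + k * local_arg z0 z)).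

Lemma cnorm2_polar (r t : R) : cnorm2 ((r * cos t) +i* (r * sin t) : C) = r ^+ 2.
Proof. by rewrite /cnorm2 /= !exprMn -mulrDr cos2Dsin2 mulr1. Qed.

Lemma cnorm2_eta z0 psi z : cnorm2 (eta z0 psi z) = qfun z.
Proof.
by rewrite /eta cnorm2_polar /qfun expr2 -expRD; congr expR; field.
Qed.

Lemma qfun_gt0 z : 0 < qfun z.
Proof. exact: expR_gt0. Qed.

Lemma eta_neq0 z0 psi z : eta z0 psi z != 0.
Proof. by rewrite -cnorm2_eq0 cnorm2_eta gt_eqF// qfun_gt0. Qed.

Lemma rel_dir_self (z0 : C) : twice_punctured z0 -> 0 < re (rel_dir z0 z0).
Proof.
move=> /twice_puncturedP[A0 B0].
have -> : re (rel_dir z0 z0) = cnorm2 (moebius_dir z0).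
  by rewrite /rel_dir /cnorm2 !reimE; ring.
by rewrite moebius_dirE cnorm2M cnorm2_conj mulr_gt0.
Qed.

Lemma continuous_cnorm2 (c : C) : continuous (fun z : C => cnorm2 (z + c)).
Proof.
move=> z.
have ac : {for z, continuous (fun w : C => w + c)}.
  exact: is_derive_continuous (is_derive_addr c z).
have rc : {for z, continuous (fun w : C => re (w + c))}.
  by apply: (@continuous_comp _ _ _ (fun w : C => w + c) re) => //; exact: re_continuous.
have ic : {for z, continuous (fun w : C => im (w + c))}.
  by apply: (@continuous_comp _ _ _ (fun w : C => w + c) im) => //; exact: im_continuous.
exact: (continuousD (continuousM rc rc) (continuousM ic ic)).
Qed.

Lemma continuous_moebius_dir : continuous (@moebius_dir R : C -> C).
Proof.
move=> z.
have nc : {for z, continuous (@cnorm2 R)}.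
  by have := @continuous_cnorm2 0 z; under eq_fun do rewrite addr0.
have rc : {for z, continuous (fun w : C => cnorm2 w - 1 : R)}.
  by apply: continuousB => //; exact: cst_continuous.
have ic : {for z, continuous (fun w : C => 2 * im w : R)}.
  by apply: continuousM; [exact: cst_continuous|exact: im_continuous].
exact: (@continuous_reim R C (@moebius_dir R : C -> C) z rc ic).
Qed.

Lemma near_rel_dir (z0 : C) : twice_punctured z0 ->
  \forall z \near z0, twice_punctured z /\ 0 < re (rel_dir z0 z).
Proof.
move=> Mz0; apply: filterI.
  exact: open_nbhs_nbhs (conj (@open_twice_punctured R) Mz0).
have rc : {for z0, continuous (fun z => re (rel_dir z0 z))}.
  apply: (@continuous_comp _ _ _ (rel_dir z0) re); last exact: re_continuous.
  apply: (@continuousM _ _ (@moebius_dir R : C -> C) (fun=> (moebius_dir z0)^*)).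
    exact: continuous_moebius_dir.
  exact: cst_continuous.
have := @cvgr_gt _ _ (nbhs z0) (nbhs_filter z0) _ _ rc _ (rel_dir_self Mz0).
exact.
Qed.

Lemma has_pd_eta i (z0 : C) psi (z : C) : twice_punctured z ->
  twice_punctured z0 -> 0 < re (rel_dir z0 z) ->
  has_pd i (fun w => re (eta z0 psi w)) z
    (re (dir R i * (eta z0 psi z * (K * (2 / (z ^+ 2 - 1)))))) /\
  has_pd i (fun w => im (eta z0 psi w)) z
    (im (dir R i * (eta z0 psi z * (K * (2 / (z ^+ 2 - 1)))))).
Proof.
move=> Mz Mz0 u0.
have lp := has_pd_logq i Mz.
have ap := has_pd_local_arg i Mz Mz0 u0.
have ep : has_pd i (fun w => expR (k / 2 * logq w)) z
    (expR (k / 2 * logq z) * (k * re (dir R i * (2 / (z ^+ 2 - 1))))).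
  apply: has_pd_eq.
    by apply: has_pd_expR; exact: (has_pdMl (k / 2) lp).
  by field.
have fp : has_pd i (fun w => psi + k * local_arg z0 w) z
    (k * im (dir R i * (2 / (z ^+ 2 - 1)))).
  apply: has_pd_eq.
    by apply: has_pdD; [exact: has_pd_cst|exact: (has_pdMl k ap)].
  by rewrite add0r.
have cp := has_pd_comp (g := @cos R) fp (is_derive_cos _).
have sp := has_pd_comp (g := @sin R) fp (is_derive_sin _).
split; apply: has_pd_eq.
- exact: (has_pdM ep cp).
- have -> : dir R i * (eta z0 psi z * (K * (2 / (z ^+ 2 - 1)))) =
    eta z0 psi z * (K * (dir R i * (2 / (z ^+ 2 - 1)))) by ring.
  by set L := dir R i * (2 / _); rewrite !reimE /=; ring.
- exact: (has_pdM ep sp).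
- have -> : dir R i * (eta z0 psi z * (K * (2 / (z ^+ 2 - 1)))) =
    eta z0 psi z * (K * (dir R i * (2 / (z ^+ 2 - 1)))) by ring.
  by set L := dir R i * (2 / _); rewrite !reimE /=; ring.
Qed.

Lemma continuous_eta (z0 : C) psi (z : C) : twice_punctured z ->
  twice_punctured z0 -> 0 < re (rel_dir z0 z) ->
  {for z, continuous (eta z0 psi)}.
Proof.
move=> Mz Mz0 u0.
have lc : {for z, continuous (@logq R)}.
  have [A0 B0] := twice_puncturedP Mz.
  apply: continuousB; (apply: (@continuous_comp _ _ _ _ (@ln R));
    [exact: continuous_cnorm2|exact: continuous_ln]).
have ac : {for z, continuous (local_arg z0)}.
  apply: (@continuous_comp _ _ _ _ (@atan R)); last exact: continuous_atan.
  have rc : {for z, continuous (rel_dir z0)}.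
    apply: (@continuousM _ _ (@moebius_dir R : C -> C) (fun=> (moebius_dir z0)^*)).
      exact: continuous_moebius_dir.
    exact: cst_continuous.
  apply: continuousM.
    by apply: (@continuous_comp _ _ _ (rel_dir z0) im) => //; exact: im_continuous.
  apply: continuousV; first by rewrite gt_eqF.
  by apply: (@continuous_comp _ _ _ (rel_dir z0) re) => //; exact: re_continuous.
have ec : {for z, continuous (fun w => expR (k / 2 * logq w))}.
  apply: (@continuous_comp _ _ _ _ (@expR R)); last exact: continuous_expR.
  by apply: continuousM => //; exact: cst_continuous.
have fc : {for z, continuous (fun w => psi + k * local_arg z0 w)}.
  apply: continuousD; first exact: cst_continuous.
  by apply: continuousM => //; exact: cst_continuous.
apply: continuous_reim.
  apply: (@continuousM _ _ (fun w => expR (k / 2 * logq w))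
    (fun w => cos (psi + k * local_arg z0 w)) z) => //.
  by apply: (@continuous_comp _ _ _ _ (@cos R)) => //; exact: continuous_cos.
apply: (@continuousM _ _ (fun w => expR (k / 2 * logq w))
    (fun w => sin (psi + k * local_arg z0 w)) z) => //.
by apply: (@continuous_comp _ _ _ _ (@sin R)) => //; exact: continuous_sin.
Qed.

Lemma cderiv_eta (z0 : C) psi : twice_punctured z0 ->
  \forall z \near z0,
    cderiv (eta z0 psi) z (eta z0 psi z * (K * (2 / (z ^+ 2 - 1)))).
Proof.
(* [cauchy_riemann] asks for the partials on a neighbourhood of each [z] near [z0]. *)
move=> Mz0; have := near_join (near_rel_dir Mz0); apply: filterS => z Hz.
have [Mz u0] := nbhs_singleton Hz.
apply: (@cauchy_riemann _ (eta z0 psi)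
  (fun z => eta z0 psi z * (K * (2 / (z ^+ 2 - 1))))).
- by apply: filterS Hz => w [Mw uw] i; exact: has_pd_eta.
- exact: continuous_eta.
- apply: continuousM; first exact: continuous_eta.
  apply: continuousM; first exact: cst_continuous.
  have z10 : z ^+ 2 - 1 != 0.
    by rewrite sqr_sub1 -cnorm2_eq0 cnorm2M mulf_neq0// gt_eqF//;
       case: (twice_puncturedP Mz).
  have D := cderivM (cderiv_cst 2 z)
    (@cderivV _ (fun w => w ^+ 2 - 1) z _ z10 (cderiv_sqr_sub1 z)).
  exact: is_derive_continuous D.
Qed.

End LocalFrame.

(** * Smoothness of complex and vector-valued expressions *)

Section ComplexSmoothness.
Variable R : realType.
Local Notation C := (Cplane R).
Variable M : set C.
Hypothesis oM : open M.

Definition csmooth (h : C -> C) :=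
  smooth M (fun z => re (h z) : R) /\ smooth M (fun z => im (h z) : R).

Lemma csmooth_cst (c : C) : csmooth (fun=> c).
Proof. by split=> k; exact: Ck_cst. Qed.

Lemma csmooth_id : csmooth id.
Proof. by split=> k; [exact: Ck_re|exact: Ck_im]. Qed.

Lemma csmoothD f g : csmooth f -> csmooth g -> csmooth (fun z => f z + g z).
Proof.
move=> [f1 f2] [g1 g2]; split=> k.
  by apply: (Ck_ext oM _ (CkD oM (f1 k) (g1 k))) => z _; rewrite reimE.
by apply: (Ck_ext oM _ (CkD oM (f2 k) (g2 k))) => z _; rewrite reimE.
Qed.

Lemma csmoothM f g : csmooth f -> csmooth g -> csmooth (fun z => f z * g z).
Proof.
move=> [f1 f2] [g1 g2]; split=> k.
  apply: (Ck_ext oM _ (CkD oM (CkM oM (f1 k) (g1 k)) (CkN oM (CkM oM (f2 k) (g2 k))))).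
  by move=> z _; rewrite reimE.
apply: (Ck_ext oM _ (CkD oM (CkM oM (f1 k) (g2 k)) (CkM oM (f2 k) (g1 k)))).
by move=> z _; rewrite reimE.
Qed.

Lemma csmoothX f n : csmooth f -> csmooth (fun z => f z ^+ n).
Proof.
move=> cf; elim: n => [|n IH]; first exact: csmooth_cst.
have E : (fun z => f z ^+ n.+1) = (fun z => f z * f z ^+ n).
  by apply: funext => z; rewrite exprS.
by rewrite E; exact: csmoothM.
Qed.

Lemma smooth_cnorm2 f : csmooth f -> smooth M (fun z => cnorm2 (f z) : R).
Proof. by move=> [f1 f2] k; apply: CkD => //; apply: CkM. Qed.

Lemma csmoothV f : (forall z, M z -> f z != 0) -> csmooth f ->
  csmooth (fun z => (f z)^-1).
Proof.
move=> f0 cf; have [f1 f2] := cf.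
have nV k : Ck k M (fun z => (cnorm2 (f z))^-1).
  apply: CkV => //; last exact: smooth_cnorm2.
  by move=> z /f0; rewrite cnorm2_eq0.
split=> k.
  by apply: (Ck_ext oM _ (CkM oM (f1 k) (nV k))) => z _; rewrite re_invE.
apply: (Ck_ext oM _ (CkM oM (CkN oM (f2 k)) (nV k))) => z _.
by rewrite im_invE.
Qed.

Lemma smooth_nullv f g : csmooth f -> csmooth g ->
  smooth M (fun z => nullv (f z) (g z)).
Proof.
move=> cf cg k; have [f1 f2] := cf; have [g1 g2] := cg.
have nf := smooth_cnorm2 cf k; have ng := smooth_cnorm2 cg k.
apply: Ck_mx => // a; rewrite ord1; apply: ord4P.
- by apply: (Ck_ext oM _ (CkM oM (CkD oM nf ng) (Ck_cst oM k (2^-1 : R)))) => z _; rewrite vec4E.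
- apply: (Ck_ext oM _ (CkD oM (CkM oM (f1 k) (g1 k)) (CkM oM (f2 k) (g2 k)))) => z _.
  by rewrite vec4E.
- apply: (Ck_ext oM _ (CkD oM (CkM oM (f2 k) (g1 k)) (CkN oM (CkM oM (f1 k) (g2 k))))).
  by move=> z _; rewrite vec4E.
- apply: (Ck_ext oM _ (CkM oM (CkD oM nf (CkN oM ng)) (Ck_cst oM k (2^-1 : R)))) => z _.
  by rewrite vec4E.
Qed.

Lemma CkZf m n k (h : C -> R) (F : C -> 'M[R]_(m.+1, n.+1)) :
  Ck k M h -> Ck k M F -> Ck k M (fun z => h z *: F z).
Proof.
elim: k h F => [|k IH] h F hk Fk.
  split=> // z Mz; apply: continuousZ.
    exact: Ck_continuous hk Mz.
  exact: Ck_continuous Fk Mz.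
apply: (CkS_intro oM (d := fun i z => h z *: pd i F z + pd i h z *: F z)).
- move=> z Mz; apply: continuousZ.
    exact: Ck_continuous hk Mz.
  exact: Ck_continuous Fk Mz.
- move=> i z Mz; apply: has_pd_mx => a b.
  have Fab := pd_mx (has_pd_ex (CkS_has_pd i Fk Mz)) a b.
  apply: has_pd_eq.
    under eq_fun do rewrite mxE.
    exact: (has_pdM (CkS_has_pd i hk Mz) Fab).
  by rewrite !mxE [F z a b * _]mulrC.
- by move=> i; apply: CkD => //; apply: IH; by [exact: CkW|exact: CkS_pd].
Qed.

End ComplexSmoothness.

(** * The explicit frame and its logarithmic derivative *)

Section Surface.
Variable R : realType.
Local Notation C := (Cplane R).
Variable k : R.
Local Notation M := (thrice_punctured_plane R).
Local Notation K := (k%:C : C).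

(* The entries of the lift, for a value h of ((z - 1) / (z + 1)) ^ k. *)
Definition e11 (h z : C) : C := z ^+ 2 / ((z ^+ 2 - 1) * h).
Definition e12 (h z : C) : C := h * (K * z + 1).
Definition e21 (h z : C) : C := ((z ^+ 2 - 1) * h)^-1.
Definition e22 (h z : C) : C := h * ((z + K) / z).

(** The off-diagonal entries of E^{-1} dE/dz: the first column moves by [omega] times the second,
    the second by [theta] times the first. *)
Definition omega (h z : C) : C := - 2 * z / ((z ^+ 2 - 1) * h) ^+ 2.
Definition theta (h z : C) : C := h ^+ 2 * (K * (z ^+ 2 + 2 * K * z + 1) / z ^+ 2).

Lemma thriceP z : M z -> z != 0 /\ z ^+ 2 - 1 != 0.
Proof.
by move=> [z0 z1 z2]; rewrite z0 sqr_sub1 mulf_neq0 ?subr_eq0 ?addr_eq0.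
Qed.

Lemma det_frame h z : M z -> h != 0 ->
  e11 h z * e22 h z - e12 h z * e21 h z = 1.
Proof.
move=> /thriceP[z0 z1] h0; rewrite /e11 /e22 /e12 /e21.
by field; rewrite z0 h0 z1.
Qed.

Section Frame.
Variables (h : C -> C) (z : C).
Hypotheses (Mz : M z) (h0 : h z != 0)
  (dh : cderiv h z (h z * (K * (2 / (z ^+ 2 - 1))))).

Let dz : cderiv id z 1 := cderiv_id z.
Let dl : cderiv (fun w => K * w + 1) z K.
Proof.
apply: cderiv_eq.
  by apply: cderivD; [apply: cderivM; [exact: cderiv_cst|exact: dz]|exact: cderiv_cst].
by rewrite /=; ring.
Qed.
Let dg : cderiv (fun w => (w ^+ 2 - 1) * h w) z (h z * (2 * z + 2 * K)).
Proof.
have [z0 z1] := thriceP Mz.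
apply: cderiv_eq; first exact: (cderivM (cderiv_sqr_sub1 z) dh).
by rewrite /=; field.
Qed.
Let g0 : (z ^+ 2 - 1) * h z != 0.
Proof. by have [z0 z1] := thriceP Mz; rewrite mulf_neq0. Qed.

Lemma cderiv_e21 :
  cderiv (fun w => e21 (h w) w) z (e22 (h z) z * omega (h z) z).
Proof.
have [z0 z1] := thriceP Mz.
apply: cderiv_eq; first exact: (@cderivV _ (fun w => (w ^+ 2 - 1) * h w) z _ g0 dg).
by rewrite /e22 /omega; field; rewrite z0 h0 z1.
Qed.

Lemma cderiv_e11 :
  cderiv (fun w => e11 (h w) w) z (e12 (h z) z * omega (h z) z).
Proof.
have [z0 z1] := thriceP Mz.
apply: cderiv_eq; first exact: (@cderivM _ (fun w => w ^+ 2) (fun w => e21 (h w) w) z _ _ (cderivX 2 dz) cderiv_e21).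
by rewrite /e12 /e21 /e22 /omega /=; field; rewrite z0 h0 z1.
Qed.

Lemma cderiv_e12 :
  cderiv (fun w => e12 (h w) w) z (e11 (h z) z * theta (h z) z).
Proof.
have [z0 z1] := thriceP Mz.
apply: cderiv_eq; first exact: (@cderivM _ h (fun w => K * w + 1) z _ _ dh dl).
by rewrite /e11 /theta /=; field; rewrite z0 h0 z1.
Qed.

Lemma cderiv_e22 :
  cderiv (fun w => e22 (h w) w) z (e21 (h z) z * theta (h z) z).
Proof.
have [z0 z1] := thriceP Mz.
apply: cderiv_eq.
  apply: (@cderivM _ h (fun w => (w + K) / w) z _ _ dh).
  apply: (@cderivM _ (fun w => w + K) (fun w => w^-1)); last exact: (@cderivV _ id z _ z0 dz).
  exact: (cderivD dz (cderiv_cst K z)).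
by rewrite /e21 /theta /=; field; rewrite z0 h0 z1.
Qed.

Lemma cderiv_omega : cderiv (fun w => omega (h w) w) z
  (omega (h z) z * (z^-1 - 2 * (2 * z + 2 * K) / (z ^+ 2 - 1))).
Proof.
have [z0 z1] := thriceP Mz.
apply: cderiv_eq.
  apply: (@cderivM _ (fun w => - 2 * w) (fun w => (((w ^+ 2 - 1) * h w) ^+ 2)^-1)).
    by apply: cderivM; [exact: cderiv_cst|exact: dz].
  apply: (@cderivV _ (fun w => ((w ^+ 2 - 1) * h w) ^+ 2)); last exact: (cderivX 2 dg).
  by rewrite expf_neq0.
by rewrite /omega /=; field; rewrite z0 h0 z1.
Qed.

Lemma cderiv_theta : cderiv (fun w => theta (h w) w) z
  (h z ^+ 2 * (4 * K / (z ^+ 2 - 1) * (K * (z ^+ 2 + 2 * K * z + 1) / z ^+ 2) +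
     - 2 * K * (K * z + 1) / z ^+ 3)).
Proof.
have [z0 z1] := thriceP Mz.
apply: cderiv_eq.
  apply: (@cderivM _ (fun w => h w ^+ 2) (fun w => K * (w ^+ 2 + 2 * K * w + 1) / w ^+ 2)
    z _ _ (cderivX 2 dh)).
  apply: (@cderivM _ (fun w => K * (w ^+ 2 + 2 * K * w + 1)) (fun w => (w ^+ 2)^-1)); last first.
    by apply: (@cderivV _ (fun w => w ^+ 2)); [rewrite expf_neq0|exact: (cderivX 2 dz)].
  apply: cderivM; first exact: cderiv_cst.
  apply: cderivD; last exact: cderiv_cst.
  apply: cderivD; first exact: (cderivX 2 dz).
  by apply: cderivM; [exact: cderiv_cst|exact: dz].
by rewrite /=; field; rewrite z0 z1.
Qed.

End Frame.

End Surface.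

(** * The front, its normal and its first fundamental form *)

Section FrontProof.
Variable R : realType.
Local Notation C := (Cplane R).
Variable k : R.
Local Notation M := (thrice_punctured_plane R).
Local Notation K := (k%:C : C).
Local Notation oM := (@open_thrice_punctured R).

(** [mu] and [nu] are the light-like vectors of the two columns of the frame, with the scalar
    depending on h taken out; only its squared modulus [qfun] is left. *)
Definition mu (z : C) : 'rV[R]_4 :=
  (cnorm2 (z ^+ 2 - 1) * qfun k z)^-1 *: nullv (z ^+ 2) 1.
Definition nu (z : C) : 'rV[R]_4 :=
  qfun k z *: nullv (K * z + 1) ((z + K) / z).
(** The front is [surf 1 1], its normal [surf 1 (-1)], and the parallel front at [t] is
    [surf (expR t) (expR (- t))]; one family treats them all. *)
Definition surf (al be : R) (z : C) : 'rV[R]_4 := al *: mu z + be *: nu z.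

Lemma lorentz_comb a b c d (x y u w : 'rV[R]_4) :
  lorentz (a *: x + b *: y) (c *: u + d *: w) =
  a * c * lorentz x u + a * d * lorentz x w + b * c * lorentz y u + b * d * lorentz y w.
Proof. by rewrite !(lorentzDl, lorentzDr, lorentzZl, lorentzZr); ring. Qed.

Definition frame (h z : C) : 'M[R[i]]_2 := \matrix_(i, j)
  if i == 0 then if j == 0 then e11 h z else e12 k h z
  else if j == 0 then e21 h z else e22 k h z.

Lemma nullvZ (c u v : C) : nullv (c * u) (c * v) = cnorm2 c *: nullv u v.
Proof.
apply/matrixP => r; rewrite ord1; apply: ord4P.
all: by rewrite [RHS]mxE !vec4E /cnorm2 !reimE; field.
Qed.

Lemma mu_frame (h z : C) : cnorm2 h = qfun k z ->
  mu z = nullv (e11 h z) (e21 h z).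
Proof.
move=> hq; rewrite /mu /e11 /e21 -hq -cnorm2M -cnorm2V.
by rewrite [z ^+ 2 / _]mulrC -[X in _ = nullv _ X]mulr1 nullvZ.
Qed.

Lemma nu_frame (h z : C) : cnorm2 h = qfun k z ->
  nu z = nullv (e12 k h z) (e22 k h z).
Proof. by move=> hq; rewrite /nu /e12 /e22 nullvZ hq. Qed.

Lemma thrice_neq0 z : M z -> z != 0 /\ z ^+ 2 - 1 != 0.
Proof. exact: thriceP. Qed.

Lemma modulus_neq0 (h z : C) : cnorm2 h = qfun k z -> h != 0.
Proof. by move=> hq; rewrite -cnorm2_eq0 hq gt_eqF// qfun_gt0. Qed.

(** Multiply the branch [eta] by the constant of modulus 1 that gives it the value [H]. Pointwise
    identities can therefore be stated for an arbitrary [H] of the right modulus, without choosing a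
    branch. *)
Lemma local_branch (z0 H : C) : M z0 -> cnorm2 H = qfun k z0 ->
  exists h : C -> C, h z0 = H /\
    \forall z \near z0, [/\ M z, cnorm2 (h z) = qfun k z &
      cderiv h z (h z * (K * (2 / (z ^+ 2 - 1))))].
Proof.
move=> Mz0 HE; pose u := H / eta k z0 0 z0.
have e0 := eta_neq0 k z0 0 z0.
exists (fun z => u * eta k z0 0 z); split; first by rewrite /u divfK.
have near1 := open_nbhs_nbhs (conj oM Mz0).
have near2 := cderiv_eta k 0 (thrice_twice Mz0).
apply: filterS2 near1 near2 => z Mz dz; split => //.
  rewrite cnorm2M /u cnorm2M cnorm2V !cnorm2_eta HE mulfV ?mul1r//.
  by rewrite gt_eqF// qfun_gt0.
apply: cderiv_eq; first exact: (cderivM (cderiv_cst u z) dz).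
by rewrite /=; ring.
Qed.

Lemma surface_pd (z H : C) i : M z -> cnorm2 H = qfun k z ->
  has_pd i mu z (dnullv (e11 H z) (e21 H z)
    (e12 k H z * (dir R i * omega H z)) (e22 k H z * (dir R i * omega H z))) /\
  has_pd i nu z (dnullv (e12 k H z) (e22 k H z)
    (e11 H z * (dir R i * theta k H z)) (e21 H z * (dir R i * theta k H z))).
Proof.
move=> Mz HE; have [h [hz near_h]] := local_branch Mz HE.
have [_ hq dh] := nbhs_singleton near_h.
have h0 := modulus_neq0 hq.
rewrite -hz; split.
  apply: (@has_pd_near _ _ _ (fun w => nullv (e11 (h w) w) (e21 (h w) w))).
    by apply: filterS near_h => w [_ hw _]; rewrite (mu_frame hw).
  rewrite ![_ * (dir R i * _)]mulrCA.
  by apply: has_pd_nullv; [exact: cderiv_e11|exact: cderiv_e21].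
apply: (@has_pd_near _ _ _ (fun w => nullv (e12 k (h w) w) (e22 k (h w) w))).
  by apply: filterS near_h => w [_ hw _]; rewrite (nu_frame hw).
rewrite ![_ * (dir R i * _)]mulrCA.
by apply: has_pd_nullv; [exact: cderiv_e12|exact: cderiv_e22].
Qed.

Lemma surf_pd (z H : C) al be i : M z -> cnorm2 H = qfun k z ->
  pd i (surf al be) z = al *: dnullv (e11 H z) (e21 H z)
    (e12 k H z * (dir R i * omega H z)) (e22 k H z * (dir R i * omega H z)) +
  be *: dnullv (e12 k H z) (e22 k H z)
    (e11 H z * (dir R i * theta k H z)) (e21 H z * (dir R i * theta k H z)).
Proof.
move=> Mz HE; have [h1 h2] := surface_pd i Mz HE.
by apply: has_pdE; apply: has_pdD; apply: has_pdZ.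
Qed.

Lemma exists_modulus z : exists H : C, cnorm2 H = qfun k z.
Proof. by exists (eta k z 0 z); rewrite cnorm2_eta. Qed.

Section Gram.
Variables (z H : C) (Mz : M z) (HE : cnorm2 H = qfun k z).
Let a := e11 H z. Let b := e12 k H z. Let c := e21 H z. Let d := e22 k H z.
Let mui i := dnullv a c (b * (dir R i * omega H z)) (d * (dir R i * omega H z)).
Let nui i := dnullv b d (a * (dir R i * theta k H z)) (c * (dir R i * theta k H z)).

Let det1 : a * d - b * c = 1.
Proof. by rewrite /a /b /c /d det_frame// (modulus_neq0 HE). Qed.
Let det1' : b * c - a * d = -1.
Proof. by rewrite -det1; ring. Qed.
Let D2 : re (a * d - b * c) ^+ 2 + im (a * d - b * c) ^+ 2 = 1.
Proof. by rewrite det1 /= expr0n /= expr1n addr0. Qed.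
Let D2' : re (b * c - a * d) ^+ 2 + im (b * c - a * d) ^+ 2 = 1.
Proof. by rewrite det1' /= oppr0 expr0n /= sqrrN expr1n addr0. Qed.

Lemma gram_mumu i j : lorentz (mui i) (mui j) =
  re ((dir R i * omega H z) * (dir R j * omega H z)^*).
Proof. by rewrite /mui lorentz_dnullv D2 mul1r. Qed.

Lemma gram_nunu i j : lorentz (nui i) (nui j) =
  re ((dir R i * theta k H z) * (dir R j * theta k H z)^*).
Proof. by rewrite /nui lorentz_dnullv D2' mul1r. Qed.

Lemma gram_munu i j : lorentz (mui i) (nui j) =
  re ((dir R i * omega H z) * (dir R j * theta k H z)).
Proof. by rewrite /mui /nui lorentz_dnullv_mixed D2 mul1r. Qed.

Lemma gram_normal i : [/\ lorentz (mui i) (mu z) = 0, lorentz (mui i) (nu z) = 0,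
  lorentz (nui i) (mu z) = 0 & lorentz (nui i) (nu z) = 0].
Proof.
rewrite (mu_frame HE) (nu_frame HE) /mui /nui.
by rewrite !lorentz_nullv_dnullv !lorentz_nullv_dnullv'.
Qed.

Lemma gram_point : [/\ lorentz (mu z) (mu z) = 0, lorentz (nu z) (nu z) = 0 &
  lorentz (mu z) (nu z) = - 2^-1].
Proof.
rewrite (mu_frame HE) (nu_frame HE) !lorentz_nullv0 lorentz_nullv.
by rewrite D2 mulN1r.
Qed.

End Gram.

(** The differentials of [mu] and [nu] have Gram matrices |omega|^2 and |theta|^2, with cross terms
    Re(omega theta): together, an expanded square. *)
Lemma first_form_surf (z H : C) al be : M z -> cnorm2 H = qfun k z ->
  first_form (surf al be) z =
  flat_form (al%:C * omega H z) (be%:C * theta k H z).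
Proof.
move=> Mz HE; apply/matrixP => i j; rewrite !mxE !(surf_pd _ _ _ Mz HE).
rewrite !(lorentzDl, lorentzDr, lorentzZl, lorentzZr).
rewrite (gram_mumu Mz HE) (gram_nunu Mz HE) (gram_munu Mz HE).
rewrite [lorentz (dnullv (e12 _ _ _) _ _ _) _]lorentzC (gram_munu Mz HE).
case: (omega H z) => o1 o2; case: (theta k H z) => t1 t2.
by case: (dir R i) => a1 a2; case: (dir R j) => b1 b2; rewrite !reimE /=; ring.
Qed.

Lemma quad_flat_form (om th : C) (v : 'rV[R]_2) :
  quad (flat_form om th) v =
  cnorm2 (om * (v 0 0 +i* v 0 1 : C) + conjc (th * (v 0 0 +i* v 0 1 : C))).
Proof.
rewrite /quad mxE sum2E !mxE !sum2E !flat_formE /cnorm2.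
by case: om th => [a1 a2] [b1 b2]; rewrite !reimE /=; ring.
Qed.

Lemma quad_first_form f (z : C) (v : 'rV[R]_2) :
  quad (first_form f z) v = lorentz (v *m Defs.jacobian f z) (v *m Defs.jacobian f z).
Proof.
have E : v *m Defs.jacobian f z = v 0 0 *: pd 0 f z + v 0 1 *: pd 1 f z.
  by apply/matrixP => r s; rewrite ord1 !mxE sum2E !mxE.
rewrite E !(lorentzDl, lorentzDr, lorentzZl, lorentzZr).
rewrite /quad mxE sum2E !mxE !sum2E !mxE.
rewrite (lorentzC (pd 1 f z) (pd 0 f z)).
by ring.
Qed.

Lemma immersion_of_quad f (z : C) :
  (forall v, quad (first_form f z) v = 0 -> v = 0) -> immersion_at f z.
Proof.
move=> H; apply: inj_row_free => v vJ; apply: H.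
by rewrite quad_first_form vJ /lorentz !mxE; ring.
Qed.

Lemma row2_eq0 (v : 'rV[R]_2) : (v 0 0 +i* v 0 1 : C) = 0 -> v = 0.
Proof.
case=> v0 v1; apply/matrixP => i; rewrite ord1; apply: ord2P; by rewrite mxE.
Qed.

(** A null direction makes the two summands opposite, hence of equal modulus, which distinct moduli
    of [om] and [th] allow only for the zero vector. *)
Lemma quad_flat_form_eq0 (om th : C) (v : 'rV[R]_2) :
  cnorm2 om != cnorm2 th -> quad (flat_form om th) v = 0 -> v = 0.
Proof.
move=> ne; rewrite quad_flat_form => /eqP; rewrite cnorm2_eq0 => /eqP H.
apply: row2_eq0; apply/eqP; rewrite -cnorm2_eq0; apply: contraT => w0.
have : cnorm2 (om * (v 0 0 +i* v 0 1 : C)) = cnorm2 (th * (v 0 0 +i* v 0 1 : C)).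
  move/eqP: H; rewrite addr_eq0 => /eqP ->.
  by case: (th * _) => x y; rewrite /cnorm2 /= opprK sqrrN.
by rewrite !cnorm2M => /(mulIf w0) /eqP; rewrite (negPf ne).
Qed.

Lemma smooth_logq j : Ck j M (@logq R).
Proof.
have sm (c : C) : smooth M (fun z : C => cnorm2 (z + c)).
  exact: (smooth_cnorm2 oM (csmoothD oM (csmooth_id oM) (csmooth_cst oM c))).
apply: (CkD oM); last apply: (CkN oM); apply: (Ck_ln oM); try exact: sm.
  by move=> z /thrice_twice/twice_puncturedP[].
by move=> z /thrice_twice/twice_puncturedP[].
Qed.

Lemma smooth_qfun j : Ck j M (qfun k).
Proof.
by apply: (Ck_expR oM); apply: (CkM oM); [exact: (Ck_cst oM)|exact: smooth_logq].
Qed.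

Lemma smooth_mu : smooth M mu.
Proof.
have c2 : csmooth M (fun z => z ^+ 2).
  exact: (csmoothX oM 2 (csmooth_id oM)).
move=> j; apply: (CkZf oM).
  apply: (CkV oM).
    by move=> z /thrice_neq0[_ h]; rewrite mulf_neq0 ?cnorm2_eq0// gt_eqF// qfun_gt0.
  apply: (CkM oM); last exact: smooth_qfun.
  apply: (smooth_cnorm2 oM); apply: (csmoothD oM) => //.
  exact: (csmooth_cst oM).
by apply: (smooth_nullv oM) => //; exact: (csmooth_cst oM).
Qed.

Lemma smooth_nu : smooth M nu.
Proof.
have ci : csmooth M id := csmooth_id oM.
move=> j; apply: (CkZf oM); first exact: smooth_qfun.
apply: (smooth_nullv oM).
  by apply: (csmoothD oM); [apply: (csmoothM oM) => //|]; exact: (csmooth_cst oM).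
apply: (csmoothM oM); first by apply: (csmoothD oM) => //; exact: (csmooth_cst oM).
by apply: (csmoothV oM) => // z [].
Qed.

Lemma smooth_surf al be : smooth M (surf al be).
Proof.
by move=> j; apply: (CkD oM); apply: (CkZ oM); [exact: smooth_mu|exact: smooth_nu].
Qed.

Lemma hermD (x y : 'rV[R]_4) : herm (x + y) = herm x + herm y.
Proof.
by apply/matrixP; apply: ord2P; apply: ord2P; rewrite !mxE /=; apply: eqC => /=; ring.
Qed.

Lemma hermN (x : 'rV[R]_4) : herm (- x) = - herm x.
Proof.
by apply/matrixP; apply: ord2P; apply: ord2P; rewrite !mxE /=; apply: eqC => /=; ring.
Qed.

Lemma herm_surf1 (h z : C) : cnorm2 h = qfun k z ->
  herm (surf 1 1 z) = frame h z *m (frame h z ^t*)%sesqui.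
Proof.
move=> hq; rewrite /surf !scale1r hermD (mu_frame hq) (nu_frame hq) !herm_nullv.
by apply/matrixP; apply: ord2P; apply: ord2P; rewrite !mxE sum2E !mxE.
Qed.

Lemma herm_surfN (h z : C) : cnorm2 h = qfun k z ->
  herm (surf 1 (-1) z) = frame h z *m e3 R *m (frame h z ^t*)%sesqui.
Proof.
move=> hq; rewrite /surf scale1r scaleN1r hermD hermN (mu_frame hq) (nu_frame hq).
rewrite !herm_nullv.
apply/matrixP; apply: ord2P; apply: ord2P; rewrite !mxE sum2E !mxE !sum2E !mxE /=.
all: by rewrite !mulr0n !mulr1n expr0 expr1 !mulr0 addr0 add0r !mulr1 mulrN1 mulNr.
Qed.

Lemma det2E (A : 'M[R[i]]_2) : \det A = A 0 0 * A 1 1 - A 0 1 * A 1 0.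
Proof.
rewrite (expand_det_row _ 0) sum2E /cofactor !det_mx11 !mxE /=.
have -> : lift 0 0 = 1 :> 'I_2 by exact: val_inj.
have -> : lift 1 0 = 0 :> 'I_2 by exact: val_inj.
by rewrite !addn0 expr0 expr1 mul1r mulN1r mulrN.
Qed.

Lemma det_frame1 (h z : C) : M z -> cnorm2 h = qfun k z -> \det (frame h z) = 1.
Proof. by move=> Mz hq; rewrite det2E !mxE /=; exact: det_frame Mz (modulus_neq0 hq). Qed.

Lemma omega_neq0 (h z : C) : M z -> cnorm2 h = qfun k z -> omega h z != 0.
Proof.
move=> /thrice_neq0[z0 z1] /modulus_neq0 h0.
by rewrite /omega mulf_neq0 ?invr_eq0 ?expf_neq0 ?mulf_neq0// oppr_eq0 pnatr_eq0.
Qed.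

(** For the immersion property of the pair (f, n), note that (f + n)/2 = [mu] induces the metric
    |omega dz|^2, nondegenerate because [omega] has no zero on [M]. *)
Lemma surf_front : front M (surf 1 1) (surf 1 (-1)).
Proof.
split.
- exact: smooth_surf.
- exact: smooth_surf.
- move=> z Mz; have [h hq] := exists_modulus z; exists (frame h z).
    exact: det_frame1.
  exact: herm_surf1.
- move=> z Mz; have [h hq] := exists_modulus z.
  have [g1 g2 g3] := gram_point Mz hq.
  split.
  + rewrite /surf lorentz_comb g1 g2 (lorentzC (nu z)) g3.
    by field.
  + rewrite /surf lorentz_comb g1 g2 (lorentzC (nu z)) g3.
    by field.
  + move=> i; rewrite {2}/surf.
    rewrite (surf_pd _ _ _ Mz hq).
    have [h1 h2 h3 h4] := gram_normal hq i.
    rewrite lorentz_comb h1 h2 h3 h4.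
    by ring.
- move=> z Mz; have [h hq] := exists_modulus z.
  apply: inj_row_free => v; rewrite mul_mx_row -[0]row_mx0 => /eq_row_mx[vf vn].
  apply: row2_eq0; apply/eqP; rewrite -cnorm2_eq0.
  have : v *m Defs.jacobian mu z = 0.
    have E : Defs.jacobian mu z = 2^-1 *: (Defs.jacobian (surf 1 1) z + Defs.jacobian (surf 1 (-1)) z).
      apply/matrixP => i j; rewrite !mxE !(surf_pd _ _ _ Mz hq).
      by rewrite (has_pdE (surface_pd i Mz hq).1) !mxE; field.
    by rewrite E -scalemxAr mulmxDr vf vn addr0 scaler0.
  move=> vJ; have : quad (first_form mu z) v = 0.
    by rewrite quad_first_form vJ /lorentz !mxE; ring.
  have -> : first_form mu z = flat_form (omega h z) 0.
    have -> : mu = surf 1 0 by apply: funext => w; rewrite /surf scale1r scale0r addr0.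
    by rewrite (first_form_surf _ _ Mz hq) mul1r mul0r.
  rewrite quad_flat_form mul0r conjc0 addr0 cnorm2M => /eqP; rewrite mulf_eq0.
  by rewrite !cnorm2_eq0 (negPf (omega_neq0 Mz hq)).
Qed.

End FrontProof.

(** * Flatness of parallel fronts *)

Section FlatFrontProof.
Variable R : realType.
Local Notation C := (Cplane R).
Variable k : R.
Local Notation M := (thrice_punctured_plane R).
Local Notation K := (k%:C : C).
Local Notation oM := (@open_thrice_punctured R).

Lemma parallel_surf t :
  parallel_front (surf k 1 1) (surf k 1 (-1)) t = surf k (expR t) (expR (- t)).
Proof.
apply: funext => z; rewrite /parallel_front /surf.
rewrite !scale1r scaleN1r scalerDr scalerBr addrACA -scalerDl -scalerBl.
by congr (_ *: _ + _ *: _); rewrite /Defs.cosh /Defs.sinh; field.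
Qed.

Lemma cnorm2_real (c : R) (z : C) : cnorm2 (c%:C * z) = c ^+ 2 * cnorm2 z.
Proof. by rewrite cnorm2M; congr (_ * _); rewrite /cnorm2 /= expr0n addr0. Qed.

(** Moving by [t] multiplies [omega] by e^t and [theta] by e^{-t}. Since [omega] does not vanish, a
    large [t] makes the first modulus the greater one near the point, and the parallel front is then
    an immersion with flat metric. *)
Lemma surf_flat : flat_front M (surf k 1 1) (surf k 1 (-1)).
Proof.
split; first exact: surf_front.
move=> p Mp; have [H HE] := exists_modulus k p.
pose X2 := cnorm2 (omega H p); pose Y2 := cnorm2 (theta k H p).
have X0 : 0 < X2 by rewrite cnorm2_gt0 (omega_neq0 Mp HE).
have Y0 : 0 <= Y2 by exact: cnorm2_ge0.
(* With t = Y2/X2 >= 0: e^{2t} X2 >= (1 + t) X2 = X2 + Y2 > Y2 >= e^{-2t} Y2. *)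
exists (Y2 / X2); rewrite parallel_surf.
set al := expR _; set be := expR _.
have [h [hp near_h]] := local_branch Mp HE.
pose om w := al%:C * omega (h w) w; pose th w := be%:C * theta k (h w) w.
pose om' w := al%:C * (omega (h w) w * (w^-1 - 2 * (2 * w + 2 * K) / (w ^+ 2 - 1))).
pose th' w := be%:C * (h w ^+ 2 * (4 * K / (w ^+ 2 - 1) * (K * (w ^+ 2 + 2 * K * w + 1) / w ^+ 2) +
     - 2 * K * (K * w + 1) / w ^+ 3)).
have dom w : M w -> cnorm2 (h w) = qfun k w ->
    cderiv h w (h w * (K * (2 / (w ^+ 2 - 1)))) -> cderiv om w (om' w).
  move=> Mw hw dh; have := cderivM (cderiv_cst al%:C w) (cderiv_omega Mw (modulus_neq0 hw) dh).
  by rewrite mulr0 addr0.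
have dth w : M w -> cnorm2 (h w) = qfun k w ->
    cderiv h w (h w * (K * (2 / (w ^+ 2 - 1)))) -> cderiv th w (th' w).
  move=> Mw hw dh; have := cderivM (cderiv_cst be%:C w) (cderiv_theta Mw dh).
  by rewrite mulr0 addr0.
have gap : 0 < cnorm2 (om p) - cnorm2 (th p).
  rewrite subr_gt0 /om /th hp !cnorm2_real -/X2 -/Y2.
  have t0 : 0 <= Y2 / X2 by rewrite divr_ge0// ltW.
  have be1 : be ^+ 2 <= 1.
    by rewrite exprn_ile1 ?expR_ge0// -expR0 ler_expR oppr_le0.
  rewrite (le_lt_trans (_ : _ <= Y2)) ?ler_piMl//.
  rewrite -ltr_pdivrMr// /al.
  have := expR_ge1Dx (Y2 / X2); set t := Y2 / X2 in t0 *; move=> e1.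
  rewrite (lt_le_trans (_ : _ < 1 + t))//; first by lra.
  rewrite (le_trans e1)// expr2 ler_pMr ?expR_gt0//.
  by rewrite (le_trans _ e1)// lerDl.
have near_gap : \forall z \near p, 0 < cnorm2 (om z) - cnorm2 (th z).
  have [Mp' hq dh] := nbhs_singleton near_h.
  have c0 (u : C -> C) l : cderiv u p l -> {for p, continuous (fun z => cnorm2 (u z))}.
    move=> du; have uc := is_derive_continuous du.
    apply: (@continuous_comp _ _ _ u (@cnorm2 R)) => //.
    have := @continuous_cnorm2 R 0 (u p); under eq_fun do rewrite addr0; exact.
  have cc : {for p, continuous (fun z => cnorm2 (om z) - cnorm2 (th z))}.
    by apply: continuousB; [exact: c0 (dom p Mp' hq dh)|exact: c0 (dth p Mp' hq dh)].
  have := @cvgr_gt _ _ (nbhs p) (nbhs_filter p) _ _ cc _ gap.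
  exact.
have ffE z : M z -> cnorm2 (h z) = qfun k z ->
    first_form (surf k al be) z = flat_form (om z) (th z).
  by move=> Mz hz; rewrite (first_form_surf _ _ Mz hz).
apply: filterS (near_join (filterI near_h near_gap)) => w Hw.
have [[Mw hw dw] gw] := nbhs_singleton Hw.
split.
  apply: immersion_of_quad => v; rewrite ffE//; apply: quad_flat_form_eq0.
  by rewrite -subr_eq0 gt_eqF.
have [w0 w1] := thriceP Mw.
have d1 : cderiv (fun w => w ^+ 2 - 1) w (2 * w) := cderiv_sqr_sub1 w.
have d1V := @cderivV _ (fun w => w ^+ 2 - 1) w _ w1 d1.
have did := cderiv_id w.
have dpow n : cderiv (fun w => (w ^+ n)^-1) w _ :=
  @cderivV _ (fun w => w ^+ n) w _ (expf_neq0 n w0) (cderivX n did).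
have cc c := cderiv_cst c w.
have dlin (a b : C) : cderiv (fun w => a * w + b) w _ := cderivD (cderivM (cc a) did) (cc b).
(* The second derivatives are assembled from the rules; their values are inferred. *)
have dl1 : cderiv om' w _ := cderivM (cc al%:C)
  (cderivM (cderiv_omega Mw (modulus_neq0 hw) dw)
     (cderivB (@cderivV _ id w _ w0 did)
        (cderivM (cderivM (cc 2) (dlin 2 (2 * K))) d1V))).
have dl2 : cderiv th' w _ := cderivM (cc be%:C)
  (cderivM (cderivX 2 dw)
    (cderivD
      (cderivM (cderivM (cc (4 * K)) d1V)
        (cderivM (cderivM (cc K) (cderivD (cderivD (cderivX 2 did)
          (cderivM (cc (2 * K)) did)) (cc 1))) (dpow 2)))
      (cderivM (cderivM (cc (- 2 * K)) (dlin K 1)) (dpow 3)))).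
apply: (gauss_curvature_flat (om := om) (th := th) _ dl1 dl2).
apply: filterS Hw => z [[Mz hz dz] gz]; split.
- exact: ffE.
- exact: dom.
- exact: dth.
- by rewrite gt_eqF.
Qed.

End FlatFrontProof.

(** * A smooth cutoff function *)

Section Bump.
Variable R : realType.
Local Notation C := (Cplane R).

(** The functions x^{-n} e^{-1/x}, extended by 0, span a space closed under differentiation; all
    orders of smoothness of e^{-1/x} follow by one induction over the whole family. *)
Definition flat_exp (n : nat) (x : R) : R :=
  if 0 < x then x^-1 ^+ n * expR (- x^-1) else 0.

(** From e^y >= y^{n+1}/(n+1)! at y = 1/x. Applied to [n.+1], it bounds the difference quotient of
    [flat_exp n] at 0, so the derivative there is 0. *)
Lemma flat_exp_le n x : `|flat_exp n x| <= n.+1`!%:R * `|x|.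
Proof.
rewrite /flat_exp; case: ifPn => x0; last by rewrite normr0 mulr_ge0.
have y0 : 0 < x^-1 by rewrite invr_gt0.
rewrite (gtr0_norm x0) ger0_norm ?mulr_ge0 ?expR_ge0 ?exprn_ge0 ?(ltW y0)//.
rewrite expRN ler_pdivrMr ?expR_gt0//.
have := expR_ge1Dxn n (ltW y0); have f0 : (0 : R) < n.+1`!%:R by rewrite ltr0n fact_gt0.
move=> H; have {}H : x^-1 ^+ n.+1 <= n.+1`!%:R * expR x^-1.
  by rewrite mulrC -ler_pdivrMr// (le_trans _ H)// lerDr.
have -> : x^-1 ^+ n = x * x^-1 ^+ n.+1 by rewrite exprS mulrA mulfV ?gt_eqF// mul1r.
by rewrite mulrAC [leRHS]mulrC; rewrite ler_pM2l.
Qed.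

Lemma flat_expS n x : x != 0 -> x^-1 * flat_exp n x = flat_exp n.+1 x.
Proof. by move=> x0; rewrite /flat_exp; case: ifP => _; rewrite ?mulr0// exprS mulrA. Qed.

Lemma is_derive_flat_exp n (x : R) :
  is_derive x (1 : R) (flat_exp n) (- n%:R * flat_exp n.+1 x + flat_exp n.+2 x).
Proof.
have [x0|x0|->] := ltgtP x 0.
- have -> : - n%:R * flat_exp n.+1 x + flat_exp n.+2 x = 0.
    by rewrite /flat_exp ltNge ltW//= mulr0 addr0.
  apply: near_eq_is_derive (is_derive_cst (0 : R) x 1).
  near=> y; rewrite /flat_exp /cst ltNge; case: ifPn => // /negP[].
  by apply/ltW; near: y; exact: lt_nbhsl.
- have D : is_derive x (1 : R) (fun y => y^-1) (- x ^- 2).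
    have := @is_deriveV _ id x 1 1 (lt0r_neq0 x0) (is_derive_id _ _).
    by rewrite [_ *: _]mulr1.
  have DN := is_deriveN D.
  have DE : is_derive x (1 : R) (fun y => expR (- y^-1)) (expR (- x^-1) * x ^- 2).
    have := @is_derive1_comp _ (@expR R) (fun y => - y^-1) x _ _ (is_derive_expR _) DN.
    by rewrite opprK.
  have DX := @is_deriveX _ _ (fun y : R => y^-1) n x 1 _ D.
  have DM := is_deriveM DX DE.
  apply: is_derive_eq.
    apply: near_eq_is_derive DM.
    near=> y; rewrite /flat_exp (_ : (0 < y) = true); last first.
      by near: y; exact: (lt_nbhsr x0).
    by rewrite exprfctE.
  have sE (a b : R) : a *: b = a * b by [].
  rewrite /flat_exp x0 /= !sE exprfctE.
  case: n {DX DM} => [|n]; rewrite ?expr0 /=; first by field; rewrite gt_eqF.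
  by rewrite -!exprVn !exprS; field; rewrite gt_eqF.
- have E m : flat_exp m 0 = 0 by rewrite /flat_exp ltxx.
  rewrite !E mulr0 addr0.
  have lim : (fun h : R => h^-1 *: (flat_exp n (h *: (1 : R) + 0) - flat_exp n 0)) @ 0^' --> (0 : R).
    apply/cvgrPdist_le => e e0; near=> h.
    have h0 : h != 0 by near: h; exact: nbhs_dnbhs_neq.
    have sE (a b : R) : a *: b = a * b by [].
    rewrite E subr0 addr0 [h *: _]mulr1 sE flat_expS// sub0r normrN.
    rewrite (le_trans (flat_exp_le _ _))// -ler_pdivlMl ?ltr0n ?fact_gt0//.
    near: h; apply: dnbhs0_le; rewrite mulr_gt0// invr_gt0 ltr0n fact_gt0//.
  apply: DeriveDef; first by apply/cvg_ex; exists 0.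
  exact/cvg_lim.
Unshelve. all: by end_near. Qed.

Lemma flat_exp_continuous n : continuous (flat_exp n).
Proof.
move=> x; apply/differentiable_continuous/derivable1_diffP.
by case: (is_derive_flat_exp n x).
Qed.

Lemma Ck_flat_exp (M : set C) (f : C -> R) (oM : open M) n j :
  Ck j M f -> Ck j M (fun z => flat_exp n (f z)).
Proof.
elim: j n => [|j IH] n fj.
  split=> // z Mz; apply: (@continuous_comp _ _ _ f (flat_exp n)).
    exact: Ck_continuous fj Mz.
  exact: flat_exp_continuous.
apply: (CkS_intro oM (d := fun i z =>
  (- n%:R * flat_exp n.+1 (f z) + flat_exp n.+2 (f z)) * pd i f z)).
- move=> z Mz; apply: (@continuous_comp _ _ _ f (flat_exp n)).
    exact: Ck_continuous fj Mz.
  exact: flat_exp_continuous.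
- move=> i z Mz; apply: has_pd_comp (is_derive_flat_exp n (f z)).
  exact: CkS_has_pd fj Mz.
- move=> i; apply: (CkM oM); last exact: CkS_pd.
  apply: (CkD oM); last by apply: IH; exact: CkW.
  by apply: (CkM oM); [exact: (Ck_cst oM)|apply: IH; exact: CkW].
Qed.

Lemma flat_exp_ge0 n x : 0 <= flat_exp n x.
Proof.
by rewrite /flat_exp; case: ifPn => // x0; rewrite mulr_ge0 ?expR_ge0// exprn_ge0// invr_ge0 ltW.
Qed.

Lemma flat_exp0_ge x : 1 <= x -> expR (-1) <= flat_exp 0 x.
Proof.
move=> x1; rewrite /flat_exp (lt_le_trans ltr01 x1) expr0 mul1r ler_expR lerN2.
by rewrite invf_le1// (lt_le_trans ltr01 x1).
Qed.

Lemma flat_exp_eq0 n x : x <= 0 -> flat_exp n x = 0.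
Proof. by move=> x0; rewrite /flat_exp ltNge x0. Qed.

End Bump.

(** * Lengths of curves and a completeness criterion *)

Section CurveLength.
Variable R : realType.
Local Notation C := (Cplane R).

Lemma quadE (A : 'M[R]_2) v : quad A v =
  v 0 0 ^+ 2 * A 0 0 + v 0 0 * v 0 1 * (A 0 1 + A 1 0) + v 0 1 ^+ 2 * A 1 1.
Proof. by rewrite /quad mxE sum2E !mxE !sum2E; ring. Qed.

Lemma integrable_unit (f : R -> R) :
  (forall t : R, 0 <= t <= 1 -> {for t, continuous f}) ->
  (@lebesgue_measure R).-integrable `[0, 1] (EFin \o f).
Proof.
move=> fc; apply: continuous_compact_integrable; first exact: segment_compact.
by apply: continuous_in_subspaceT => t; rewrite inE /= in_itv /=; exact: fc.
Qed.

Lemma increment_le_integral (phi dphi w : R -> R) (L : R) :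
  (forall t : R, 0 <= t <= 1 -> is_derive t (1 : R) phi (dphi t)) ->
  (forall t : R, 0 <= t <= 1 -> {for t, continuous dphi}) ->
  (forall t : R, 0 <= t <= 1 -> {for t, continuous w}) ->
  (forall t : R, 0 <= t <= 1 -> `|dphi t| <= L * w t) ->
  `|phi 1 - phi 0| <= L * \int[lebesgue_measure]_(t in `[0, 1]) w t.
Proof.
move=> pd dc wc le.
have m01 : measurable (`[0, 1]%classic : set (measurableTypeR R)) by exact: measurable_itv.
have phic (t : R) : 0 <= t <= 1 -> {for t, continuous phi}.
  by move=> /pd [H _]; apply/differentiable_continuous/derivable1_diffP.
have ftc : phi 1 - phi 0 = \int[lebesgue_measure]_(t in `[0, 1]) dphi t.
  rewrite /Rintegral (@continuous_FTC2 _ dphi phi 0 1)//.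
  - by apply: continuous_in_subspaceT => t; rewrite inE /= in_itv /=; exact: dc.
  - split.
    + move=> t; rewrite in_itv /= => /andP[t0 t1].
      by case: (pd t); rewrite ?(ltW t0) ?(ltW t1).
    + by apply: cvg_at_right_filter; apply: phic; rewrite lexx ler01.
    + by apply: cvg_at_left_filter; apply: phic; rewrite lexx ler01.
  - move=> t; rewrite in_itv /= => /andP[t0 t1]; rewrite derive1E.
    by case: (pd t); rewrite ?(ltW t0) ?(ltW t1).
rewrite ftc -RintegralZl//; last exact: integrable_unit.
apply: le_trans (le_normr_Rintegral _ _) _ => //; first exact: integrable_unit.
apply: le_Rintegral => //.
- apply: integrable_unit => t t01; apply: (@continuous_comp _ _ _ dphi (fun x : R => `|x|)).
    exact: dc.
  exact: norm_continuous.
- apply: integrable_unit => t t01; apply: continuousM; first exact: cst_continuous.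
  exact: wc.
Qed.

Lemma is_derive_continuousR (f : R -> R) (t l : R) :
  is_derive t (1 : R) f l -> {for t, continuous f}.
Proof. by case=> + _ => /derivable1_diffP/differentiable_continuous. Qed.

Section Curve.
Variables (M : set C) (g : C -> 'M[R]_2) (p q : C) (c : R -> C).
Hypothesis cc : C1_curve M p q c.
Hypothesis gc : forall z, M z -> {for z, continuous g}.

Lemma velocityE t : (velocity c t 0 0 = derive1 (fun s => re (c s)) t) *
  (velocity c t 0 1 = derive1 (fun s => im (c s)) t).
Proof. by rewrite !mxE. Qed.

Lemma curve_derive t :
  is_derive t (1 : R) (fun s => re (c s)) (velocity c t 0 0) /\
  is_derive t (1 : R) (fun s => im (c s)) (velocity c t 0 1).
Proof.
have [D _ _ _ _] := cc; have [D1 D2] := D t.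
rewrite (velocityE t).1 (velocityE t).2 !derive1E; split; exact/derivableP.
Qed.

Lemma curve_continuous t : {for t, continuous c}.
Proof.
have [d1 d2] := curve_derive t.
exact: continuous_reim (is_derive_continuousR d1) (is_derive_continuousR d2).
Qed.

Lemma velocity_continuous t : {for t, continuous (fun s => velocity c s 0 0)} /\
  {for t, continuous (fun s => velocity c s 0 1)}.
Proof.
have [_ c1 c2 _ _] := cc.
have E0 : (fun s => velocity c s 0 0) = derive1 (fun s => re (c s)).
  by apply: funext => u; rewrite velocityE.
have E1 : (fun s => velocity c s 0 1) = derive1 (fun s => im (c s)).
  by apply: funext => u; rewrite velocityE.
by split; [rewrite E0; exact: c1|rewrite E1; exact: c2].
Qed.

Lemma speed_continuous t : 0 <= t <= 1 ->
  {for t, continuous (fun s => Num.sqrt (quad (g (c s)) (velocity c s)))}.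
Proof.
move=> t01; have [_ _ _ Mc _] := cc.
apply: (@continuous_comp _ _ _ (fun s => quad (g (c s)) (velocity c s)) (@Num.sqrt R));
  last exact: sqrt_continuous.
rewrite (_ : (fun s => _) = (fun s => velocity c s 0 0 ^+ 2 * g (c s) 0 0 +
    velocity c s 0 0 * velocity c s 0 1 * (g (c s) 0 1 + g (c s) 1 0) +
    velocity c s 0 1 ^+ 2 * g (c s) 1 1)); last first.
  by apply: funext => u; rewrite quadE.
have [v0 v1] := velocity_continuous t.
have gij i j : {for t, continuous (fun s => g (c s) i j)}.
  apply: (@continuous_comp _ _ _ (fun s => g (c s)) (fun A : 'M[R]_2 => A i j)).
    apply: (@continuous_comp _ _ _ c g); first exact: curve_continuous.
    exact/gc/Mc.
  exact: coord_continuous.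
exact: (continuousD (continuousD (continuousM (continuousM v0 v0) (gij 0 0))
  (continuousM (continuousM v0 v1) (continuousD (gij 0 1) (gij 1 0))))
  (continuousM (continuousM v1 v1) (gij 1 1))).
Qed.

(** The source of every lower bound on distances; it is applied to the coordinates and to the
    logarithm of the distance to a puncture. *)
Lemma increment_le_length (phi dphi : R -> R) (L : R) : 0 <= L ->
  (forall t : R, 0 <= t <= 1 -> is_derive t (1 : R) phi (dphi t)) ->
  (forall t : R, 0 <= t <= 1 -> {for t, continuous dphi}) ->
  (forall t : R, 0 <= t <= 1 ->
     dphi t ^+ 2 <= L ^+ 2 * quad (g (c t)) (velocity c t)) ->
  `|phi 1 - phi 0| <= L * curve_length g c.
Proof.
move=> L0 pd dc le; apply: increment_le_integral pd dc speed_continuous _ => t t01.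
rewrite -sqrtr_sqr -[L in leRHS](ger0_norm L0) -sqrtr_sqr -sqrtrM ?sqr_ge0//.
by rewrite ler_wsqrtr// le.
Qed.

End Curve.

Lemma nbhs_andC (z : C) (A B : set C) : nbhs z A -> nbhs z B -> nbhs z (A `&` B).
Proof. by move=> ? ?; exact: (@filterI _ (nbhs z) (nbhs_filter z)). Qed.

Section CompletenessCriterion.
Variables (s : seq C) (g : C -> 'M[R]_2) (de : R).
Let M : set C := [set z | z \notin s].
Hypothesis gM : riemannian_metric M g.
Hypothesis oM : open M.
Hypothesis de0 : 0 < de.
Hypothesis lower : forall z (v : 'rV[R]_2), M z ->
  de * (v 0 0 ^+ 2 + v 0 1 ^+ 2) <= quad (g z) v.
Hypothesis lower_end : forall b z (v : 'rV[R]_2), b \in s -> M z ->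
  de * (v 0 0 ^+ 2 + v 0 1 ^+ 2) <= cnorm2 (z - b) * quad (g z) v.

Let gc z : M z -> {for z, continuous g}.
Proof. by move=> Mz; have [/(_ 0%N)[H _] _] := gM; exact: H. Qed.

(** A single Lipschitz constant for all test functions; the 4 comes from the derivative of the
    squared modulus in [ln_increment]. *)
Let L := Num.sqrt (4 / de).
Let L2 : L ^+ 2 = 4 / de.
Proof. by rewrite sqr_sqrtr// divr_ge0// ltW. Qed.

Lemma re_increment p q c : C1_curve M p q c ->
  `|re q - re p| <= L * curve_length g c.
Proof.
move=> cc; have [_ _ _ Mc [c0 c1]] := cc; rewrite -c0 -c1.
apply: (increment_le_length cc gc (phi := fun t => re (c t))
  (dphi := fun t => velocity c t 0 0)).
- exact: sqrtr_ge0.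
- by move=> t _; exact: (curve_derive cc t).1.
- by move=> t _; exact: (velocity_continuous cc t).1.
- move=> t t01; rewrite L2 mulrAC ler_pdivlMr//.
  have := lower (velocity c t) (Mc t t01).
  have := mulr_ge0 (ltW de0) (sqr_ge0 (velocity c t 0 0)).
  have := mulr_ge0 (ltW de0) (sqr_ge0 (velocity c t 0 1)).
  by rewrite mulrDr [_ * de]mulrC; lra.
Qed.

Lemma im_increment p q c : C1_curve M p q c ->
  `|im q - im p| <= L * curve_length g c.
Proof.
move=> cc; have [_ _ _ Mc [c0 c1]] := cc; rewrite -c0 -c1.
apply: (increment_le_length cc gc (phi := fun t => im (c t))
  (dphi := fun t => velocity c t 0 1)).
- exact: sqrtr_ge0.
- by move=> t _; exact: (curve_derive cc t).2.
- by move=> t _; exact: (velocity_continuous cc t).2.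
- move=> t t01; rewrite L2 mulrAC ler_pdivlMr//.
  have := lower (velocity c t) (Mc t t01).
  have := mulr_ge0 (ltW de0) (sqr_ge0 (velocity c t 0 0)).
  have := mulr_ge0 (ltW de0) (sqr_ge0 (velocity c t 0 1)).
  by rewrite mulrDr [_ * de]mulrC; lra.
Qed.

Lemma is_derive_sqr_shift (u : R -> R) (b t v : R) : is_derive t (1 : R) u v ->
  is_derive t (1 : R) (fun s => (u s - b) ^+ 2) (2 * (u t - b) * v).
Proof.
move=> du; have D : is_derive t (1 : R) (fun s => u s - b) v.
  by have := is_deriveB du (is_derive_cst b t (1 : R)); rewrite subr0.
have := @is_deriveX _ _ (fun s => u s - b) 2 t 1 v D.
by rewrite exprfctE expr1.
Qed.

(** The differential of ln|z-b|^2 is at most 2|dz|/|z-b|, which [lower_end] compares with the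
    metric. Thus [b] lies at infinite distance. *)
Lemma ln_increment b p q c : b \in s -> C1_curve M p q c ->
  `|ln (cnorm2 (q - b)) - ln (cnorm2 (p - b))| <= L * curve_length g c.
Proof.
move=> bs cc; have [_ _ _ Mc [c0 c1]] := cc; rewrite -c0 -c1.
pose n t := cnorm2 (c t - b).
have nE : n = fun t => (re (c t) - re b) ^+ 2 + (im (c t) - im b) ^+ 2.
  by apply: funext => t; rewrite /n /cnorm2 !reimE.
have n0 t : 0 <= t <= 1 -> 0 < n t.
  move=> /Mc Mt; rewrite cnorm2_gt0 subr_eq0.
  by apply: contraNneq Mt => ->.
pose dn t := 2 * (re (c t) - re b) * velocity c t 0 0 +
             2 * (im (c t) - im b) * velocity c t 0 1.
have nd t : is_derive t (1 : R) n (dn t).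
  have [d1 d2] := curve_derive cc t; rewrite nE.
  exact: (is_deriveD (is_derive_sqr_shift (re b) d1) (is_derive_sqr_shift (im b) d2)).
apply: (increment_le_length cc gc (phi := fun t => ln (n t))
  (dphi := fun t => (n t)^-1 * dn t)).
- exact: sqrtr_ge0.
- move=> t t01; have := @is_derive1_comp _ (@ln R) n t _ _ (is_derive1_ln (n0 t t01)) (nd t).
  exact.
- move=> t t01.
  have [v0 v1] := velocity_continuous cc t.
  have nc := is_derive_continuousR (nd t).
  have [d1 d2] := curve_derive cc t.
  have rc := is_derive_continuousR d1; have ic := is_derive_continuousR d2.
  apply: continuousM; first by apply: continuousV => //; rewrite gt_eqF// n0.
  have cst2 : {for t, continuous (fun=> 2 : R)} by exact: cst_continuous.
  have cst_re : {for t, continuous (fun=> re b)} by exact: cst_continuous.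
  have cst_im : {for t, continuous (fun=> im b)} by exact: cst_continuous.
  have rc2 := continuousM cst2 (continuousB rc cst_re).
  have ic2 := continuousM cst2 (continuousB ic cst_im).
  exact: (continuousD (continuousM rc2 v0) (continuousM ic2 v1)).
- move=> t t01; have nt := n0 t t01.
  rewrite exprMn exprVn mulrC ler_pdivrMr ?exprn_gt0// L2.
  have H := lower_end (velocity c t) bs (Mc t t01).
  set q1 := quad _ _ in H *.
  set v0 := velocity c t 0 0 in H *; set v1 := velocity c t 0 1 in H *.
  (* Cauchy-Schwarz, with the defect written as an exact square. *)
  have cs : dn t ^+ 2 <= 4 * n t * (v0 ^+ 2 + v1 ^+ 2).
    rewrite /dn nE -/v0 -/v1; set a := re (c t) - _; set d := im (c t) - _.
    rewrite -subr_ge0 (_ : _ - _ = 4 * (a * v1 - d * v0) ^+ 2); last by ring.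
    by rewrite mulr_ge0// sqr_ge0.
  apply: le_trans cs _.
  have -> : 4 / de * q1 * n t ^+ 2 = (4 * n t / de) * (n t * q1) by ring.
  rewrite [leRHS]mulrAC ler_pdivlMr// -!mulrA.
  by rewrite ler_pM2l// ler_pM2l// mulrC.
Qed.

Lemma dist_curve p q (e : R) : (riemannian_dist M g p q < e%:E)%E ->
  exists2 c, C1_curve M p q c & curve_length g c < e.
Proof. by move=> /ereal_inf_lt[_ [c cc <-]]; rewrite lte_fin => ce; exists c. Qed.

Lemma square_segment (l z : C) (r t : R) : 0 < r ->
  `|re z - re l| < r -> `|im z - im l| < r -> 0 <= t <= 1 ->
  let w := z + t%:C * (l - z) in `|re w - re l| < r /\ `|im w - im l| < r.
Proof.
move=> r0 x y /andP[t0 t1] w.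
have aux (a b : R) : `|a - b| < r -> `|a + t * (b - a) - b| < r.
  move=> ab; have -> : a + t * (b - a) - b = (1 - t) * (a - b) by ring.
  rewrite normrM ger0_norm ?subr_ge0// (le_lt_trans _ ab)//.
  by rewrite ler_piMl// lerBlDr lerDl.
by rewrite /w !reimE /= !mul0r subr0 addr0; split; exact: aux.
Qed.

(** The distance is an infimum over curves, so it is enough to bound the straight segment to [l],
    along which the metric is at most [B] times the Euclidean one. *)
Lemma near_dist (l : C) (e : R) : M l -> 0 < e ->
  \forall z \near l, (riemannian_dist M g z l < e%:E)%E.
Proof.
move=> Ml e0.
have gij i j : \forall z \near l, `|g z i j| <= `|g l i j| + 1.
  have c1 : {for l, continuous (fun z => `|g z i j|)}.
    apply: (@continuous_comp _ _ _ (fun z => g z i j) (fun x : R => `|x|)).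
      apply: (@continuous_comp _ _ _ g (fun A : 'M[R]_2 => A i j)); first exact: gc.
      exact: coord_continuous.
    exact: norm_continuous.
  have := @cvgr_le _ _ (nbhs l) (nbhs_filter l) _ _ c1 (`|g l i j| + 1).
  by apply; rewrite ltrDl.
pose B := `|g l 0 0| + 1 + (`|g l 0 1| + 1) + (`|g l 1 0| + 1) + (`|g l 1 1| + 1).
have norm1_gt0 (x : R) : 0 < `|x| + 1 by rewrite ltr_wpDl.
have B0 : 0 < B by rewrite /B; do 3 (apply: addr_gt0; last exact: norm1_gt0); exact: norm1_gt0.
have near_quad : nbhs l [set z : C | forall v, quad (g z) v <= B * (v 0 0 ^+ 2 + v 0 1 ^+ 2)].
  have H := nbhs_andC (nbhs_andC (gij 0 0) (gij 0 1)) (nbhs_andC (gij 1 0) (gij 1 1)).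
  apply: filterS H => z [[g00 g01] [g10 g11]] v; rewrite quadE.
  set v0 := v 0 0; set v1 := v 0 1.
  rewrite /B; move: g00 g01 g10 g11.
  set b00 := _ + 1; set b01 := _ + 1; set b10 := _ + 1; set b11 := _ + 1.
  rewrite !ler_norml => /andP[_ h0] /andP[h1 h1'] /andP[h2 h2'] /andP[_ h3].
  have s0 := sqr_ge0 v0; have s1 := sqr_ge0 v1.
  have k0 := ler_wpM2l s0 h0; have k3 := ler_wpM2l s1 h3.
  have b1 : 0 <= b01 by rewrite addr_ge0.
  have b2 : 0 <= b10 by rewrite addr_ge0.
  have b0 : 0 <= b00 by rewrite addr_ge0.
  have b3 : 0 <= b11 by rewrite addr_ge0.
  have mixed (x b : R) : 0 <= b -> - b <= x -> x <= b ->
      v0 * v1 * x <= b * (v0 ^+ 2 + v1 ^+ 2).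
    move=> b_ge0 x1 x2.
    have p1 := mulr_ge0 b_ge0 (sqr_ge0 (v0 + v1)).
    have p2 := mulr_ge0 b_ge0 (sqr_ge0 (v0 - v1)).
    have p3 := mulr_ge0 b_ge0 s0; have p4 := mulr_ge0 b_ge0 s1.
    have [vv|/ltW vv] := leP 0 (v0 * v1).
      by have := ler_wpM2l vv x2; lra.
    by have := ler_wnM2l vv x1; lra.
  have m1 := mixed _ _ b1 h1 h1'; have m2 := mixed _ _ b2 h2 h2'.
  have p0 := mulr_ge0 b0 s1; have p3 := mulr_ge0 b3 s0.
  by rewrite mulrDr; lra.
have [r r0 rP] := (nbhs_square l _).1 (nbhs_andC near_quad (open_nbhs_nbhs (conj oM Ml))).
(* A segment of squared Euclidean length below [eta] has length at most sqrt(B eta) = e/2 for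
   [g]. *)
pose eta := e ^+ 2 / (4 * B).
have eta0 : 0 < eta by rewrite divr_gt0 ?exprn_gt0// mulr_gt0.
have near_n : \forall z \near l, cnorm2 (l - z) < eta.
  have c1 : {for l, continuous (fun z : C => cnorm2 (l - z))}.
    have h1 : {for l, continuous (fun z : C => re l - re z : R)}.
      by apply: continuousB; [exact: cst_continuous|exact: re_continuous].
    have h2 : {for l, continuous (fun z : C => im l - im z : R)}.
      by apply: continuousB; [exact: cst_continuous|exact: im_continuous].
    rewrite (_ : (fun z => _) = (fun z : C => (re l - re z) * (re l - re z) +
      (im l - im z) * (im l - im z))); last first.
      by apply: funext => z; rewrite /cnorm2 !reimE !expr2.
    exact: (continuousD (continuousM h1 h1) (continuousM h2 h2)).
  have := @cvgr_lt _ _ (nbhs l) (nbhs_filter l) _ _ c1 eta.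
  by apply; rewrite subrr /cnorm2 /= expr0n addr0.
have near_sq : \forall z \near l, `|re z - re l| < r /\ `|im z - im l| < r.
  by apply: (nbhs_square l _).2; exists r.
apply: (@filterS2 _ (nbhs l) (nbhs_filter l) _ _ _ _ near_n near_sq) => z nz [x y].
pose c t : C := z + t%:C * (l - z).
have cre : (fun t => re (c t)) = (fun t => re z + t * (re l - re z)).
  by apply: funext => t; rewrite /c !reimE /= mul0r subr0.
have cim : (fun t => im (c t)) = (fun t => im z + t * (im l - im z)).
  by apply: funext => t; rewrite /c !reimE /= mul0r addr0.
have aff (a b t : R) : is_derive t (1 : R) (fun t => a + t * b) b.
  have := is_deriveD (is_derive_cst a t (1 : R)) (is_deriveM (is_derive_id t (1 : R)) (is_derive_cst b t (1 : R))).
  by rewrite /= scaler0 !add0r [_ *: _]mulr1.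
have d1 : derive1 (fun t => re (c t)) = (fun=> re l - re z).
  by apply: funext => t; rewrite cre derive1E; case: (aff (re z) (re l - re z) t).
have d2 : derive1 (fun t => im (c t)) = (fun=> im l - im z).
  by apply: funext => t; rewrite cim derive1E; case: (aff (im z) (im l - im z) t).
have Mc t : 0 <= t <= 1 -> M (c t) /\ forall v, quad (g (c t)) v <= B * (v 0 0 ^+ 2 + v 0 1 ^+ 2).
  by move=> t01; have [h1 h2] := square_segment r0 x y t01; have [] := rP _ h1 h2.
have cc : C1_curve M z l c.
  split.
  - move=> t; rewrite cre cim.
    by split; [case: (aff (re z) (re l - re z) t)|case: (aff (im z) (im l - im z) t)].
  - by rewrite d1; exact: cst_continuous.
  - by rewrite d2; exact: cst_continuous.
  - by move=> t /Mc[].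
  - by rewrite /c mul0r addr0 mul1r addrC subrK.
apply: (@le_lt_trans _ _ (curve_length g c)%:E).
  by apply: ereal_inf_lbound; exists c.
rewrite lte_fin.
have speed_le : curve_length g c <= e / 2.
  have m01 : measurable (`[0, 1]%classic : set (measurableTypeR R)) by exact: measurable_itv.
  have -> : e / 2 = \int[@lebesgue_measure R]_(t in `[0, 1]) (e / 2).
    rewrite Rintegral_cst//.
    have := @lebesgue_measure_itv R `[0, 1]%R; rewrite /= lte_fin ltr01 => ->.
    by rewrite oppr0 /= addr0 mulr1.
  apply: le_Rintegral => //.
  - apply: integrable_unit; exact: (speed_continuous cc gc).
  - by apply: integrable_unit => t _; exact: cst_continuous.
  - move=> t; rewrite /= in_itv /= => /Mc[_ Q].
    have e2 : 0 <= e / 2 by rewrite divr_ge0// ltW.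
    rewrite -[leRHS](ger0_norm e2) -sqrtr_sqr ler_wsqrtr// (le_trans (Q _))//.
    rewrite !velocityE d1 d2.
    have -> : (re l - re z) ^+ 2 + (im l - im z) ^+ 2 = cnorm2 (l - z).
      by rewrite /cnorm2 !reimE.
    rewrite mulrC -ler_pdivlMr// (le_trans (ltW nz))// /eta le_eqVlt.
    by apply/orP; left; apply/eqP; field; rewrite gt_eqF.
rewrite (le_lt_trans speed_le)//.
by rewrite ltr_pdivrMr// ltr_pMr// ltr1n.
Qed.

Lemma cauchy_real (x : nat -> R) :
  (forall e : R, 0 < e -> exists N, forall m, (N <= m)%N -> `|x N - x m| < e) ->
  exists l : R, x @ \oo --> l.
Proof.
move=> H; apply/cvg_ex; apply: cauchy_cvg; apply: cauchy_exP => e e0.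
have [N HN] := H e e0; exists (x N).
by exists N => // m Nm; exact: HN.
Qed.

(** The coordinates of a Cauchy sequence are Cauchy, so it converges in the plane. The limit is no
    puncture, since by [ln_increment] the logarithms of the distances to each puncture stay bounded;
    [near_dist] then gives convergence for the metric. *)
Lemma complete_of_lower_bounds : complete_metric M g.
Proof.
split=> // u Mu cauchy_u.
have L0 : 0 < L by rewrite sqrtr_gt0 divr_gt0.
have cauchy_F (F : C -> R) :
    (forall p q c, C1_curve M p q c -> `|F q - F p| <= L * curve_length g c) ->
    forall e : R, 0 < e -> exists N, forall m, (N <= m)%N -> `|F (u N) - F (u m)| < e.
  move=> HF e e0; have [N HN] := cauchy_u (e / L) (divr_gt0 e0 L0).
  exists N => m Nm; have [c cc ce] := dist_curve (HN N m (leqnn N) Nm).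
  rewrite distrC (le_lt_trans (HF _ _ _ cc))//.
  by rewrite mulrC -ltr_pdivlMr.
have [x ux] := cauchy_real (cauchy_F (fun z => re z) re_increment).
have [y uy] := cauchy_real (cauchy_F (fun z => im z) im_increment).
pose l : C := x +i* y.
have ul : u @ \oo --> l by exact: cvg_reim.
have Ml : M l.
  apply/negP => ls.
  have [N HN] := cauchy_F _ (fun p q c => @ln_increment l p q c ls) 1 ltr01.
  have pos m : 0 < cnorm2 (u m - l).
    rewrite cnorm2_gt0 subr_eq0; have Mum : u m \notin s := Mu m.
    by apply: contraNneq Mum => ->.
  (* From index [N] on the logarithm moves by less than 1, so the squared distance to [l] stays
     above [d]. *)
  pose d := expR (ln (cnorm2 (u N - l)) - 1).
  have far m : (N <= m)%N -> d <= cnorm2 (u m - l).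
    move=> /HN; rewrite ltr_norml => /andP[_ h].
    rewrite -[leRHS]lnK ?posrE// ler_expR; lra.
  have c1 : (fun m => cnorm2 (u m - l)) @ \oo --> (0 : R).
    have -> : (fun m => cnorm2 (u m - l)) = (fun m => (re (u m) - x) * (re (u m) - x) +
        (im (u m) - y) * (im (u m) - y)).
      by apply: funext => m; rewrite /cnorm2 !reimE !expr2.
    have z1 : (fun m => re (u m) - x) @ \oo --> (0 : R).
      by rewrite -(subrr x); apply: cvgB => //; exact: cvg_cst.
    have z2 : (fun m => im (u m) - y) @ \oo --> (0 : R).
      by rewrite -(subrr y); apply: cvgB => //; exact: cvg_cst.
    rewrite (_ : 0 = 0 * 0 + 0 * 0); last by rewrite mulr0 addr0.
    exact: (cvgD (cvgM z1 z1) (cvgM z2 z2)).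
  have d0 : 0 < d by exact: expR_gt0.
  have [N' _ HN'] := @cvgr_lt _ _ _ _ _ _ c1 d d0.
  have := HN' _ (leq_maxr N N'); rewrite /= ltNge => /negP; apply.
  exact: far (leq_maxl N N').
exists l => // e e0.
exact: ul (near_dist Ml e0).
Qed.

End CompletenessCriterion.
End CurveLength.

(** * Separation of two power-like terms *)

Section PowerGap.
Variable R : realType.
Local Notation C := (Cplane R).

Lemma cderiv_cnorm2_continuous (u : C -> C) z l : cderiv u z l ->
  {for z, continuous (fun w => cnorm2 (u w))}.
Proof.
move=> du; apply: (@continuous_comp _ _ _ u (@cnorm2 R)).
  exact: is_derive_continuous du.
have := @continuous_cnorm2 R 0 (u z).
by rewrite (_ : (fun w => cnorm2 (w + 0)) = @cnorm2 R)//; apply: funext => w; rewrite addr0.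
Qed.

Lemma near_small_power (b : C) (e h : R) : 0 < e -> 0 < h ->
  \forall z \near b, z != b -> expR (e * ln (cnorm2 (z - b))) <= h.
Proof.
move=> e0 h0.
have c1 : {for b, continuous (fun z : C => cnorm2 (z - b))}.
  exact: continuous_cnorm2.
have := @cvgr_lt _ _ (nbhs b) (nbhs_filter b) _ _ c1 (expR (ln h / e)).
rewrite subrr {1}/cnorm2 /= expr0n addr0 => /(_ (expR_gt0 _)).
apply: filterS => z zh zb.
have S0 : 0 < cnorm2 (z - b) by rewrite cnorm2_gt0 subr_eq0.
rewrite -[leRHS]lnK ?posrE// ler_expR mulrC -ler_pdivlMr//.
by rewrite -[leRHS]expRK ler_ln ?posrE ?expR_gt0// ltW.
Qed.

(** With u = |z-b|^{2e} tending to 0, the term [be / u] stays large while [al * u] becomes small. *)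
Lemma power_gap_pos (b : C) (al be : C -> R) (e : R) : 0 < e ->
  {for b, continuous al} -> {for b, continuous be} -> 0 < al b -> 0 < be b ->
  exists2 de, 0 < de & \forall z \near b, z != b ->
    de <= (be z * expR (- (e * ln (cnorm2 (z - b)))) -
           al z * expR (e * ln (cnorm2 (z - b)))) ^+ 2.
Proof.
move=> e0 ac bc a0 b0.
(* Once u <= h, the first term is at least [be b / 2] and the second at most half of that; their gap
   is at least [be b / 2 / 2]. *)
pose h := Num.min 1 (be b / 2 / 2 / (2 * al b)).
have h0 : 0 < h by rewrite lt_min ltr01 !divr_gt0// mulr_gt0.
exists ((be b / 2 / 2) ^+ 2); first by rewrite exprn_gt0// !divr_gt0.
have n1 : \forall z \near b, al z <= 2 * al b.
  have := @cvgr_le _ _ (nbhs b) (nbhs_filter b) _ _ ac (2 * al b).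
  by apply; rewrite ltr_pMl// ltr1n.
have n2 : \forall z \near b, be b / 2 <= be z.
  have := @cvgr_ge _ _ (nbhs b) (nbhs_filter b) _ _ bc (be b / 2).
  by apply; rewrite ltr_pdivrMr// ltr_pMr// ltr1n.
have n3 := near_small_power b e0 h0.
apply: filterS3 n1 n2 n3 => z z1 z2 z3 zb; have {}z3 := z3 zb.
set u := expR (e * _) in z3 *; rewrite expRN -/u.
have u0 : 0 < u by exact: expR_gt0.
have u1 : u <= 1 by rewrite (le_trans z3)// ge_min lexx.
have u2 : u <= be b / 2 / 2 / (2 * al b) by rewrite (le_trans z3)// ge_min lexx orbT.
have g1 : be b / 2 <= be z / u.
  rewrite (le_trans z2)// ler_pMr ?invf_ge1//.
  by rewrite (lt_le_trans _ z2)// divr_gt0.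
have g2 : al z * u <= be b / 2 / 2.
  rewrite (le_trans (_ : _ <= 2 * al b * u)) ?ler_pM2r//.
  by rewrite mulrC -ler_pdivlMr// mulr_gt0.
have h2 : 0 <= be b / 2 / 2 by rewrite !divr_ge0// ltW.
by rewrite lerXn2r ?nnegrE//; lra.
Qed.

(** A negative exponent exchanges the two terms; for exponent 0 the powers disappear and distinct
    limits at [b] separate them. *)
Lemma power_gap (b : C) (al be : C -> R) (e : R) :
  {for b, continuous al} -> {for b, continuous be} -> 0 < al b -> 0 < be b ->
  e != 0 \/ al b != be b ->
  exists2 de, 0 < de & \forall z \near b, z != b ->
    de <= (be z * expR (- (e * ln (cnorm2 (z - b)))) -
           al z * expR (e * ln (cnorm2 (z - b)))) ^+ 2.
Proof.
move=> ac bc a0 b0 hyp; have [e0|e0|e0] := ltgtP e 0.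
- have [de de0 H] := power_gap_pos (e := - e) (b := b) (al := be) (be := al)
    (ltac:(by rewrite oppr_gt0)) bc ac b0 a0.
  exists de => //; apply: filterS H => z /[apply].
  by rewrite mulNr opprK -[in X in _ -> X]sqrrN opprB.
- exact: power_gap_pos.
- have neq : al b != be b by move: hyp; rewrite e0 eqxx => -[].
  exists ((be b - al b) ^+ 2 / 2).
    by rewrite divr_gt0// lt0r sqr_ge0 andbT expf_neq0// subr_eq0 eq_sym.
  have cc : {for b, continuous (fun z => (be z - al z) * (be z - al z))}.
    exact: (continuousM (continuousB bc ac) (continuousB bc ac)).
  have := @cvgr_ge _ _ (nbhs b) (nbhs_filter b) _ _ cc ((be b - al b) ^+ 2 / 2).
  have p0 : 0 < (be b - al b) ^+ 2.
    by rewrite lt0r sqr_ge0 andbT expf_neq0// subr_eq0 eq_sym.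
  rewrite -expr2 ltr_pdivrMr// ltr_pMr// ltr1n => /(_ isT).
  apply: filterS => z h _; rewrite e0 mul0r oppr0 expR0 !mulr1.
  by rewrite (le_trans h).
Qed.

End PowerGap.

(** * Growth of the metric at the ends *)

Section EndEstimates.
Variable R : realType.
Local Notation C := (Cplane R).
Local Notation M := (thrice_punctured_plane R).

Definition omega_abs (k : R) (z : C) : R :=
  2 * Num.sqrt (cnorm2 z) / (cnorm2 (z ^+ 2 - 1) * qfun k z).
Definition theta_num (k : R) (z : C) : C := z ^+ 2 + 2 * k%:C * z + 1.
Definition theta_abs (k : R) (z : C) : R :=
  `|k| * qfun k z * Num.sqrt (cnorm2 (theta_num k z)) / cnorm2 z.
(** The least value of the metric of the front on unit vectors of the plane, by the reverse triangle
    inequality. *)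
Definition gap2 (k : R) (z : C) : R := (omega_abs k z - theta_abs k z) ^+ 2.

Lemma omega_absE k (H z : C) : cnorm2 H = qfun k z ->
  cnorm2 (omega H z) = omega_abs k z ^+ 2.
Proof.
move=> HE.
have E1 : cnorm2 (- 2 * z) = 2 ^+ 2 * cnorm2 z.
  by rewrite cnorm2M; congr (_ * _); rewrite /cnorm2 /=; ring.
have E2 : cnorm2 (((z ^+ 2 - 1) * H) ^+ 2) = (cnorm2 (z ^+ 2 - 1) * qfun k z) ^+ 2.
  by rewrite expr2 cnorm2M -expr2 cnorm2M HE.
rewrite /omega cnorm2M cnorm2V E1 E2 /omega_abs expr_div_n [(2 * Num.sqrt _) ^+ 2]exprMn.
by rewrite sqr_sqrtr ?cnorm2_ge0.
Qed.

Lemma theta_absE k (H z : C) : cnorm2 H = qfun k z ->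
  cnorm2 (theta k H z) = theta_abs k z ^+ 2.
Proof.
move=> HE; rewrite /theta /theta_abs [RHS]expr_div_n ![in RHS]exprMn sqr_sqrtr ?cnorm2_ge0//.
rewrite -/(theta_num k z) real_normK ?num_real//.
rewrite [H ^+ 2]expr2 [z ^+ 2]expr2 !cnorm2M cnorm2V cnorm2M HE.
have -> : cnorm2 (k%:C : C) = k ^+ 2 by rewrite /cnorm2 /= expr0n addr0.
by rewrite !expr2; ring.
Qed.

Lemma sqr_sqrt_sub_le (a b : C) :
  (Num.sqrt (cnorm2 a) - Num.sqrt (cnorm2 b)) ^+ 2 <= cnorm2 (a + b).
Proof.
have n (z : C) : 0 <= Num.sqrt (cnorm2 z) by exact: sqrtr_ge0.
have N2 (z : C) : cnorm2 z = Num.sqrt (cnorm2 z) ^+ 2 by rewrite sqr_sqrtr ?cnorm2_ge0.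
have NN (z : C) : cnorm2 (- z) = cnorm2 z by rewrite /cnorm2 !reimE !sqrrN.
have h1 := cnormD (a + b) (- b); have h2 := cnormD (a + b) (- a).
rewrite -!/(cnorm2 _) !NN addrK in h1.
rewrite -!/(cnorm2 _) !NN [a + b]addrC addrK [b + a]addrC in h2.
rewrite [leRHS]N2 -[leLHS]real_normK ?num_real//.
by rewrite lerXn2r ?nnegrE// ler_norml; apply/andP; split; lra.
Qed.

Lemma gap2_le_quad k z (v : 'rV[R]_2) : M z ->
  gap2 k z * (v 0 0 ^+ 2 + v 0 1 ^+ 2) <= quad (first_form (surf k 1 1) z) v.
Proof.
move=> Mz; have [H HE] := exists_modulus k z.
rewrite (first_form_surf _ _ Mz HE) !mul1r quad_flat_form.
set w : C := _ +i* _; apply: le_trans (sqr_sqrt_sub_le _ _).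
have cj (x : C) : cnorm2 (conjc x) = cnorm2 x by case: x => x y; rewrite /cnorm2 /= sqrrN.
rewrite cj (cnorm2M (omega H z)) (cnorm2M (theta k H z)) (omega_absE HE) (theta_absE HE).
have X0 : 0 <= omega_abs k z.
  by rewrite divr_ge0 ?mulr_ge0 ?sqrtr_ge0 ?cnorm2_ge0// ltW// qfun_gt0.
have Y0 : 0 <= theta_abs k z.
  rewrite divr_ge0 ?mulr_ge0 ?sqrtr_ge0 ?cnorm2_ge0//; exact/ltW/qfun_gt0.
rewrite (sqrtrM _ (sqr_ge0 (omega_abs k z))) (sqrtrM _ (sqr_ge0 (theta_abs k z))).
rewrite !sqrtr_sqr !ger0_norm// -mulrBl exprMn.
by rewrite sqr_sqrtr ?cnorm2_ge0.
Qed.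

Lemma cnorm2N (z : C) : cnorm2 (- z) = cnorm2 z.
Proof. by rewrite /cnorm2 !reimE !sqrrN. Qed.

Lemma logqN (z : C) : logq (- z) = - logq z.
Proof.
have E1 : - z - 1 = - (z + 1) by ring.
have E2 : - z + 1 = - (z - 1) by ring.
by rewrite /logq E1 E2 !cnorm2N opprB.
Qed.

(** The map z -> -z inverts (z-1)/(z+1), which the sign of [k] compensates; the end -1 thus reduces
    to the end 1. *)
Lemma gap2N k (z : C) : gap2 (- k) (- z) = gap2 k z.
Proof.
have E1 : theta_num (- k) (- z) = theta_num k z.
  have E : ((- k)%:C : C) = - k%:C by apply: eqC; rewrite /= ?oppr0.
  by rewrite /theta_num E; ring.
by rewrite /gap2 /omega_abs /theta_abs E1 /qfun logqN mulrNN normrN cnorm2N sqrrN.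
Qed.

Lemma logqV (z : C) : M z -> logq z^-1 = logq z.
Proof.
move=> Mz; have [z0 _] := thriceP Mz.
have [A0 B0] := twice_puncturedP (thrice_twice Mz).
have n0 : 0 < cnorm2 z by rewrite cnorm2_gt0.
rewrite /logq.
have -> : z^-1 - 1 = - (z - 1) * z^-1 by field.
have -> : z^-1 + 1 = (z + 1) * z^-1 by field.
rewrite !(cnorm2M, cnorm2N, cnorm2V) !ln_div ?posrE//.
by ring.
Qed.

(** The map z -> 1/z only changes the sign of (z-1)/(z+1), and |z|^4 is the conformal factor of dz
    under inversion; infinity thus reduces to 0. *)
Lemma gap2V k (z : C) : M z -> gap2 k z^-1 = cnorm2 z ^+ 2 * gap2 k z.
Proof.
move=> Mz; have [z0 z1] := thriceP Mz.
have n0 : cnorm2 z != 0 by rewrite cnorm2_eq0.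
have n0' : 0 < cnorm2 z by rewrite cnorm2_gt0.
have q0 : qfun k z != 0 by rewrite gt_eqF// qfun_gt0.
have c0 : cnorm2 (z ^+ 2 - 1) != 0 by rewrite cnorm2_eq0.
have qV : qfun k z^-1 = qfun k z by rewrite /qfun logqV.
have sV : Num.sqrt (cnorm2 z^-1) = (Num.sqrt (cnorm2 z))^-1.
  by rewrite cnorm2V sqrtrV// ltW.
have s0 : Num.sqrt (cnorm2 z) != 0 by rewrite gt_eqF// sqrtr_gt0.
have s2 : cnorm2 z = Num.sqrt (cnorm2 z) ^+ 2 by rewrite sqr_sqrtr// ltW.
rewrite /gap2 -exprMn; congr (_ ^+ 2); rewrite mulrBr; congr (_ - _).
  rewrite /omega_abs qV sV.
  have -> : z^-1 ^+ 2 - 1 = - (z ^+ 2 - 1) * z^-1 * z^-1 by field.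
  rewrite !(cnorm2M, cnorm2N, cnorm2V).
  by set s := Num.sqrt _ in s0 s2 *; rewrite s2; field; rewrite s0 c0 q0.
rewrite /theta_abs qV.
have -> : theta_num k z^-1 = theta_num k z * (z^-1 * z^-1).
  by rewrite /theta_num; field.
rewrite !(cnorm2M, cnorm2V) sqrtrM ?cnorm2_ge0// -expr2 sqrtr_sqr.
rewrite (ger0_norm (_ : 0 <= (cnorm2 z)^-1)) ?invr_ge0 ?cnorm2_ge0//.
by field.
Qed.

End EndEstimates.

Section EndGap.
Variable R : realType.
Local Notation C := (Cplane R).
Local Notation M := (thrice_punctured_plane R).

Lemma continuous_expR_ln_cnorm2 (e : R) (c b : C) : b + c != 0 ->
  {for b, continuous (fun z : C => expR (e * ln (cnorm2 (z + c))))}.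
Proof.
move=> bc; apply: (@continuous_comp _ _ _ _ (@expR R)); last exact: continuous_expR.
apply: continuousM; first exact: cst_continuous.
apply: (@continuous_comp _ _ _ (fun z : C => cnorm2 (z + c)) (@ln R)).
  exact: continuous_cnorm2.
by apply: continuous_ln; rewrite cnorm2_gt0.
Qed.

Lemma cderiv_theta_num (k : R) (z : C) : exists l, cderiv (theta_num k) z l.
Proof.
by eexists; exact: (cderivD (cderivD (cderivX 2 (cderiv_id z))
  (cderivM (cderiv_cst (2 * k%:C : C) z) (cderiv_id z))) (cderiv_cst (1 : C) z)).
Qed.

Lemma continuous_sqrt_cnorm2 (u : C -> C) z l : cderiv u z l ->
  {for z, continuous (fun w => Num.sqrt (cnorm2 (u w)))}.
Proof.
move=> du; apply: (@continuous_comp _ _ _ (fun w => cnorm2 (u w)) (@Num.sqrt R)).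
  exact: cderiv_cnorm2_continuous du.
exact: sqrt_continuous.
Qed.

(** Near 1 the products |z-1||omega| and |z-1||theta| are [be] |z-1|^{-(1+2k)} and [al]
    |z-1|^{1+2k}, so [power_gap] applies with exponent 1/2 + k; [al 1] is positive because k is
    neither 0 nor -1. *)
Lemma end_one (k : R) : k != 0 -> k != -1 ->
  exists2 de, 0 < de & \forall z \near (1 : C), M z ->
    de <= cnorm2 (z - 1) * gap2 k z.
Proof.
move=> k0 k1.
pose al (z : C) := `|k| * Num.sqrt (cnorm2 (theta_num k z)) * (cnorm2 z)^-1 *
  expR (- k * ln (cnorm2 (z + 1))).
pose be (z : C) := 2 * Num.sqrt (cnorm2 z) * expR ((k - 1) * ln (cnorm2 (z + 1))).
have n1 : cnorm2 (1 : C) = 1 by rewrite /cnorm2 /= expr1n expr0n addr0.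
have n2 : cnorm2 (1 + 1 : C) = 4 by rewrite /cnorm2 /=; ring.
have cN : {for (1 : C), continuous (@cnorm2 R)} := cderiv_cnorm2_continuous (cderiv_id 1).
have two0 : 1 + 1 != 0 :> C by rewrite -cnorm2_eq0 n2 pnatr_eq0.
have ac : {for (1 : C), continuous al}.
  have [l dl] := cderiv_theta_num k 1.
  apply: continuousM; last exact: continuous_expR_ln_cnorm2.
  apply: continuousM; last by apply: continuousV => //; rewrite n1 oner_eq0.
  by apply: continuousM; [exact: cst_continuous|exact: continuous_sqrt_cnorm2 dl].
have bc : {for (1 : C), continuous be}.
  apply: continuousM; last exact: continuous_expR_ln_cnorm2.
  by apply: continuousM; [exact: cst_continuous|exact: continuous_sqrt_cnorm2 (cderiv_id 1)].
have Q1 : cnorm2 (theta_num k 1) = (2 * (k + 1)) ^+ 2.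
  by rewrite /theta_num /cnorm2 !reimE /=; ring.
have a1 : al 1 = `|k| * `|2 * (k + 1)| * expR (- k * ln 4).
  by rewrite /al Q1 sqrtr_sqr n1 n2 invr1 mulr1.
have b1 : be 1 = 2 * expR ((k - 1) * ln 4).
  by rewrite /be n1 n2 sqrtr1 mulr1.
have a0 : 0 < al 1.
  rewrite a1 !mulr_gt0 ?expR_gt0// normr_gt0//.
  by rewrite mulf_neq0// ?pnatr_eq0// addr_eq0.
have b0 : 0 < be 1 by rewrite b1 mulr_gt0// expR_gt0.
have hyp : 2^-1 + k != 0 \/ al 1 != be 1.
  (* For k = -1/2 the powers cancel; the limits of [al] and [be] are then 1 and 1/4. *)
  have [ek|] := eqVneq (2^-1 + k) 0; last by left.
  right; have kE : k = - 2^-1 by apply/eqP; rewrite -addr_eq0 addrC ek.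
  apply/eqP => E.
  have : al 1 * expR (3 / 2 * ln 4) = be 1 * expR (3 / 2 * ln 4) by rewrite E.
  rewrite a1 b1 -[LHS]mulrA -[RHS]mulrA -!expRD kE.
  have -> : - - 2^-1 * ln 4 + 3 / 2 * ln 4 = ln 4 + ln 4 :> R by field.
  have -> : (- 2^-1 - 1) * ln 4 + 3 / 2 * ln 4 = 0 :> R by field.
  rewrite expRD lnK ?posrE// expR0.
  have -> : 2 * (- 2^-1 + 1) = 1 :> R by field.
  rewrite normr1 normrN gtr0_norm ?invr_gt0//; lra.
have [de de0 H] := power_gap ac bc a0 b0 hyp.
exists de => //; apply: filterS H => z H Mz; have [z0 z1 zN1] := Mz.
apply: le_trans (H z1) _; rewrite le_eqVlt; apply/orP; left; apply/eqP.
have [A0 B0] := twice_puncturedP (thrice_twice Mz).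
have n0 : 0 < cnorm2 z by rewrite cnorm2_gt0.
rewrite /gap2 /omega_abs /theta_abs /al /be /qfun /logq sqr_sub1 cnorm2M.
set LA := ln (cnorm2 (z - 1)); set LB := ln (cnorm2 (z + 1)).
have EA : cnorm2 (z - 1) = expR (LA / 2) ^+ 2.
  by rewrite expr2 -expRD -splitr lnK.
have EB : cnorm2 (z + 1) = expR LB by rewrite lnK.
rewrite EB EA -exprMn; congr (_ ^+ 2); rewrite mulrBr; congr (_ - _).
  have E0 : expR ((k - 1) * LB) * expR (- ((2^-1 + k) * LA)) =
      expR (LA / 2) / (expR (LA / 2) ^+ 2 * expR LB * expR (k * (LA - LB))).
    by rewrite expr2 -!expRD -expRN -expRD; congr expR; field.
  by rewrite -[LHS]mulrA E0; ring.
have E1 : expR (- k * LB) * expR ((2^-1 + k) * LA) = expR (LA / 2) * expR (k * (LA - LB)).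
  by rewrite -!expRD; congr expR; field.
by rewrite -[LHS]mulrA E1; ring.
Qed.

Lemma end_minus_one (k : R) : k != 0 -> k != 1 ->
  exists2 de, 0 < de & \forall z \near (-1 : C), M z ->
    de <= cnorm2 (z + 1) * gap2 k z.
Proof.
move=> k0 k1; have [||de de0 H] := @end_one (- k); rewrite ?oppr_eq0 ?eqr_opp//.
exists de => //.
have Nc : {for (-1 : C), continuous (fun z : C => - z)} :=
  is_derive_continuous (cderivN (cderiv_id (-1 : C))).
have H1 : nbhs (- (-1 : C)) [set z : C | M z -> de <= cnorm2 (z - 1) * gap2 (- k) z].
  by rewrite opprK.
apply: (@filterS _ (nbhs (-1 : C)) (nbhs_filter _) _ _ _ (Nc _ H1)) => z Hz Mz.
have MN : M (- z).
  by case: Mz => z0 z1 z2; split; rewrite ?oppr_eq0// eqr_oppLR ?opprK.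
have := Hz MN; rewrite gap2N.
by rewrite (_ : - z - 1 = - (z + 1)) ?cnorm2N//; ring.
Qed.

(** At 0, |z|^2 |omega| tends to 0 while |z|^2 |theta| tends to |k|; [F] is the difference, extended
    continuously. *)
Lemma end_zero (k : R) : k != 0 ->
  exists2 de, 0 < de & \forall z \near (0 : C), M z ->
    de <= cnorm2 z ^+ 2 * gap2 k z.
Proof.
move=> k0.
pose F (z : C) := cnorm2 z * (2 * Num.sqrt (cnorm2 z) / (cnorm2 (z ^+ 2 - 1) * qfun k z)) -
  `|k| * qfun k z * Num.sqrt (cnorm2 (theta_num k z)).
have cN : {for (0 : C), continuous (@cnorm2 R)} := cderiv_cnorm2_continuous (cderiv_id 0).
have n0 : cnorm2 (0 : C) = 0 by rewrite /cnorm2 /= expr0n addr0.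
have nn1 : cnorm2 (0 - 1 : C) = 1 by rewrite /cnorm2 /=; ring.
have np1 : cnorm2 (0 + 1 : C) = 1 by rewrite /cnorm2 /=; ring.
have q0 : qfun k 0 = 1 by rewrite /qfun /logq nn1 np1 ln1 subrr mulr0 expR0.
have cq : {for (0 : C), continuous (qfun k)}.
  apply: (@continuous_comp _ _ _ _ (@expR R)); last exact: continuous_expR.
  apply: continuousM; first exact: cst_continuous.
  apply: continuousB.
    apply: (@continuous_comp _ _ _ (fun z : C => cnorm2 (z - 1)) (@ln R)).
      exact: continuous_cnorm2.
    by apply: continuous_ln; rewrite nn1.
  apply: (@continuous_comp _ _ _ (fun z : C => cnorm2 (z + 1)) (@ln R)).
    exact: continuous_cnorm2.
  by apply: continuous_ln; rewrite np1.
have s1 : cnorm2 (0 ^+ 2 - 1 : C) = 1 by rewrite expr0n /= nn1.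
have cF : {for (0 : C), continuous F}.
  have [l dl] := cderiv_theta_num k 0.
  apply: continuousB; apply: continuousM.
  - exact: cN.
  - apply: continuousM.
      by apply: continuousM; [exact: cst_continuous|exact: continuous_sqrt_cnorm2 (cderiv_id 0)].
    apply: continuousV; first by rewrite s1 q0 mulr1 oner_eq0.
    by apply: continuousM => //; exact: cderiv_cnorm2_continuous (cderiv_sqr_sub1 0).
  - by apply: continuousM => //; exact: cst_continuous.
  - exact: continuous_sqrt_cnorm2 dl.
have F0 : F 0 * F 0 = k ^+ 2.
  rewrite /F n0 mul0r q0 /theta_num.
  have -> : (0 ^+ 2 + 2 * k%:C * 0 + 1 : C) = 1 by ring.
  have -> : cnorm2 (1 : C) = 1 by rewrite /cnorm2 /= expr1n expr0n addr0.
  by rewrite sqrtr1 sub0r mulrNN !mulr1 -expr2 real_normK ?num_real.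
have k2 : 0 < k ^+ 2 by rewrite lt0r sqr_ge0 expf_neq0.
exists (k ^+ 2 / 2); first by rewrite divr_gt0.
have CF : {for (0 : C), continuous (fun z => F z * F z)} := continuousM cF cF.
have half : k ^+ 2 / 2 < F 0 * F 0 by rewrite F0 ltr_pdivrMr// ltr_pMr// ltr1n.
have := @cvgr_ge _ _ (nbhs (0 : C)) (nbhs_filter _) _ _ CF _ half.
apply: filterS => z h Mz; have [z0 _] := thriceP Mz.
apply: le_trans h _; rewrite le_eqVlt; apply/orP; left; apply/eqP.
have nz : cnorm2 z != 0 by rewrite cnorm2_eq0.
have q1 : qfun k z != 0 by rewrite gt_eqF// qfun_gt0.
have c1 : cnorm2 (z ^+ 2 - 1) != 0 by rewrite cnorm2_eq0; have [] := thriceP Mz.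
rewrite -expr2 /gap2 -exprMn; congr (_ ^+ 2).
by rewrite /F /omega_abs /theta_abs; field; rewrite nz q1 c1.
Qed.

End EndGap.

(** * Completeness of the front *)

Section Completeness.
Variable R : realType.
Local Notation C := (Cplane R).
Local Notation M := (thrice_punctured_plane R).
Local Notation oM := (@open_thrice_punctured R).
Variable k : R.
Hypotheses (k0 : k != 0) (k1 : k != 1) (kN1 : k != -1).

Lemma nbhs_cnorm2 (b : C) (A : set C) : nbhs b A ->
  exists2 e : R, 0 < e & forall z, cnorm2 (z - b) < e -> A z.
Proof.
move=> /(nbhs_square b)[r r0 rA]; exists (r ^+ 2); first by rewrite exprn_gt0.
have aux (x y : R) : x ^+ 2 + y ^+ 2 < r ^+ 2 -> `|x| < r.
  move=> h; rewrite -(gtr0_norm r0) -!sqrtr_sqr ltr_sqrt ?exprn_gt0//.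
  by rewrite (le_lt_trans _ h)// lerDl sqr_ge0.
move=> z; rewrite /cnorm2 !reimE => h; apply: rA; first exact: aux h.
by apply: (aux _ (re z - re b)); rewrite addrC.
Qed.

(** Squared form of: distinct punctures are at least 1 apart, so a point within 1/4 of one is at
    least 1/2 away from the others. *)
Lemma far_from (c d : R) (z : C) : 1 <= `|c - d| ->
  cnorm2 (z - c%:C) < 16^-1 -> 4^-1 <= cnorm2 (z - d%:C).
Proof.
rewrite /cnorm2 !reimE /= subr0; set x := re z; set y := im z => cd h.
have y2 := sqr_ge0 y; have h2 : (x - c) ^+ 2 < 4^-1 ^+ 2 by lra.
have : `|x - c| < 4^-1.
  by rewrite -[4^-1]ger0_norm ?invr_ge0// -!sqrtr_sqr ltr_sqrt// exprn_gt0// invr_gt0.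
rewrite ltr_norml => /andP[x1 x2].
have [cd0|/ltW cd0] := leP 0 (c - d).
  move: cd; rewrite ger0_norm// => cd.
  have xd : 2^-1 <= x - d by lra.
  have : 2^-1 ^+ 2 <= (x - d) ^+ 2 by rewrite lerXn2r ?nnegrE//; lra.
  lra.
move: cd; rewrite ler0_norm// => cd.
have xd : 2^-1 <= d - x by lra.
have : 2^-1 ^+ 2 <= (d - x) ^+ 2 by rewrite lerXn2r ?nnegrE//; lra.
by rewrite -[(x - d) ^+ 2]sqrrN opprB; lra.
Qed.

Definition punctures : seq C := [:: 0; 1; -1].

Lemma punctureP (P : C -> Prop) : P 0 -> P 1 -> P (-1) ->
  forall b, b \in punctures -> P b.
Proof. by move=> P0 P1 PN b; rewrite !inE => /or3P[] /eqP ->. Qed.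

Lemma puncture_far (b c z : C) : b \in punctures -> c \in punctures -> b != c ->
  cnorm2 (z - b) < 16^-1 -> 4^-1 <= cnorm2 (z - c).
Proof.
have EN : (-1 : C) = (-1 : R)%:C by apply: eqC; rewrite /= ?oppr0.
have F c d := @far_from c d z.
move=> bP cP; move: b bP c cP; apply: punctureP; apply: punctureP;
  rewrite ?eqxx// => _.
- by apply: (F 0 1); rewrite sub0r normrN normr1.
- by have := F 0 (-1); rewrite -EN; apply; rewrite sub0r opprK normr1.
- by apply: (F 1 0); rewrite subr0 normr1.
- by have := F 1 (-1); rewrite -EN; apply; rewrite opprK ger0_norm; lra.
- by have := F (-1) 0; rewrite -EN; apply; rewrite subr0 normrN normr1.
- by have := F (-1) 1; rewrite -EN; apply; rewrite -opprD normrN ger0_norm; lra.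
Qed.

Lemma near_puncture_gap : exists e de : R, [/\ 0 < e, e <= 16^-1, 0 < de &
  forall b z, b \in punctures -> M z -> cnorm2 (z - b) < e ->
    de <= cnorm2 (z - b) * gap2 k z /\ (b = 0 -> de <= cnorm2 z ^+ 2 * gap2 k z)].
Proof.
have [d0 d00 /nbhs_cnorm2[e0 e00 H0]] := end_zero k0.
have [d1 d10 /nbhs_cnorm2[e1 e10 H1]] := end_one k0 kN1.
have [d2 d20 /nbhs_cnorm2[e2 e20 H2]] := end_minus_one k0 k1.
exists (Num.min (Num.min e0 e1) (Num.min e2 16^-1)), (Num.min d0 (Num.min d1 d2)).
split.
- by rewrite !lt_min e00 e10 e20 invr_gt0 ltr0n.
- by rewrite !ge_min lexx !orbT.
- by rewrite !lt_min d00 d10 d20.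
- move=> b z bP Mz; rewrite !lt_min => /andP[/andP[h0 h1] /andP[h2 h3]].
  move: b bP h0 h1 h2 h3; apply: punctureP => h0 h1 h2 h3.
  + have g := H0 z h0 Mz; split; last by move=> _; rewrite ge_min g.
    have h4 : cnorm2 z < 16^-1 by rewrite -[z]subr0.
    rewrite subr0 ge_min (le_trans g)//.
    rewrite expr2 ler_wpM2r ?sqr_ge0// ler_piMl ?cnorm2_ge0//.
    by rewrite (le_trans (ltW h4))// invf_le1 ?ltr0n ?ler1n.
  + split; last by move/eqP; rewrite oner_eq0.
    by rewrite !ge_min (H1 z h1 Mz) !orbT.
  + split; last by move/eqP; rewrite oppr_eq0 oner_eq0.
    have := H2 z; rewrite opprK; move: h2; rewrite opprK => h2 /(_ h2 Mz) g.
    by rewrite !ge_min g !orbT.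
Qed.

(** All four ends in one statement. The region |z|^2 > 1/e is the inverse of the disc about 0, where
    the stronger bound with |z|^4 becomes by [gap2V] a plain lower bound. *)
Lemma gap_lower : exists e de : R, [/\ 0 < e, e <= 16^-1, 0 < de &
  forall z, M z -> (exists2 b, b \in punctures & cnorm2 (z - b) < e) \/ e^-1 < cnorm2 z ->
    de <= gap2 k z /\ forall b, b \in punctures -> de <= cnorm2 (z - b) * gap2 k z].
Proof.
have [e [de [e0 e16 de0 H]]] := near_puncture_gap.
have g0 z : 0 <= gap2 k z by exact: sqr_ge0.
exists e, (de / 4); split => //; first by rewrite divr_gt0.
have step (de' : R) z : 0 < de' -> M z -> de' <= gap2 k z -> forall c, 4^-1 <= cnorm2 (z - c) ->
    de' / 4 <= cnorm2 (z - c) * gap2 k z.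
  move=> d0 Mz gz c cz; by rewrite mulrC ler_pM ?invr_ge0 ?(ltW d0).
have quarter (d x : R) : 0 < d -> d <= x -> d / 4 <= x.
  by move=> d0 dx; rewrite (le_trans _ dx)// ler_piMr ?(ltW d0)// invf_le1 ?ltr0n ?ler1n.
move=> z Mz [[b bP zb]|big].
  have [g1 _] := H b z bP Mz zb.
  have zb16 : cnorm2 (z - b) < 16^-1 by rewrite (lt_le_trans zb).
  have g : de <= gap2 k z.
    rewrite (le_trans g1)// ler_piMl// (le_trans (ltW zb16))// invf_le1 ?ltr0n ?ler1n//.
  split; first exact: quarter.
  move=> c cP; have [<-|bc] := eqVneq b c; first exact: quarter.
  by apply: step => //; exact: puncture_far bP cP bc zb16.
have [z0 z1 zN1] := Mz.
have Nz : 0 < cnorm2 z by rewrite cnorm2_gt0.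
have MV : M z^-1.
  split; rewrite ?invr_eq0//; first by rewrite invr_eq1.
  by apply: contra zN1 => /eqP h; rewrite -[z]invrK h invrN1.
have small : cnorm2 (z^-1 - 0) < e by rewrite subr0 cnorm2V invf_plt ?posrE.
have [_ /(_ erefl)] := H 0 z^-1 (mem_head _ _) MV small.
rewrite gap2V// cnorm2V mulrA -exprMn mulVf ?gt_eqF// expr1n mul1r => g.
split; first exact: quarter.
move=> c cP; apply: step => //.
have N16 : 16 < cnorm2 z.
  rewrite (le_lt_trans _ big)// -[X in X <= _]invrK lef_pV2 ?posrE ?invr_gt0//.
have s1 : `|re z| ^+ 2 <= cnorm2 z by rewrite real_normK ?num_real// lerDl sqr_ge0.
move: c cP; apply: punctureP; rewrite /cnorm2 !reimE /= in N16 *; first lra.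
  by have := sqr_ge0 (re z - 2); have := sqr_ge0 (im z); lra.
by have := sqr_ge0 (re z + 2); have := sqr_ge0 (im z); lra.
Qed.

(** Tends to infinity at each of the four ends, so a cutoff of it has compact support in [M]. *)
Definition proper_fun (z : C) : R :=
  cnorm2 z + (cnorm2 z)^-1 + (cnorm2 (z - 1))^-1 + (cnorm2 (z + 1))^-1.

Lemma smooth_proper_fun : smooth M proper_fun.
Proof.
have sm (c : C) : smooth M (fun z : C => cnorm2 (z + c)).
  exact: (smooth_cnorm2 oM (csmoothD oM (csmooth_id oM) (csmooth_cst oM c))).
have sm0 : smooth M (fun z : C => cnorm2 z).
  exact: (smooth_cnorm2 oM (csmooth_id oM)).
move=> j; apply: (CkD oM); first apply: (CkD oM); first apply: (CkD oM).
- exact: sm0.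
- by apply: (CkV oM) => // z [z0 _ _]; rewrite cnorm2_eq0.
- apply: (CkV oM) => [z [_ z1 _]|]; last exact: sm.
  by rewrite cnorm2_eq0 subr_eq0.
- apply: (CkV oM) => [z [_ _ z1]|]; last exact: sm.
  by rewrite cnorm2_eq0 addr_eq0.
Qed.

Lemma closed_cnorm2_ge (c : C) (r : R) : closed [set z : C | r <= cnorm2 (z + c)].
Proof.
rewrite (_ : [set _ | _] = (fun z : C => cnorm2 (z + c)) @^-1` [set x | r <= x]) //.
apply: closed_comp; last exact: closed_ge.
by move=> z _; exact: continuous_cnorm2.
Qed.

Lemma closed_cnorm2_le (r : R) : closed [set z : C | cnorm2 z <= r].
Proof.
rewrite (_ : [set _ | _] = (fun z : C => cnorm2 (z + 0)) @^-1` [set x | x <= r]); last first.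
  by apply/seteqP; split => z; rewrite /= addr0.
apply: closed_comp; last exact: closed_le.
by move=> z _; exact: continuous_cnorm2.
Qed.

Lemma compact_disc r : 0 < r -> compact [set z : C | cnorm2 z <= r].
Proof.
move=> r0.
pose S : set (R * R) := `[- (r + 1), r + 1] `*` `[- (r + 1), r + 1].
have cS : compact S by apply: compact_setX; exact: segment_compact.
pose p (u : R * R) : C := u.1 +i* u.2.
have cp : continuous p.
  by move=> u; apply: continuous_reim; [exact: cvg_fst|exact: cvg_snd].
apply: (@subclosed_compact _ _ (p @` S)); first exact: closed_cnorm2_le.
  by apply: continuous_compact => //; exact: continuous_subspaceT.
move=> z zr; exists (re z, im z); last by rewrite /p; case: z zr.
have aux (x y : R) : x ^+ 2 + y ^+ 2 <= r -> - (r + 1) <= x <= r + 1.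
  move=> h; rewrite -ler_norml.
  have r1 : 0 <= r + 1 by lra.
  rewrite -[r + 1]ger0_norm// -!sqrtr_sqr ler_wsqrtr//.
  by have := sqr_ge0 y; have := sqr_ge0 r; lra.
by split; rewrite /= in_itv /=; [exact: aux zr|apply: (aux _ (re z)); rewrite addrC].
Qed.

Definition core (r : R) : set C := [set z | cnorm2 z <= r] `&`
  ([set z | r^-1 <= cnorm2 (z + 0)] `&`
  ([set z | r^-1 <= cnorm2 (z + -1)] `&` [set z | r^-1 <= cnorm2 (z + 1)])).

Lemma compact_core r : 0 < r -> compact (core r).
Proof.
move=> r0; apply: (@subclosed_compact _ _ [set z : C | cnorm2 z <= r]).
- by do ?apply: closedI; [exact: closed_cnorm2_le|exact: closed_cnorm2_ge
    |exact: closed_cnorm2_ge|exact: closed_cnorm2_ge].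
- exact: compact_disc.
- by move=> z [].
Qed.

Lemma core_sub r : 0 < r -> core r `<=` M.
Proof.
move=> r0 z [_ [h0 [h1 h2]]].
have pos (c : C) : r^-1 <= cnorm2 (z + c) -> z + c != 0.
  by move=> h; rewrite -cnorm2_gt0 (lt_le_trans _ h)// invr_gt0.
split; first by have := pos _ h0; rewrite addr0.
  by rewrite -subr_eq0; exact: pos.
by rewrite -addr_eq0; exact: pos.
Qed.

Lemma proper_fun_core r z : 0 < r -> M z -> proper_fun z <= r -> core r z.
Proof.
move=> r0 Mz; have [z0 z1 zN1] := Mz; have [A0 B0] := twice_puncturedP (thrice_twice Mz).
have N0 : 0 < cnorm2 z by rewrite cnorm2_gt0.
have iN : 0 < (cnorm2 z)^-1 by rewrite invr_gt0.
have iA : 0 < (cnorm2 (z - 1))^-1 by rewrite invr_gt0.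
have iB : 0 < (cnorm2 (z + 1))^-1 by rewrite invr_gt0.
have flip (x : R) : 0 < x -> x^-1 <= r -> r^-1 <= x.
  by move=> x0 h; rewrite -[x]invrK lef_pV2 ?posrE ?invr_gt0.
rewrite /proper_fun => h; split; first by rewrite /=; lra.
split; first by rewrite /= addr0; apply: flip => //; lra.
by split; apply: flip => //; lra.
Qed.

Lemma Ck_coord m n j (F : C -> 'M[R]_(m.+1, n.+1)) a b :
  Ck j M F -> Ck j M (fun z => F z a b).
Proof.
elim: j F => [|j IH] F Fj.
  split=> // z Mz; apply: (@continuous_comp _ _ _ F (fun A : 'M[R]_(m.+1, n.+1) => A a b)).
    exact: Ck_continuous Fj Mz.
  exact: coord_continuous.
apply: (CkS_intro oM (d := fun i z => pd i F z a b)).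
- move=> z Mz; apply: (@continuous_comp _ _ _ F (fun A : 'M[R]_(m.+1, n.+1) => A a b)).
    exact: Ck_continuous Fj Mz.
  exact: coord_continuous.
- by move=> i z Mz; apply: pd_mx; exact: has_pd_ex (CkS_has_pd i Fj Mz).
- by move=> i; apply: IH; exact: CkS_pd.
Qed.

Lemma smooth_first_form f : smooth M f -> smooth M (first_form f).
Proof.
move=> sf j; apply: (Ck_mx oM) => a b.
have c i s : Ck j M (fun z => pd i f z 0 s) by apply: Ck_coord; apply: CkS_pd; exact: sf.
apply: (Ck_ext oM (h1 := fun z => - (pd a f z 0 0 * pd b f z 0 0) +
  pd a f z 0 1 * pd b f z 0 1 + pd a f z 0 2 * pd b f z 0 2 + pd a f z 0 3 * pd b f z 0 3)).
  by move=> z _; rewrite mxE.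
have cM s : Ck j M (fun z => pd a f z 0 s * pd b f z 0 s) by exact: (CkM oM).
by do 3 apply: (CkD oM) => //; exact: (CkN oM).
Qed.

(** Near the ends [gap_lower] supplies the bounds of the criterion. On the compact rest, where the
    front may be singular, a bump times the Euclidean metric supplies them; adding it elsewhere does
    no harm since it is nonnegative. *)
Lemma surf_complete : complete_front M (surf k 1 1).
Proof.
have [e [de [e0 e16 de0 H]]] := gap_lower.
(* Outside the regions of [gap_lower] each of the four terms of [proper_fun] is at most 1/e, so
   there [r - proper_fun] is at least 1 and [tf] at least exp(-1). *)
pose r := 4 * e^-1 + 1.
have r0 : 0 < r by rewrite /r ltr_wpDl// mulr_ge0// invr_ge0 ltW.
pose tf (z : C) := flat_exp 0 (r - proper_fun z).
pose T (z : C) : 'M[R]_2 := (tf z)%:M.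
have stf : smooth M tf.
  move=> j; apply: (Ck_flat_exp oM); apply: (CkD oM); first exact: (Ck_cst oM).
  by apply: (CkN oM); exact: smooth_proper_fun.
have sT : smooth M T.
  move=> j; apply: (Ck_mx oM) => a b.
  apply: (Ck_ext oM (h1 := fun z => tf z * (a == b)%:R)).
    by move=> z _; rewrite mxE mulr_natr.
  by apply: (CkM oM); [exact: stf|exact: (Ck_cst oM)].
exists T, (core r); split => //.
- by move=> z _; rewrite tr_scalar_mx.
- by split; [exact: compact_core|exact: core_sub].
- move=> z Mz nz; rewrite /T /tf flat_exp_eq0 ?raddf0//.
  rewrite subr_le0 leNgt; apply/negP => /ltW h; apply: nz.
  exact: proper_fun_core.
set g := fun z => _.
have quadT z v : quad (g z) v = quad (first_form (surf k 1 1) z) v +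
    tf z * (v 0 0 ^+ 2 + v 0 1 ^+ 2).
  have gE i j : g z i j = first_form (surf k 1 1) z i j + tf z *+ (i == j).
    by rewrite /g mxE; congr (_ + _); rewrite mxE.
  rewrite !quadE !gE; move: (first_form _ z) (tf z) => A t.
  by rewrite /= !mulr1n !mulr0n; ring.
(* On the rest [tf] is at least exp(-1) and each squared distance to a puncture at least [e]. *)
pose c0 := expR (- 1 : R) * e.
have c00 : 0 < c0 by rewrite mulr_gt0// expR_gt0.
have tf0 z : 0 <= tf z by exact: flat_exp_ge0.
have weight z : M z -> Num.min de c0 <= gap2 k z + tf z /\
    forall b, b \in punctures -> Num.min de c0 <= cnorm2 (z - b) * (gap2 k z + tf z).
  move=> Mz; have g0 : 0 <= gap2 k z by exact: sqr_ge0.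
  have [A0 B0] := twice_puncturedP (thrice_twice Mz).
  have N0 : 0 < cnorm2 z by rewrite cnorm2_gt0; case: Mz.
  have [near|far] := pselect ((exists2 b, b \in punctures & cnorm2 (z - b) < e) \/ e^-1 < cnorm2 z).
    have [h1 h2] := H z Mz near; split.
      by rewrite ge_min (le_trans h1)// lerDl.
    move=> b bP; rewrite ge_min (le_trans (h2 b bP))//.
    by rewrite ler_wpM2l ?cnorm2_ge0// lerDl.
  have farP b : b \in punctures -> e <= cnorm2 (z - b).
    by move=> bP; rewrite leNgt; apply/negP => h; apply: far; left; exists b.
  have Ne : cnorm2 z <= e^-1 by rewrite leNgt; apply/negP => h; apply: far; right.
  have f0 : e <= cnorm2 (z - 0) by apply: farP; rewrite !inE eqxx.
  have f1 : e <= cnorm2 (z - 1) by apply: farP; rewrite !inE eqxx orbT.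
  have f2 : e <= cnorm2 (z - -1) by apply: farP; rewrite !inE eqxx !orbT.
  rewrite subr0 in f0; rewrite opprK in f2.
  have tf1 : expR (-1) <= tf z.
    apply: flat_exp0_ge; rewrite lerBrDr /r [1 + _]addrC lerD2r /proper_fun.
    have inv (x : R) : e <= x -> x^-1 <= e^-1.
      by move=> ex; rewrite lef_pV2 ?posrE// (lt_le_trans e0).
    have := inv _ f0; have := inv _ f1; have := inv _ f2; lra.
  split.
    rewrite ge_min; apply/orP; right; rewrite (le_trans (_ : _ <= expR (-1)))//.
      by rewrite ler_piMr ?expR_ge0// (le_trans e16)// invf_le1 ?ltr0n ?ler1n.
    by rewrite (le_trans tf1)// lerDr.
  move=> b bP; rewrite ge_min; apply/orP; right; rewrite /c0 mulrC ler_pM ?expR_ge0 ?(ltW e0)//.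
    exact: farP.
  by rewrite (le_trans tf1)// lerDr.
have dd0 : 0 < Num.min de c0 by rewrite lt_min de0 c00.
have ME : M = [set z | z \notin punctures].
  apply/seteqP; split => z /=; rewrite !inE !negb_or.
    by move=> [-> -> ->].
  by move=> /and3P[].
have gM : riemannian_metric M g.
  split.
    by move=> j; apply: (CkD oM); [exact: (smooth_first_form (@smooth_surf R k 1 1))|exact: sT].
  move=> z Mz; split.
    apply/matrixP => i j; rewrite !mxE lorentzC; congr (_ + _ *+ _).
    by rewrite eq_sym.
  move=> v v0; rewrite quadT.
  have v2 : 0 < v 0 0 ^+ 2 + v 0 1 ^+ 2.
    rewrite lt0r addr_ge0 ?sqr_ge0// andbT; apply: contra v0 => h.
    have : cnorm2 (v 0 0 +i* v 0 1 : C) == 0 by [].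
    by rewrite cnorm2_eq0 => /eqP/row2_eq0 ->.
  have [h _] := weight z Mz; apply: lt_le_trans (lerD (gap2_le_quad k v Mz) (lexx _)).
  by rewrite -mulrDl mulr_gt0// (lt_le_trans dd0).
have low z (v : 'rV[R]_2) : M z -> (gap2 k z + tf z) * (v 0 0 ^+ 2 + v 0 1 ^+ 2) <= quad (g z) v.
  by move=> Mz; rewrite quadT mulrDl lerD2r; exact: gap2_le_quad.
have v2 (v : 'rV[R]_2) : 0 <= v 0 0 ^+ 2 + v 0 1 ^+ 2 by rewrite addr_ge0 ?sqr_ge0.
rewrite ME; apply: (@complete_of_lower_bounds _ punctures g (Num.min de c0)).
- by rewrite -ME.
- by rewrite -ME; exact: oM.
- exact: dd0.
- rewrite -ME => z v Mz; have [h _] := weight z Mz.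
  by apply: le_trans (low z v Mz); rewrite ler_wpM2r.
- rewrite -ME => b z v bP Mz; have [_ h] := weight z Mz.
  apply: le_trans (ler_wpM2l (cnorm2_ge0 _) (low z v Mz)).
  by rewrite mulrA ler_wpM2r// h.
Qed.

End Completeness.

Lemma continuous_pair (T U V : topologicalType) (f : T -> U) (g : T -> V) x :
  {for x, continuous f} -> {for x, continuous g} ->
  {for x, continuous (fun t => (f t, g t))}.
Proof. by move=> fx gx; exact: (cvg_pair fx gx). Qed.

(** * Continuous arguments and their transport along homotopies *)

Section AngleLift.
Variable R : realType.
Local Notation C := (Cplane R).

Definition polar (w : C) (a : R) :=
  exists2 r : R, 0 < r & w = (r * cos a) +i* (r * sin a).

Lemma polarM w1 w2 a1 a2 : polar w1 a1 -> polar w2 a2 -> polar (w1 * w2) (a1 + a2).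
Proof.
move=> [r r0 ->] [s s0 ->]; exists (r * s); first exact: mulr_gt0.
by apply: eqC; rewrite reimE /= ?cosD ?sinD; ring.
Qed.

Lemma polar_conj w a : polar w a -> polar (conjc w) (- a).
Proof. by move=> [r r0 ->]; exists r => //; rewrite cosN sinN mulrN. Qed.

Lemma polar_real (r : R) : 0 < r -> polar r%:C 0.
Proof. by move=> r0; exists r => //; rewrite cos0 sin0 mulr1 mulr0. Qed.

Lemma polar_atan (w : C) : 0 < re w -> polar w (atan (im w / re w)).
Proof.
move=> w0; set x := im w / re w.
exists (re w * Num.sqrt (1 + x ^+ 2)).
  by rewrite mulr_gt0// sqrtr_gt0 ltr_pwDl// sqr_ge0.
have s0 : Num.sqrt (1 + x ^+ 2) != 0.
  by rewrite gt_eqF// sqrtr_gt0 ltr_pwDl// sqr_ge0.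
have c0 : cos (atan x) != 0 by rewrite cos_atan invr_eq0.
have sE : sin (atan x) = x * cos (atan x).
  have E : sin (atan x) / cos (atan x) = x := atanK x.
  by rewrite -{2}E divfK.
apply: eqC => /=; rewrite ?sE cos_atan; first by rewrite -mulrA mulfV// mulr1.
rewrite [x * _]mulrC mulrA -[_ * _ * _^-1]mulrA mulfV// mulr1 /x mulrC divfK//.
by rewrite gt_eqF.
Qed.

Lemma polar_unique w a b : polar w a -> polar w b -> cos (a - b) = 1.
Proof.
move=> Pa Pb; have [r r0 E] := polarM Pa (polar_conj Pb).
have [s s0 ws] := Pa.
have w2 : w * conjc w = (s ^+ 2)%:C.
  by rewrite ws; apply: eqC; rewrite reimE /=; [|ring];
    rewrite !mulrN opprK -!expr2 !exprMn -mulrDr cos2Dsin2 mulr1.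
move: E; rewrite w2 => -[rc rs].
have sin0 : sin (a - b) = 0.
  by apply/eqP; move/esym/eqP: rs; rewrite mulf_eq0 gt_eqF.
have c2 : cos (a - b) ^+ 2 = 1 by have := cos2Dsin2 (a - b); rewrite sin0 expr0n addr0.
have c0 : 0 < cos (a - b) by rewrite -(pmulr_rgt0 _ r0) -rc exprn_gt0.
by apply/eqP; rewrite -(@eqrXn2 _ 2)// ?c2 ?expr1n// ltW.
Qed.

Definition angle_lift (g : R -> C) (p : R -> R) :=
  continuous p /\ forall t, polar (g t) (p t).

(** The difference of two lifts is continuous with cosine 1. If it went from 0 to a positive value
    it would take one in ]0, 1], where the cosine, injective on [0, pi], is not 1. *)
Lemma angle_lift_unique g p1 p2 : angle_lift g p1 -> angle_lift g p2 ->
  p1 0 = p2 0 -> p1 1 = p2 1.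
Proof.
wlog le : p1 p2 / p2 1 <= p1 1.
  move=> H l1 l2 e; have [h|/ltW h] := leP (p2 1) (p1 1); first exact: H.
  by apply/esym; apply: H.
move=> [c1 l1] [c2 l2] e0; apply/eqP; rewrite eq_le le andbT leNgt; apply/negP => lt.
pose d t := p1 t - p2 t.
have dc : continuous d by move=> t; apply: continuousB; [exact: c1|exact: c2].
have d0 : d 0 = 0 by rewrite /d e0 subrr.
have d1 : 0 < d 1 by rewrite subr_gt0.
pose v := Num.min 1 (d 1).
have v0 : 0 < v by rewrite lt_min ltr01.
have [||t _ tv] := @IVT R d 0 1 v ler01.
- exact: continuous_subspaceT.
- by rewrite d0 (min_l (ltW d1)) (max_r (ltW d1)) (ltW v0) /= ge_min lexx orbT.
have cv : cos v = 1 by rewrite -tv; exact: polar_unique (l1 t) (l2 t).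
have vpi : v <= pi by rewrite (le_trans (_ : _ <= 1)) ?ge_min ?lexx// (le_trans _ (pi_ge2 R))// ler1n.
have := @cos_inj R; move=> /(_ v 0); rewrite !in_itv /= vpi ltW// lexx pi_ge0.
by rewrite cos0 cv => /(_ isT isT erefl) v00; move: v0; rewrite v00 ltxx.
Qed.

Definition relw (w0 w1 : C) : C := w1 * conjc w0.

(** While [g1] stays less than a right angle away from [g0], the difference of their arguments is a
    continuous [atan]. *)
Lemma angle_lift_step (g0 g1 : R -> C) p : continuous g0 -> continuous g1 ->
  (forall t, 0 < re (relw (g0 t) (g1 t))) -> angle_lift g0 p ->
  angle_lift g1 (fun t => p t + atan (im (relw (g0 t) (g1 t)) / re (relw (g0 t) (g1 t)))).
Proof.
move=> c0 c1 pos [cp lp]; split.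
  have cr : continuous (fun t => re (relw (g0 t) (g1 t))).
    move=> t; have [a0 b0] := (cvg_re (nbhs_filter t) (c0 t), cvg_im (nbhs_filter t) (c0 t)).
    have [a1 b1] := (cvg_re (nbhs_filter t) (c1 t), cvg_im (nbhs_filter t) (c1 t)).
    rewrite (_ : (fun t => _) = fun t => re (g1 t) * re (g0 t) + im (g1 t) * im (g0 t)).
      exact: (continuousD (continuousM a1 a0) (continuousM b1 b0)).
    by apply: funext => s; rewrite /relw !reimE mulrN opprK.
  have ci : continuous (fun t => im (relw (g0 t) (g1 t))).
    move=> t; have [a0 b0] := (cvg_re (nbhs_filter t) (c0 t), cvg_im (nbhs_filter t) (c0 t)).
    have [a1 b1] := (cvg_re (nbhs_filter t) (c1 t), cvg_im (nbhs_filter t) (c1 t)).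
    rewrite (_ : (fun t => _) = fun t => im (g1 t) * re (g0 t) - re (g1 t) * im (g0 t)).
      exact: (continuousB (continuousM b1 a0) (continuousM a1 b0)).
    by apply: funext => s; rewrite /relw !reimE; ring.
  move=> t; apply: continuousD; first exact: cp.
  apply: (@continuous_comp _ _ _ _ (@atan R)); last exact: continuous_atan.
  apply: continuousM; first exact: ci.
  by apply: continuousV; [rewrite gt_eqF|exact: cr].
move=> t; have [r r0 gE] := lp t.
have n0 : 0 < cnorm2 (g0 t).
  by rewrite gE cnorm2_polar exprn_gt0.
have := polarM (polarM (lp t) (polar_atan (pos t))) (polar_real (_ : 0 < (cnorm2 (g0 t))^-1)).
rewrite invr_gt0 => /(_ n0); rewrite addr0.
have -> : g0 t * relw (g0 t) (g1 t) * ((cnorm2 (g0 t))^-1)%:C = g1 t; last by [].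
have E : g0 t * conjc (g0 t) = (cnorm2 (g0 t))%:C.
  by apply: eqC; rewrite /cnorm2 !reimE /=; ring.
rewrite /relw mulrCA E -mulrA -rmorphM /= mulfV ?gt_eqF// mulr1 //.
Qed.

(** Cut the homotopy into steps so short that [angle_lift_step] applies to each; where [H] does not
    move, each correction is 0. Contracting a path gives existence of lifts, a homotopy of paths
    gives invariance. *)
Lemma lift_transport (H : R * R -> C) p :
  continuous H -> (forall u, H u != 0) ->
  (forall s t, H (s, t) = H (s, Num.max 0 (Num.min 1 t))) ->
  angle_lift (fun t => H (0, t)) p ->
  exists q, angle_lift (fun t => H (1, t)) q /\
    forall t, (forall s, H (s, t) = H (0, t)) -> q t = p t.
Proof.
move=> cH H0 Hcl lp.
pose cl t : R := Num.max 0 (Num.min 1 t).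
(* Compactness of the square makes the admissible step uniform; the clamping of [t] reduces the
   whole line to it. *)
have near_step : \forall de \near (0 : R), forall u : R * R, (`[0, 1] `*` `[0, 1]) u ->
    0 < re (relw (H u) (H (u.1 + de, u.2))).
  have cK : compact (`[0, 1]%classic `*` `[0, 1]%classic : set (R * R)).
    by apply: compact_setX; exact: segment_compact.
  move/compact_near_coveringP : cK => /(_ R (nbhs (0 : R))
    (fun de u => 0 < re (relw (H u) (H (u.1 + de, u.2)))) _).
  apply=> u _.
  pose F (x : (R * R) * R) := re (relw (H x.1) (H (x.1.1 + x.2, x.1.2))).
  have cF : continuous F.
    move=> x.
    have c1 : {for x, continuous (fun x : (R * R) * R => H x.1)}.
      by apply: (@continuous_comp _ _ _ fst H); [exact: cvg_fst|exact: cH].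
    have c2 : {for x, continuous (fun x : (R * R) * R => H (x.1.1 + x.2, x.1.2))}.
      apply: (@continuous_comp _ _ _ (fun x : (R * R) * R => (x.1.1 + x.2, x.1.2)) H);
        last exact: cH.
      have f11 : {for x, continuous (fun x : (R * R) * R => x.1.1)}.
        by apply: (@continuous_comp _ _ _ fst fst); exact: cvg_fst.
      have f12 : {for x, continuous (fun x : (R * R) * R => x.1.2)}.
        by apply: (@continuous_comp _ _ _ fst snd); [exact: cvg_fst|exact: cvg_snd].
      have f2 : {for x, continuous (fun x : (R * R) * R => x.2)} by exact: cvg_snd.
      exact: (continuous_pair (continuousD f11 f2) f12).
    have [a0 b0] := (cvg_re (nbhs_filter x) c1, cvg_im (nbhs_filter x) c1).
    have [a1 b1] := (cvg_re (nbhs_filter x) c2, cvg_im (nbhs_filter x) c2).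
    rewrite /F (_ : (fun x => _) = fun x => re (H (x.1.1 + x.2, x.1.2)) * re (H x.1) +
      im (H (x.1.1 + x.2, x.1.2)) * im (H x.1)).
      exact: (continuousD (continuousM a1 a0) (continuousM b1 b0)).
    by apply: funext => s; rewrite /relw !reimE mulrN opprK.
  have F0 : 0 < F (u, 0).
    rewrite /F /= addr0 -surjective_pairing.
    have -> : re (relw (H u) (H u)) = cnorm2 (H u) by rewrite /relw /cnorm2 !reimE; ring.
    by rewrite cnorm2_gt0.
  have := @cvgr_gt _ _ (nbhs (u, 0 : R)) (nbhs_filter _) _ _ (cF (u, 0)) _ F0.
  by [].
have [d /= d0 dP] := near_step.
have [N Nd] := ltr_add_invr d0; rewrite add0r in Nd.
pose e : R := N.+1%:R^-1.
have e0 : 0 < e by rewrite invr_gt0.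
have pos n t : (n <= N)%N ->
    0 < re (relw (H (n%:R * e, t)) (H (n.+1%:R * e, t))).
  move=> nN; rewrite (Hcl (n%:R * e)) (Hcl (n.+1%:R * e)).
  have := dP e; rewrite /ball_ /= sub0r normrN gtr0_norm// => /(_ Nd).
  move=> /(_ (n%:R * e, Num.max 0 (Num.min 1 t))) /=.
  rewrite -[n.+1%:R]natr1 mulrDl mul1r; apply; split; rewrite /= in_itv /=.
    rewrite mulr_ge0 ?(ltW e0)//= /e ler_pdivrMr// mul1r ler_nat.
    exact: leqW.
  by rewrite le_max lexx /= ge_max ler01 ge_min lexx.
have line (s : R) : continuous (fun t => H (s, t)).
  move=> t; apply: (@continuous_comp _ _ _ (fun t => (s, t)) H); last exact: cH.
  by apply: continuous_pair; [exact: cst_continuous|exact: cvg_id].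
have ind n : (n <= N.+1)%N -> exists q, angle_lift (fun t => H (n%:R * e, t)) q /\
    forall t, (forall s, H (s, t) = H (0, t)) -> q t = p t.
  elim: n => [|n IH] nN.
    by exists p; split=> //; rewrite mul0r.
  have [q [lq qp]] := IH (ltnW nN).
  eexists; split; first exact: (angle_lift_step (line _) (line _) (fun t => pos n t nN) lq).
  move=> t Ht; rewrite /= qp// !Ht.
  have -> : im (relw (H (0, t)) (H (0, t))) = 0 by rewrite /relw !reimE; ring.
  by rewrite mul0r atan0 addr0.
have [q [lq qp]] := ind N.+1 (leqnn _).
by exists q; split=> //; move: lq; rewrite /e mulfV// pnatr_eq0.
Qed.

End AngleLift.

(** * Change of the argument of (z - 1)/(z + 1) along a path *)

Section TotalAngle.
Variable R : realType.
Local Notation C := (Cplane R).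
Local Notation M := (thrice_punctured_plane R).

(** Paths are controlled on [0, 1] only; composing with this retraction makes them continuous on the
    line. *)
Definition clamp (t : R) : R := Num.max 0 (Num.min 1 t).

Lemma clamp_itv t : 0 <= clamp t <= 1.
Proof. by rewrite /clamp le_max lexx /= ge_max ler01 ge_min lexx. Qed.

Lemma clamp_id t : 0 <= t <= 1 -> clamp t = t.
Proof. by move=> /andP[t0 t1]; rewrite /clamp (min_r t1) (max_r t0). Qed.

Lemma clamp0 : clamp 0 = 0. Proof. by rewrite clamp_id// lexx ler01. Qed.
Lemma clamp1 : clamp 1 = 1. Proof. by rewrite clamp_id// lexx ler01. Qed.

Lemma clampK t : clamp (clamp t) = clamp t.
Proof. exact/clamp_id/clamp_itv. Qed.

Lemma clamp_continuous : continuous clamp.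
Proof.
move=> t; apply: continuous_max; first exact: cst_continuous.
by apply: continuous_min; [exact: cst_continuous|exact: cvg_id].
Qed.

Lemma path_clamp_continuous (c : R -> C) : {within `[0, 1], continuous c} ->
  continuous (fun t => c (clamp t)).
Proof.
move=> /subspace_continuousP cc t.
have ct : `[0, 1]%classic (clamp t) by rewrite /= in_itv /= clamp_itv.
have := cc _ ct; apply: (@cvg_comp _ _ _ clamp c).
move=> A /= HA; apply: (@filterS _ (nbhs t) (nbhs_filter t) _ _ _ (clamp_continuous HA)) => s.
by apply; rewrite /= in_itv /= clamp_itv.
Qed.

Lemma square_clamp_continuous (H : R * R -> C) :
  {within `[0, 1] `*` `[0, 1], continuous H} ->
  continuous (fun u : R * R => H (clamp u.1, clamp u.2)).
Proof.
move=> /subspace_continuousP cc u.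
pose cl (u : R * R) := (clamp u.1, clamp u.2).
have cu v : (`[0, 1] `*` `[0, 1])%classic (cl v).
  by split; rewrite /= in_itv /= clamp_itv.
have ccl : {for u, continuous cl}.
  apply: continuous_pair; apply: (@continuous_comp _ _ _ _ clamp).
  - exact: cvg_fst.
  - exact: clamp_continuous.
  - exact: cvg_snd.
  - exact: clamp_continuous.
have := cc _ (cu u); apply: (@cvg_comp _ _ _ cl H).
move=> A /= HA; apply: (@filterS _ (nbhs u) (nbhs_filter u) _ _ _ (ccl _ HA)) => s.
by apply; exact: cu.
Qed.

Lemma moebius_dir_neq0 (z : C) : M z -> moebius_dir z != 0.
Proof.
move=> /thrice_twice/twice_puncturedP[A0 B0].
by rewrite moebius_dirE -cnorm2_eq0 cnorm2M cnorm2_conj mulf_neq0// gt_eqF.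
Qed.

Definition rel_path (c : R -> C) (t : R) : C := rel_dir (c 0) (c (clamp t)).

Definition has_angle (c : R -> C) (d : R) :=
  exists p, [/\ angle_lift (rel_path c) p, p 0 = 0 & p 1 = d].

Definition total_angle (c : R -> C) : R := xget 0 (has_angle c).

Lemma rel_dir_neq0 (z0 z : C) : M z0 -> M z -> rel_dir z0 z != 0.
Proof.
move=> M0 Mz; rewrite /rel_dir mulf_neq0 ?moebius_dir_neq0//.
by rewrite -cnorm2_eq0 cnorm2_conj cnorm2_eq0 moebius_dir_neq0.
Qed.

Lemma rel_dir_continuous (z0 : C) : continuous (rel_dir z0).
Proof.
move=> z; apply: (@continuousM _ _ (@moebius_dir R : C -> C) (fun=> conjc (moebius_dir z0))).
  exact: continuous_moebius_dir.
exact: cst_continuous.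
Qed.

Lemma rel_dir_cst (z0 : C) : M z0 -> angle_lift (fun=> rel_dir z0 z0) (fun=> 0).
Proof.
move=> Mz0; split; first exact: cst_continuous.
move=> t; have -> : rel_dir z0 z0 = (cnorm2 (moebius_dir z0))%:C.
  by apply: eqC; rewrite /rel_dir /cnorm2 !reimE /=; ring.
by apply: polar_real; rewrite cnorm2_gt0 moebius_dir_neq0.
Qed.

Lemma path_pointE z0 c : is_path M z0 c -> forall t, M (c (clamp t)).
Proof. by move=> [_ Mc _] t; apply: Mc; exact: clamp_itv. Qed.

(** Transport the constant lift along the contraction c(s t) of the path to its starting point. *)
Lemma has_angle_ex z0 c : is_path M z0 c -> exists d, has_angle c d.
Proof.
move=> pc; have [cc Mc c0] := pc.
have M0 : M (c 0) by apply: Mc; rewrite lexx ler01.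
pose H (u : R * R) := rel_dir (c 0) (c (clamp (u.1 * clamp u.2))).
have cH : continuous H.
  move=> u; apply: (@continuous_comp _ _ _ (fun u : R * R => c (clamp (u.1 * clamp u.2))));
    last exact: rel_dir_continuous.
  apply: (@continuous_comp _ _ _ (fun u : R * R => u.1 * clamp u.2) (fun t => c (clamp t)));
    last exact: path_clamp_continuous.
  apply: continuousM; first exact: cvg_fst.
  by apply: (@continuous_comp _ _ _ snd clamp); [exact: cvg_snd|exact: clamp_continuous].
have [||||q [lq qp]] := @lift_transport R H (fun=> 0).
- exact: cH.
- by move=> u; apply: rel_dir_neq0 => //; exact: path_pointE pc _.
- by move=> s t; rewrite /H /= -/(clamp t) clampK.
- have := rel_dir_cst M0; congr (angle_lift _ _).
  by apply: funext => t; rewrite /H /= mul0r clamp0.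
- exists (q 1), q; split=> //.
    have -> : rel_path c = fun t => H (1, t) by apply: funext => t; rewrite /H /= mul1r clampK.
    exact: lq.
  by rewrite qp// => s; rewrite /H /= clamp0 !mulr0.
Qed.

Lemma has_angle_unique c d1 d2 : has_angle c d1 -> has_angle c d2 -> d1 = d2.
Proof.
move=> [p1 [l1 z1 <-]] [p2 [l2 z2 <-]].
by apply: angle_lift_unique l1 l2 _; rewrite z1 z2.
Qed.

Lemma has_total_angle z0 c : is_path M z0 c -> has_angle c (total_angle c).
Proof. by move=> /has_angle_ex[d Hd]; exact: xgetPex (ex_intro _ d Hd). Qed.

Lemma total_angleE z0 c d : is_path M z0 c -> has_angle c d -> total_angle c = d.
Proof. by move=> pc; apply: has_angle_unique; exact: has_total_angle pc. Qed.

(** Transport a lift along the homotopy: the endpoints are fixed, so the values of the lift at 0 and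
    1 do not change. *)
Lemma total_angle_homotopic z0 c d : is_path M z0 c -> is_path M z0 d ->
  homotopic M c d -> total_angle c = total_angle d.
Proof.
move=> pc pd [H [cH MH Hcd Hend]]; have [_ Mc c0] := pc; have [_ _ d0] := pd.
have i01 : 0 <= (0 : R) <= 1 by rewrite lexx ler01.
have i11 : 0 <= (1 : R) <= 1 by rewrite lexx ler01.
have M0 : M (c 0) by exact: Mc.
apply/esym; apply: (total_angleE pd).
have [p [lp p0 p1]] := has_total_angle pc.
pose G (u : R * R) := rel_dir (c 0) (H (clamp u.1, clamp u.2)).
have cG : continuous G.
  move=> u; apply: (@continuous_comp _ _ _ (fun u : R * R => H (clamp u.1, clamp u.2)));
    last exact: rel_dir_continuous.
  exact: square_clamp_continuous.
have [||||q [lq qp]] := @lift_transport R G p.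
- exact: cG.
- by move=> u; apply: rel_dir_neq0 => //; apply: MH; exact: clamp_itv.
- by move=> s t; rewrite /G /= -/(clamp t) clampK.
- have -> : (fun t => G (0, t)) = rel_path c.
    by apply: funext => t; rewrite /G /= clamp0 (Hcd _ (clamp_itv t)).1.
  exact: lp.
- exists q; split.
  + have -> : rel_path d = fun t => G (1, t).
      apply: funext => t; rewrite /G /rel_path /= clamp1 (Hcd _ (clamp_itv t)).2.
      by rewrite d0 c0.
    exact: lq.
  + by rewrite qp// => s; rewrite /G /= !clamp0 !(Hend _ _).1 ?clamp_itv.
  + by rewrite qp// => s; rewrite /G /= !clamp1 clamp0 !(Hend _ _).2 ?clamp_itv.
Qed.

(** Clamping fuses the two halves of the concatenation into one formula whose continuity is
    visible. *)
Lemma sheetE (c : R -> C) (z : C) u : 0 <= u <= 1 ->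
  sheet c z u = c (clamp (2 * u)) + (Num.max 0 (2 * u - 1))%:C * (z - c 1).
Proof.
move=> /andP[u0 u1]; rewrite /sheet /path_cat; case: ifPn => h.
  rewrite clamp_id; last by rewrite mulr_ge0//= -ler_pdivlMl// mulr1.
  rewrite max_l ?mul0r ?addr0// subr_le0 -ler_pdivlMl// mulr1 //.
rewrite -ltNge in h; have h1 : 1 < 2 * u by rewrite -ltr_pdivrMl// mulr1.
rewrite /segment max_r ?subr_ge0 ?(ltW h1)//; congr (c _ + _).
by rewrite /clamp (min_l (ltW h1)) max_r.
Qed.

Lemma sheet1 (c : R -> C) (z : C) : sheet c z 1 = z.
Proof.
rewrite sheetE ?lexx ?ler01//.
have -> : clamp (2 * 1) = 1.
  by rewrite /clamp mulr1 min_l ?ler1n// max_r.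
have -> : 2 * 1 - 1 = 1 :> R by ring.
by rewrite max_r// mul1r addrC subrK.
Qed.

Lemma sheet0 (c : R -> C) (z : C) : sheet c z 0 = c 0.
Proof.
by rewrite sheetE ?lexx ?ler01// mulr0 clamp0 max_l ?mul0r ?addr0// sub0r lerN10.
Qed.

(** On a short final segment the direction stays within a right angle of the one at [c 1]. The lift
    of the extended path is therefore the lift of [c], stopped at its end, corrected by a single
    [angle_lift_step]. *)
Lemma total_angle_sheet z0 c : is_path M z0 c ->
  \forall z \near c 1, total_angle (sheet c z) = total_angle c + local_arg (c 1) z.
Proof.
move=> pc; have [cc Mc c0] := pc.
have i01 : 0 <= (0 : R) <= 1 by rewrite lexx ler01.
have i11 : 0 <= (1 : R) <= 1 by rewrite lexx ler01.
have M0 : M (c 0) by exact: Mc.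
have M1 : M (c 1) by exact: Mc.
have near1 := near_rel_dir (thrice_twice M1).
have near2 := open_nbhs_nbhs (conj (@open_thrice_punctured R) M1).
have [r r0 rP] := (nbhs_square (c 1) _).1 (nbhs_andC near1 near2).
apply: (nbhs_square (c 1) _).2; exists r => // z zx zy.
pose sg t : C := c (clamp (2 * clamp t)) + (Num.max 0 (2 * clamp t - 1))%:C * (z - c 1).
have sgE t : sheet c z (clamp t) = sg t by rewrite sheetE ?clamp_itv.
have c2 : continuous (fun t => c (clamp (2 * clamp t))).
  move=> t; apply: (@continuous_comp _ _ _ (fun t => 2 * clamp t) (fun t => c (clamp t)));
    last exact: path_clamp_continuous.
  by apply: continuousM; [exact: cst_continuous|exact: clamp_continuous].
have csg : continuous sg.
  move=> t.
  have cm : {for t, continuous (fun t => Num.max 0 (2 * clamp t - 1))}.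
    apply: continuous_max; first exact: cst_continuous.
    apply: continuousB; last exact: cst_continuous.
    by apply: continuousM; [exact: cst_continuous|exact: clamp_continuous].
  have cmC : {for t, continuous (fun t => (Num.max 0 (2 * clamp t - 1))%:C : C)}.
    by apply: continuous_reim; [exact: cm|exact: cst_continuous].
  have cz : {for t, continuous (fun=> z - c 1 : C)} by exact: cst_continuous.
  exact: (continuousD (c2 t) (continuousM cmC cz)).
have seg_ok t : [/\ M (sg t) & 0 < re (rel_dir (c (clamp (2 * clamp t))) (sg t))].
  rewrite /sg; set u := clamp t.
  have u01 : 0 <= u <= 1 by exact: clamp_itv.
  have [h|h] := lerP (2 * u - 1) 0.
    rewrite mul0r addr0; split; first exact: path_pointE pc _.
    apply: rel_dir_self; apply: thrice_twice; exact: path_pointE pc _.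
  have -> : clamp (2 * u) = 1 by rewrite /clamp min_l ?max_r//; lra.
  have v01 : 0 <= 1 - (2 * u - 1) <= 1.
    by case/andP: u01 => ? ?; apply/andP; split; lra.
  have [h1 h2] := square_segment r0 zx zy v01.
  have -> : c 1 + (2 * u - 1)%:C * (z - c 1) = z + (1 - (2 * u - 1))%:C * (c 1 - z).
    by rewrite rmorphB /=; ring.
  by have [[_ ?] ?] := rP _ h1 h2.
have [p [[cp lp] p0 p1]] := has_total_angle pc.
pose g0 t := rel_dir (c 0) (c (clamp (2 * clamp t))).
have l0 : angle_lift g0 (fun t => p (clamp (2 * clamp t))).
  split; last first.
    by move=> t; have := lp (clamp (2 * clamp t)); rewrite /rel_path clampK.
  move=> t; apply: (@continuous_comp _ _ _ (fun t => clamp (2 * clamp t)) p); last exact: cp.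
  apply: (@continuous_comp _ _ _ (fun t => 2 * clamp t) clamp); last exact: clamp_continuous.
  by apply: continuousM; [exact: cst_continuous|exact: clamp_continuous].
pose g1 t := rel_dir (c 0) (sg t).
(* Measuring both directions from the base point [a] introduces a positive factor that cancels in
   the quotient under [atan]. *)
have rel_rel (a b w : C) : relw (rel_dir a b) (rel_dir a w) =
    (cnorm2 (moebius_dir a))%:C * rel_dir b w.
  rewrite /relw /rel_dir; case: (moebius_dir a) => a1 a2.
  case: (moebius_dir b) => b1 b2; case: (moebius_dir w) => w1 w2.
  by apply: eqC; rewrite /cnorm2 !reimE /=; ring.
have n0 : 0 < cnorm2 (moebius_dir (c 0)) by rewrite cnorm2_gt0 moebius_dir_neq0.
have reC (x : R) (w : C) : re (x%:C * w) = x * re w by rewrite reimE /= mul0r subr0.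
have imC (x : R) (w : C) : im (x%:C * w) = x * im w by rewrite reimE /= mul0r addr0.
have cg0 : continuous g0.
  by move=> t; apply: (@continuous_comp _ _ _ _ (rel_dir (c 0)));
    [exact: c2|exact: rel_dir_continuous].
have cg1 : continuous g1.
  by move=> t; apply: (@continuous_comp _ _ _ sg (rel_dir (c 0)));
    [exact: csg|exact: rel_dir_continuous].
have l1 := angle_lift_step cg0 cg1 _ l0.
have pos t : 0 < re (relw (g0 t) (g1 t)).
  by rewrite rel_rel reC mulr_gt0//; have [] := seg_ok t.
have {}l1 := l1 pos.
have csheet : {within `[0, 1], continuous (sheet c z)}.
  apply/subspace_continuousP => t; rewrite /= in_itv /= => t01.
  have E : sheet c z t = sg t by rewrite -sgE clamp_id.
  have cE : sg t = sheet c z t by rewrite E.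
  move=> A /= HA; move: (csg t A); rewrite cE => /(_ HA) HA'.
  apply: (@filterS _ (nbhs t) (nbhs_filter t) _ _ _ HA') => s As s01.
  have Es : sg s = sheet c z s by rewrite -sgE clamp_id.
  by rewrite /= Es in As.
have ps : is_path M z0 (sheet c z).
  split; [exact: csheet| |by rewrite sheet0].
  move=> t t01; rewrite -(clamp_id t01) sgE; by have [] := seg_ok t.
apply: (total_angleE ps); eexists; split.
- have -> : rel_path (sheet c z) = g1.
    by apply: funext => t; rewrite /rel_path sheet0 sgE.
  exact: l1.
- cbv beta; rewrite clamp0 mulr0 clamp0 p0.
  have -> : g0 0 = rel_dir (c 0) (c 0) by rewrite /g0 clamp0 mulr0 clamp0.
  have -> : g1 0 = rel_dir (c 0) (c 0) by rewrite /g1 -sgE clamp0 sheet0.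
  rewrite rel_rel reC imC.
  have -> : im (rel_dir (c 0) (c 0)) = 0 by rewrite /rel_dir !reimE; ring.
  by rewrite mulr0 mul0r atan0 addr0.
- cbv beta; rewrite clamp1 mulr1; have E2 : clamp 2 = 1 by rewrite /clamp min_l ?max_r ?ler1n.
  rewrite E2 p1; congr (_ + _).
  have -> : g0 1 = rel_dir (c 0) (c 1) by rewrite /g0 clamp1 mulr1 E2.
  have -> : g1 1 = rel_dir (c 0) z by rewrite /g1 -sgE clamp1 sheet1.
  rewrite rel_rel reC imC /local_arg; congr atan; symmetry.
  by rewrite -mulf_div mulfV ?mul1r// gt_eqF.
Qed.

End TotalAngle.

(** * The lift to SL(2, C) and the hyperbolic Gauss maps *)

Section HolomorphicLift.
Variable R : realType.
Local Notation C := (Cplane R).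
Variable k : R.
Local Notation M := (thrice_punctured_plane R).
Local Notation K := (k%:C : C).

(** The branch of the power, up to a constant of modulus 1, that is positive at the starting point,
    continued along [c]. *)
Definition branch_along (c : R -> C) : C :=
  (expR (k / 2 * logq (c 1)) * cos (k * total_angle c)) +i*
  (expR (k / 2 * logq (c 1)) * sin (k * total_angle c)).

Definition offdiag (t o : C) : 'M[R[i]]_2 :=
  \matrix_(i, j) if i == j then 0 else if i == 0 then t else o.

Definition lift (c : R -> C) : 'M[R[i]]_2 := frame k (branch_along c) (c 1).

Lemma cnorm2_branch_along c : cnorm2 (branch_along c) = qfun k (c 1).
Proof. by rewrite /branch_along cnorm2_polar /qfun expr2 -expRD; congr expR; field. Qed.

(** In the coordinate of the universal cover the lift is the frame of the local branch [eta], whose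
    derivatives are known. *)
Lemma lift_sheet z0 c : is_path M z0 c ->
  \forall z \near c 1, lift (sheet c z) = frame k (eta k (c 1) (k * total_angle c) z) z.
Proof.
move=> /total_angle_sheet; apply: (@filterS _ (nbhs (c 1)) (nbhs_filter _)) => z tz.
by rewrite /lift /branch_along tz sheet1 [k * (_ + _)]mulrDr.
Qed.

Lemma local_arg_self (z : C) : local_arg z z = 0.
Proof.
have -> : local_arg z z = atan 0; last exact: atan0.
congr atan.
have -> : im (rel_dir z z) = 0 by rewrite /rel_dir !reimE; ring.
by rewrite mul0r.
Qed.

Lemma eta_branch_along c : eta k (c 1) (k * total_angle c) (c 1) = branch_along c.
Proof. by rewrite /eta local_arg_self mulr0 addr0. Qed.

Lemma lift_is_derive z0 c : is_path M z0 c ->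
  let h := branch_along c in let z := c 1 in
  forall i j, cderiv (fun w => lift (sheet c w) i j) z
    ((frame k h z *m offdiag (theta k h z) (omega h z)) i j).
Proof.
move=> pc h z; have [_ Mc _] := pc.
have Mz : M z by apply: Mc; rewrite ler01 lexx.
pose g := eta k z (k * total_angle c).
have gz : g z = h by exact: eta_branch_along.
have g0 : g z != 0 by exact: eta_neq0.
have dg := nbhs_singleton (cderiv_eta k (k * total_angle c) (thrice_twice Mz)).
have tr i j (l : C) : cderiv (fun w => frame k (g w) w i j) z l ->
    cderiv (fun w => lift (sheet c w) i j) z l.
  apply: cderiv_near; apply: (@filterS _ (nbhs z) (nbhs_filter _) _ _ _ (lift_sheet pc)) => w.
  by move=> ->.
have E i j (l : C) : cderiv (fun w => frame k (g w) w i j) z l ->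
  l = (frame k h z *m offdiag (theta k h z) (omega h z)) i j ->
  cderiv (fun w => lift (sheet c w) i j) z ((frame k h z *m offdiag (theta k h z) (omega h z)) i j).
  by move=> d <-; exact: tr.
have d00 : cderiv (fun w => frame k (g w) w 0 0) z
    (e12 k (g z) z * omega (g z) z).
  have -> : (fun w => frame k (g w) w 0 0) = fun w => e11 (g w) w.
    by apply: funext => w; rewrite mxE.
  exact: cderiv_e11 Mz g0 dg.
have d01 : cderiv (fun w => frame k (g w) w 0 1) z
    (e11 (g z) z * theta k (g z) z).
  have -> : (fun w => frame k (g w) w 0 1) = fun w => e12 k (g w) w.
    by apply: funext => w; rewrite mxE.
  exact: cderiv_e12 Mz g0 dg.
have d10 : cderiv (fun w => frame k (g w) w 1 0) z
    (e22 k (g z) z * omega (g z) z).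
  have -> : (fun w => frame k (g w) w 1 0) = fun w => e21 (g w) w.
    by apply: funext => w; rewrite mxE.
  exact: cderiv_e21 Mz g0 dg.
have d11 : cderiv (fun w => frame k (g w) w 1 1) z
    (e21 (g z) z * theta k (g z) z).
  have -> : (fun w => frame k (g w) w 1 1) = fun w => e22 k (g w) w.
    by apply: funext => w; rewrite mxE.
  exact: cderiv_e22 Mz g0 dg.
apply: ord2P; apply: ord2P.
- by apply: (E _ _ _ d00); rewrite gz mxE sum2E !mxE /= mulr0 add0r.
- by apply: (E _ _ _ d01); rewrite gz mxE sum2E !mxE /= mulr0 addr0.
- by apply: (E _ _ _ d10); rewrite gz mxE sum2E !mxE /= mulr0 add0r.
- by apply: (E _ _ _ d11); rewrite gz mxE sum2E !mxE /= mulr0 addr0.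
Qed.

Lemma lift_holomorphic z0 : M z0 -> holomorphic_lift M z0 (surf k 1 1) (surf k 1 (-1)) lift.
Proof.
move=> Mz0; split.
  move=> c d pc pd cd; rewrite /lift /branch_along (total_angle_homotopic pc pd cd).
  have -> // : c 1 = d 1.
  have [H [_ _ He Hs]] := cd.
  have i11 : 0 <= (1 : R) <= 1 by rewrite lexx ler01.
  by rewrite -(He 1 i11).2 (Hs 1 i11).2.
move=> c pc; have [_ Mc _] := pc.
have Mz : M (c 1) by apply: Mc; rewrite ler01 lexx.
have hq := cnorm2_branch_along c.
have D := lift_is_derive pc.
have detE : \det (lift c) = 1 by exact: det_frame1.
have uE : lift c \in unitmx by rewrite unitmxE detE unitr1.
have cdE : cover_derive lift c = lift c *m offdiag (theta k (branch_along c) (c 1)) (omega (branch_along c) (c 1)).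
  apply/matrixP => i j; rewrite mxE; have [d <-] := D i j.
  by rewrite derive1E.
split=> //.
- split; first by move=> i j; have [] := D i j.
  (* The lower left entry of E^{-1}E' is [omega], so E' cannot vanish. *)
  apply/eqP => E0; have := omega_neq0 Mz hq; move/eqP; apply.
  have : invmx (lift c) *m cover_derive lift c = 0 by rewrite E0 mulmx0.
  by rewrite cdE mulKmx// => /matrixP/(_ 1 0); rewrite !mxE.
- by move=> i; rewrite cdE mulKmx// mxE eqxx.
- exact: herm_surf1.
- exact: herm_surfN.
Qed.

End HolomorphicLift.

(** With k = 1/a, multiplying both terms of z(kz+1)/(z+k) by a gives the second map; a(z+k) = az+1
    also makes the poles agree. *)
Lemma surf_gauss_maps (R : realType) (a : R) : a != 0 ->
  hyperbolic_gauss_maps (thrice_punctured_plane R) (surf a^-1 1 1) (surf a^-1 1 (-1))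
    (fun z => Some (z ^+ 2)) (fun z => sphere_div (z * (z + a%:C)) (a%:C * z + 1)).
Proof.
move=> a0 z0 Mz0; exists (lift a^-1); first exact: lift_holomorphic.
move=> c [_ Mc _].
have Mz : (thrice_punctured_plane R) (c 1) by apply: Mc; rewrite ler01 lexx.
have h0 := modulus_neq0 (cnorm2_branch_along a^-1 c).
have [z0' z1] := thriceP Mz; rewrite !mxE /=.
have aC : a%:C != 0 :> R[i] by rewrite fmorph_eq0.
have aV : (a^-1)%:C = (a%:C)^-1 :> R[i] by exact: fmorphV.
split.
  rewrite /sphere_div /e11 /e21 invr_eq0 mulf_eq0 (negPf z1) (negPf h0) /=.
  by congr Some; field; rewrite h0 z1.
rewrite /sphere_div /e12 /e22 aV.
have -> : (branch_along a^-1 c * ((c 1 + a%:C^-1) / c 1) == 0) = (a%:C * c 1 + 1 == 0).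
  rewrite !mulf_eq0 (negPf h0) /= invr_eq0 (negPf z0') orbF.
  by rewrite -(mulrI_eq0 _ (mulfI aC)) mulrDr mulfV.
case: ifPn => // n0; congr Some.
have n1 : c 1 + a%:C^-1 != 0.
  by rewrite -(mulrI_eq0 _ (mulfI aC)) mulrDr mulfV.
by field; rewrite h0 z0' aC n0.
Qed.

(** * Multiplicities and totally ramified values *)

Section Multiplicity.
Variable R : realType.
Local Notation C := (Cplane R).
Implicit Types (h : C -> sphere R) (g : C -> C).

Lemma near_nonzero g (z l : C) : cderiv g z l -> g z != 0 -> \forall w \near z, g w != 0.
Proof.
move=> /is_derive_continuous gc gz.
have := open_nbhs_nbhs (conj (@open_neq R 0) gz).
exact: gc.
Qed.

Lemma sphere_div1_inj : injective (@sphere_div R 1).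
Proof.
move=> u v; rewrite /sphere_div; case: ifPn => [/eqP->|u0]; case: ifPn => [/eqP->|v0] // [].
by rewrite !mul1r => /invr_inj.
Qed.

Lemma cderiv_shift_exp (z l : C) m (k : C -> C) : cderiv k z l ->
  cderiv (fun w => (w - z) ^+ m * k w) z
    ((0 ^+ m) * l + k z * (m%:R * 0 ^+ m.-1)).
Proof.
move=> dk; apply: cderiv_eq.
  apply: (@cderivM _ (fun w => (w - z) ^+ m) k) dk.
  by apply: cderivX; apply: cderivB; [exact: cderiv_id|exact: cderiv_cst].
by rewrite /= subrr subr0 mulr1.
Qed.

(** Differentiating c + (w-z)^m k(w) at z gives k(z), nonzero, for m = 1 and 0 for m >= 2; the value
    at z excludes m = 0. *)
Lemma exponent_eq1 g k (z c l : C) m : cderiv g z l -> holomorphic_at k z ->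
  k z != 0 -> g z = c -> (\forall w \near z, g w = c + (w - z) ^+ m * k w) ->
  m != 0%N /\ (m == 1%N) = (l != 0).
Proof.
move=> dg hk k0 gz near_g.
have m0 : m != 0%N.
  apply: contra k0 => /eqP m0; have := nbhs_singleton near_g.
  rewrite gz m0 expr0 mul1r => /eqP; rewrite -{1}[c]addr0 => /eqP/addrI <- //.
split=> //; have dk := derivableP (nbhs_singleton hk).
have d2 := cderivD (cderiv_cst c z) (cderiv_shift_exp m dk).
have d1 : cderiv g z _ := cderiv_near (filterS (fun w e => esym e) near_g) d2.
have [_ <-] := dg; have [_ ->] := d1.
rewrite add0r expr0n (negPf m0) mul0r add0r.
case: m m0 {near_g d2 d1} => [//|[|m]] _ /=; first by rewrite expr0 !mulr1 k0.
by rewrite exprS mul0r !mulr0 eqxx.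
Qed.

Lemma multiplicity_eq1 h g (z l : C) m :
  (\forall w \near z, h w = Some (g w)) -> cderiv g z l ->
  has_multiplicity h z m -> m != 0%N /\ (m == 1%N) = (l != 0).
Proof.
move=> hg dg [k [hk k0 hm]]; apply: (exponent_eq1 dg hk k0 erefl).
move: hm; rewrite (nbhs_singleton hg) => hm.
by apply: (@filterS2 _ (nbhs z) (nbhs_filter z) _ _ _ _ hg hm) => w -> [].
Qed.

Lemma pole_multiplicity_eq1 h g (z l : C) m :
  (\forall w \near z, h w = sphere_div 1 (g w)) -> g z = 0 -> cderiv g z l ->
  has_multiplicity h z m -> m != 0%N /\ (m == 1%N) = (l != 0).
Proof.
move=> hg gz dg [k [hk k0 hm]]; apply: (exponent_eq1 dg hk k0 gz).
have hz : h z = None by rewrite (nbhs_singleton hg) gz /sphere_div eqxx.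
move: hm; rewrite hz => hm.
apply: (@filterS2 _ (nbhs z) (nbhs_filter z) _ _ _ _ hg hm) => w ->.
by rewrite add0r => /sphere_div1_inj.
Qed.

Lemma not_totally_ramified (M : set C) h z : M z ->
  (forall m, has_multiplicity h z m -> m = 1%N) -> ~ totally_ramified M h (h z).
Proof. by move=> Mz H /(_ z Mz erefl)[m m2 /H m1]; rewrite m1 in m2. Qed.

Lemma min_multiplicityE (M : set C) h b m : multiplicities M h b m ->
  (forall m', multiplicities M h b m' -> (m <= m')%N) -> min_multiplicity M h b = m.
Proof.
move=> Hm Hmin; rewrite /min_multiplicity.
have [] := @xgetPex _ 0%N _ (ex_intro (fun m => multiplicities M h b m /\
  forall m', multiplicities M h b m' -> (m <= m')%N) m (conj Hm Hmin)).
set m0 := xget _ _ => H1 H2; apply/eqP.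
by rewrite eqn_leq H2//= Hmin.
Qed.

Lemma esum_seq (T : choiceType) (s : seq T) (f : T -> \bar R) : uniq s ->
  (forall x, (0 <= f x)%E) -> \esum_(x in [set` s]) f x = (\sum_(x <- s) f x)%E.
Proof. by move=> us f0; rewrite esum_fset// -fsbig_seq. Qed.

Lemma totally_ramified_value_numberE (M : set C) h (s1 s2 : seq (sphere R)) :
  uniq s1 -> uniq s2 -> exceptional M h = [set` s1] ->
  totally_ramified M h `\` exceptional M h = [set` s2] ->
  totally_ramified_value_number M h =
  (\sum_(b <- s1) 1 + \sum_(b <- s2) (1 - (min_multiplicity M h b)%:R^-1)%:E)%E.
Proof.
move=> u1 u2 e1 e2; rewrite /totally_ramified_value_number e2 e1 !esum_seq// => b.
rewrite lee_fin subr_ge0; case: (min_multiplicity _ _ _) => [|n].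
  by rewrite invr0.
by rewrite invf_le1 ?ler1n ?ltr0n.
Qed.

End Multiplicity.

Section Ramification.
Variable R : realType.
Local Notation C := (Cplane R).
Local Notation M := (thrice_punctured_plane R).

(** The fibres over 0, 1 and infinity lie in the removed points, every other fibre meets [M], and
    the derivative 2z has no zero there: three omitted values and no other contribution. *)
Lemma ramification_square :
  totally_ramified_value_number M (fun z => Some (z ^+ 2) : sphere R) = (3 : R)%:E.
Proof.
pose h : C -> sphere R := fun z => Some (z ^+ 2).
rewrite -/h.
have exE : exceptional M h = [set` [:: Some 0; Some 1; None] : seq (sphere R)].
  apply/seteqP; split=> [[b|] /=|b].
  - move=> Hb; rewrite !inE.
    have [->|b0] := eqVneq b 0; first by rewrite eqxx.
    have [->|b1] := eqVneq b 1; first by rewrite eqxx orbT.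
    exfalso; apply: (Hb (sqrtC b)); last by rewrite /h sqrtCK.
    have E : sqrtC b ^+ 2 = b := sqrtCK b.
    by split; [apply: contra_neq b0|apply: contra_neq b1|apply: contra_neq b1];
      rewrite -{2}E => ->; rewrite ?expr0n ?sqrrN ?expr1n.
  - by [].
  - rewrite /= !inE => Hb z [z0 z1 zN1]; move: Hb => /or3P[] /eqP -> // [] /eqP.
      by rewrite expf_eq0 /= (negPf z0).
    by rewrite sqrf_eq1 (negPf z1) (negPf zN1).
have trE : totally_ramified M h `\` exceptional M h = set0.
  rewrite -subset0 => b [tb]; apply => z Mz hz.
  have [z0 _ _] := Mz.
  rewrite -hz in tb; apply: (not_totally_ramified Mz _ tb) => m Hm.
  have hg : \forall w \near z, h w = Some (w ^+ 2) by apply: filterE.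
  have [_] := multiplicity_eq1 hg (cderivX 2 (cderiv_id z)) Hm.
  by rewrite /= mulr1 expr1 mulf_neq0// ?pnatr_eq0// => /eqP.
have us : uniq [:: Some 0; Some 1; None : sphere R].
  rewrite /= !inE andbT; apply/negP => /orP[] /eqP // [] /eqP.
  by rewrite eq_sym oner_eq0.
rewrite /totally_ramified_value_number. rewrite trE exE esum_set0 adde0 (esum_seq us)//.
by rewrite !big_cons big_nil adde0 -!EFinD; congr EFin; ring.
Qed.

Variable a : R.
Hypotheses (a0 : a != 0) (a1 : a != 1) (aN1 : a != -1).
Local Notation A := (a%:C : C).
Let Gs (z : C) : sphere R := sphere_div (z * (z + A)) (A * z + 1).

Let A0 : A != 0. Proof. by rewrite fmorph_eq0. Qed.
Let A1 : A - 1 != 0.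
Proof. by rewrite subr_eq0 -[1](rmorph1 (@real_complex R)) (inj_eq (fmorph_inj _)). Qed.
Let AN1 : A + 1 != 0.
Proof.
rewrite addr_eq0 -[1](rmorph1 (@real_complex R)) -rmorphN.
by rewrite (inj_eq (fmorph_inj _)).
Qed.

Lemma GsE z : A * z + 1 != 0 -> Gs z = Some (z * (z + A) / (A * z + 1)).
Proof. by rewrite /Gs /sphere_div => /negPf ->. Qed.

Lemma near_den z : A * z + 1 != 0 -> \forall w \near z, A * w + 1 != 0.
Proof.
exact: (near_nonzero (cderivD (cderivM (cderiv_cst A z) (cderiv_id z)) (cderiv_cst 1 z))).
Qed.

Lemma cderiv_Gs z : A * z + 1 != 0 ->
  cderiv (fun w => w * (w + A) / (A * w + 1)) z
    ((A * z ^+ 2 + 2 * z + A) / (A * z + 1) ^+ 2).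
Proof.
move=> n0; have dz := cderiv_id z.
have d1 := cderivM dz (cderivD dz (cderiv_cst A z)).
have d2 := cderivD (cderivM (cderiv_cst A z) dz) (cderiv_cst 1 z).
have dV := @cderivV _ (fun w => A * w + 1) z _ n0 d2.
apply: cderiv_eq; first exact: (@cderivM _ (fun w => w * (w + A)) _ z _ _ d1 dV).
by rewrite /=; field.
Qed.

Lemma den_num w : A * w + 1 = 0 -> w * (w + A) != 0.
Proof.
move=> E; have w0 : w != 0 by apply: contra_eq_neq E => ->; rewrite mulr0 add0r oner_neq0.
rewrite mulf_neq0//; apply/eqP => /eqP; rewrite addr_eq0 => /eqP wA.
have : (A - 1) * (A + 1) = 0 by rewrite -[RHS]oppr0 -E wA; ring.
by move/eqP; rewrite mulf_eq0 (negPf A1) (negPf AN1).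
Qed.

Lemma Gs_eq_Some w b : Gs w = Some b <-> A * w + 1 != 0 /\ w * (w + A) = b * (A * w + 1).
Proof.
split=> [|[n0 E]]; last by rewrite GsE// E mulfK.
have [E|n0] := eqVneq (A * w + 1) 0; first by rewrite /Gs /sphere_div E eqxx.
by rewrite GsE// => -[<-]; rewrite divfK.
Qed.

(** Solve the quadratic equation of the fibre. Its root could be 0 only for b = 0, and 1 or -1 only
    for b = 1; the value 0 is also taken at [- A]. *)
Lemma Gs_surj b : b != 1 -> exists2 w, M w & Gs w = Some b.
Proof.
move=> b1; have [->|b0] := eqVneq b 0.
  exists (- A); last first.
    apply/Gs_eq_Some; split; last by rewrite addNr mulr0 mul0r.
    have -> : A * - A + 1 = - ((A - 1) * (A + 1)) by ring.
    by rewrite oppr_eq0 mulf_neq0.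
  split; first by rewrite oppr_eq0.
    by rewrite eqr_oppLR -addr_eq0.
  by rewrite eqr_opp -subr_eq0.
(* The quadratic formula for w^2 + A(1-b)w - b = 0. *)
pose p := A * (1 - b); pose s := sqrtC (p ^+ 2 + 4 * b); pose w := (s - p) / 2.
have s2 : s ^+ 2 = p ^+ 2 + 4 * b by exact: sqrtCK.
have E : w * (w + A) = b * (A * w + 1).
  apply/eqP; rewrite -subr_eq0.
  have -> : w * (w + A) - b * (A * w + 1) = (s ^+ 2 - (p ^+ 2 + 4 * b)) / 4.
    by rewrite /w /p; field.
  by rewrite s2 subrr mul0r.
have n0 : A * w + 1 != 0.
  by apply/eqP => n0; have := den_num n0; rewrite E n0 mulr0 eqxx.
exists w; last by apply/Gs_eq_Some.
split.
- by apply: contra_eq_neq E => ->; rewrite mul0r mulr0 add0r mulr1 eq_sym.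
- apply: contra_eq_neq E => ->; rewrite mul1r mulr1 -subr_eq0.
  have -> : 1 + A - b * (A + 1) = (1 - b) * (A + 1) by ring.
  by rewrite mulf_neq0// subr_eq0 eq_sym.
- apply: contra_eq_neq E => ->; rewrite -subr_eq0.
  have -> : - 1 * (- 1 + A) - b * (A * - 1 + 1) = - ((1 - b) * (A - 1)) by ring.
  by rewrite oppr_eq0 mulf_neq0// subr_eq0 eq_sym.
Qed.

Lemma Gs_neq1 w : M w -> Gs w <> Some 1.
Proof.
move=> [_ w1 wN1] /Gs_eq_Some[_]; rewrite mul1r => E.
have : w ^+ 2 == 1.
  rewrite -subr_eq0; have -> : w ^+ 2 - 1 = w * (w + A) - (A * w + 1) by ring.
  by rewrite E subrr.
by rewrite sqrf_eq1 (negPf w1) (negPf wN1).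
Qed.

(** The numerator of the derivative of [Gs]. *)
Definition critical z := A * z ^+ 2 + 2 * z + A == 0.

Lemma critical_den z : critical z -> A * z + 1 != 0.
Proof.
move=> /eqP cz; apply/eqP => E; have := den_num E.
have -> : z * (z + A) = z * (A * z ^+ 2 + 2 * z + A - (A * z + 1) * z) by ring.
by rewrite cz E mul0r subr0 mulr0 eqxx.
Qed.

Lemma critical_M z : critical z -> M z.
Proof.
move=> cz; split; apply/eqP => E; move: cz; rewrite /critical E.
- by rewrite expr0n /= !mulr0 !add0r (negPf A0).
- have -> : A * 1 ^+ 2 + 2 * 1 + A = 2 * (A + 1) by ring.
  by rewrite mulf_eq0 pnatr_eq0 (negPf AN1).
- have -> : A * (-1) ^+ 2 + 2 * -1 + A = 2 * (A - 1) by ring.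
  by rewrite mulf_eq0 pnatr_eq0 (negPf A1).
Qed.

(** The map has degree 2, so a double point exhausts its fibre. This identity yields both the
    multiplicity 2 and the uniqueness of the preimage. *)
Lemma critical_sub z w : critical z -> A * w + 1 != 0 ->
  w * (w + A) / (A * w + 1) = z * (z + A) / (A * z + 1) + (w - z) ^+ 2 * (A * w + 1)^-1.
Proof.
move=> cz nw; have nz := critical_den cz; move/eqP: cz => cz.
apply/eqP; rewrite -subr_eq0; apply/eqP.
have -> : w * (w + A) / (A * w + 1) - (z * (z + A) / (A * z + 1) + (w - z) ^+ 2 * (A * w + 1)^-1)
  = (A * z ^+ 2 + 2 * z + A) * (w - z) / ((A * w + 1) * (A * z + 1)).
  by field; rewrite nw nz.
by rewrite cz !mul0r.
Qed.

Lemma critical_fibre z w : critical z -> Gs w = Gs z -> w = z.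
Proof.
move=> cz; rewrite (GsE (critical_den cz)) => /[dup] /Gs_eq_Some[nw _].
rewrite GsE// => -[]; rewrite (critical_sub cz nw) => /eqP.
rewrite -subr_eq0 addrAC subrr add0r mulf_eq0 invr_eq0 (negPf nw) orbF.
by rewrite expf_eq0 /= subr_eq0 => /eqP.
Qed.

Lemma critical_multiplicity z : critical z -> has_multiplicity Gs z 2.
Proof.
move=> cz; have nz := critical_den cz.
exists (fun w => (A * w + 1)^-1); split; last 1 first.
- apply: (@filterS _ (nbhs z) (nbhs_filter z) _ _ _ (near_den nz)) => w nw.
  by rewrite (GsE nz) (GsE nw) (critical_sub cz nw).
- apply: (@filterS _ (nbhs z) (nbhs_filter z) _ _ _ (near_den nz)) => w nw.
  have dw := cderivD (cderivM (cderiv_cst A w) (cderiv_id w)) (cderiv_cst 1 w).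
  by have [] := @cderivV _ (fun w => A * w + 1) w _ nw dw.
- by rewrite invr_eq0.
Qed.

Lemma near_GsE z : A * z + 1 != 0 ->
  \forall w \near z, Gs w = Some (w * (w + A) / (A * w + 1)).
Proof.
by move=> nz; apply: (@filterS _ (nbhs z) (nbhs_filter z) _ _ _ (near_den nz)) => w /GsE.
Qed.

Lemma critical_min_multiplicity z : critical z -> min_multiplicity M Gs (Gs z) = 2%N.
Proof.
move=> cz; apply: min_multiplicityE.
  by exists z; split=> //; [exact: critical_M|exact: critical_multiplicity].
move=> m [w [_ /(critical_fibre cz) -> Hm]]; have nz := critical_den cz.
have [m0] := multiplicity_eq1 (near_GsE nz) (cderiv_Gs nz) Hm.
by rewrite (eqP cz) mul0r eqxx => /negbT; case: m m0 {Hm} => [|[|]].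
Qed.

Lemma noncritical_multiplicity z m : M z -> ~~ critical z -> has_multiplicity Gs z m -> m = 1%N.
Proof.
move=> Mz cz; have [nz|nz] := eqVneq (A * z + 1) 0; last first.
  move=> /(multiplicity_eq1 (near_GsE nz) (cderiv_Gs nz))[_].
  by rewrite mulf_neq0 ?invr_eq0 ?expf_neq0// => /eqP.
(* At a pole the reciprocal of [Gs] is differentiated; its derivative is A over a nonzero number, so
   the pole is simple. *)
have num0 := den_num nz; have dz := cderiv_id z.
have dn := cderivM dz (cderivD dz (cderiv_cst A z)).
have dd := cderivD (cderivM (cderiv_cst A z) dz) (cderiv_cst 1 z).
have dg := @cderivM _ (fun w => A * w + 1) _ z _ _ dd (@cderivV _ (fun w => w * (w + A)) z _ num0 dn).
have near_g : \forall w \near z, Gs w = sphere_div 1 ((A * w + 1) * (w * (w + A))^-1).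
  have := near_nonzero dn num0; apply: (@filterS _ (nbhs z) (nbhs_filter z)) => w nw.
  rewrite /Gs /sphere_div mulf_eq0 invr_eq0 (negPf nw) orbF; case: ifPn => // n0.
  by rewrite mul1r invf_div.
move=> /(pole_multiplicity_eq1 near_g _ dg)[|_]; first by rewrite nz mul0r.
rewrite /= nz mul0r add0r !(mulr1, mulr0, addr0) mulf_neq0 ?invr_eq0//; last first.
by move/eqP.
Qed.

(** One omitted value, 1, and the values at the two roots of [critical]; these are distinct because
    a critical point is alone in its fibre. The sum is 1 + 1/2 + 1/2. *)
Lemma ramification_Gs : totally_ramified_value_number M Gs = (2 : R)%:E.
Proof.
pose s := sqrtC (1 - A ^+ 2); pose zp := (- 1 + s) / A; pose zm := (- 1 - s) / A.
have s2 : s ^+ 2 = 1 - A ^+ 2 by exact: sqrtCK.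
have s0 : s != 0.
  rewrite -sqrf_eq0 s2 -oppr_eq0.
  have -> : - (1 - A ^+ 2) = (A - 1) * (A + 1) by ring.
  by rewrite mulf_neq0.
have criticalE z : critical z = (z == zp) || (z == zm).
  have E : A * (A * z ^+ 2 + 2 * z + A) = A * (z - zp) * (A * (z - zm)).
    have -> : A * (z - zp) * (A * (z - zm)) = (A * z + 1) ^+ 2 - s ^+ 2.
      by rewrite /zp /zm; field; rewrite A0.
    by rewrite s2; ring.
  rewrite /critical -(mulrI_eq0 _ (mulfI A0)) E !mulf_eq0 (negPf A0) /=.
  by rewrite !subr_eq0.
have cp : critical zp by rewrite criticalE eqxx.
have cm : critical zm by rewrite criticalE eqxx orbT.
have us : uniq [:: Gs zp; Gs zm].
  rewrite /= inE andbT; apply/eqP => /esym/(critical_fibre cp)/eqP.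
  rewrite -subr_eq0; have -> : zm - zp = - 2 * s / A by rewrite /zp /zm; field; rewrite A0.
  by rewrite !mulf_eq0 invr_eq0 oppr_eq0 pnatr_eq0 (negPf s0) (negPf A0).
have exE : exceptional M Gs = [set` [:: Some 1] : seq (sphere R)].
  apply/seteqP; split=> [[b|]|b].
  - move=> Hb; rewrite /= inE; have [->|/Gs_surj[w Mw Ew]] := eqVneq b 1; first exact: eqxx.
    by case: (Hb _ Mw).
  - move=> Hb; exfalso; apply: (Hb (- A^-1)).
      split; first by rewrite oppr_eq0 invr_eq0.
        rewrite eqr_oppLR -(inj_eq invr_inj) invrK invrN invr1 -subr_eq0 opprK //.
      by rewrite eqr_opp -(inj_eq invr_inj) invrK invr1 -subr_eq0.
    by rewrite /Gs /sphere_div mulrN mulfV// addNr eqxx.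
  - by rewrite /= inE => /eqP -> z; exact: Gs_neq1.
have trE : totally_ramified M Gs `\` exceptional M Gs = [set` [:: Gs zp; Gs zm]].
  apply/seteqP; split=> [b [tb eb]|b].
    have [z Mz Ez] : exists2 z, M z & Gs z = b.
      by apply: contrapT => H; apply: eb => z Mz Ez; apply: H; exists z.
    have cz : critical z.
      apply: contrapT => /negP cz; rewrite -Ez in tb.
      exact: (not_totally_ramified Mz (fun m => noncritical_multiplicity Mz cz) tb).
    by move: cz; rewrite criticalE /= !inE -Ez => /orP[] /eqP ->; rewrite eqxx ?orbT.
  rewrite /= !inE => Hb; have [z cz ->] : exists2 z, critical z & b = Gs z.
    by move: Hb => /orP[] /eqP ->; [exists zp|exists zm].
  split; last by apply; first exact: critical_M cz.
  by move=> w Mw /(critical_fibre cz) ->; exists 2%N => //; exact: critical_multiplicity.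
rewrite (totally_ramified_value_numberE (isT : uniq [:: Some 1]) us exE trE).
rewrite !big_cons !big_nil !adde0.
rewrite !critical_min_multiplicity// -!EFinD; congr EFin.
by field.
Qed.

End Ramification.

(** * Regularity of the ends *)

Section RegularEnds.
Variable R : realType.
Local Notation C := (Cplane R).
Local Notation M := (thrice_punctured_plane R).

Lemma near_dnbhs_neq (b c : C) : \forall w \near (0 : C), w != 0 -> b + w != c.
Proof.
have [->|bc] := eqVneq b c.
  apply: (@filterE _ (nbhs (0 : C)) (nbhs_filter _)) => w; apply: contra => /eqP cw.
  by apply/eqP/(addrI c); rewrite addr0.
have := open_nbhs_nbhs (conj (@open_neq R (c - b)) (_ : 0 != c - b)).
rewrite eq_sym subr_eq0 eq_sym => /(_ bc).
apply: (@filterS _ (nbhs (0 : C)) (nbhs_filter _)) => w /= wcb _.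
by apply: contra wcb => /eqP <-; rewrite addrC addKr.
Qed.

Lemma near_dnbhs_chart (p : sphere R) : \forall w \near (0 : C)^', M (sphere_chart p w).
Proof.
rewrite near_withinE; pose F := nbhs_filter (0 : C).
have near3 b : \forall w \near (0 : C), w != 0 -> M (b + w).
  by apply: (@filterS3 _ (nbhs (0 : C)) F _ _ _ _ _ (near_dnbhs_neq b 0)
    (near_dnbhs_neq b 1) (near_dnbhs_neq b (-1))) => w h0 h1 h2 w0; split; auto.
case: p => [b|] /=; first exact: near3.
apply: (@filterS _ (nbhs (0 : C)) F _ _ _ (near3 0)) => w /[apply].
rewrite add0r => -[w0 w1 w2]; split.
- by rewrite invr_eq0.
- by rewrite -(inj_eq invr_inj) invrK invr1.
- by rewrite -(inj_eq invr_inj) invrK invrN invr1.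
Qed.

Lemma regular_end_square (p : sphere R) :
  regular_end M (fun z => Some (z ^+ 2) : sphere R) p.
Proof.
split; first exact: near_dnbhs_chart.
have hol (k d : C -> C) : (forall w, cderiv k w (d w)) -> holomorphic_at k 0.
  by move=> kd; apply: (@filterE _ (nbhs (0 : C)) (nbhs_filter _)) => w; case: (kd w).
have sq (b w : C) : cderiv (fun w => (b + w) ^+ 2) w _ :=
  cderivX 2 (cderivD (cderiv_cst b w) (cderiv_id w)).
case: p => [b|] /=.
  exists (fun w => Some ((b + w) ^+ 2)).
    exists (fun w => (b + w) ^+ 2); first exact: hol (sq b).
    by left; apply: (@filterE _ (nbhs (0 : C)) (nbhs_filter _)).
  by rewrite near_withinE; apply: (@filterE _ (nbhs (0 : C)) (nbhs_filter _)).
exists (fun w => sphere_div 1 ((0 + w) ^+ 2)).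
  exists (fun w => (0 + w) ^+ 2); first exact: hol (sq 0).
  by right; apply: (@filterE _ (nbhs (0 : C)) (nbhs_filter _)).
rewrite near_withinE; apply: (@filterE _ (nbhs (0 : C)) (nbhs_filter _)) => w w0.
rewrite add0r.
by rewrite /sphere_div expf_eq0 /= (negPf w0) exprVn div1r.
Qed.

End RegularEnds.

(** * A real-valued norm on the plane *)

Section TaxicabNorm.
Variable R : realType.
Local Notation C := (Cplane R).
Implicit Types z w : C.

(** Matches the coordinatewise bounds given by [square_lipschitz]. *)
Definition norm1 (z : C) : R := `|re z| + `|im z|.

Lemma norm1_ge0 z : 0 <= norm1 z. Proof. exact: addr_ge0. Qed.

Lemma norm1_eq0 z : norm1 z = 0 -> z = 0.
Proof.
move/eqP; rewrite paddr_eq0// !normr_eq0 => /andP[/eqP x0 /eqP y0].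
exact: eqC.
Qed.

Lemma norm1D z w : norm1 (z + w) <= norm1 z + norm1 w.
Proof. by rewrite /norm1 !reimE addrACA lerD// ler_normD. Qed.

Lemma norm1N z : norm1 (- z) = norm1 z.
Proof. by rewrite /norm1 !reimE !normrN. Qed.

Lemma norm1M z w : norm1 (z * w) <= norm1 z * norm1 w.
Proof.
rewrite /norm1 !reimE (le_trans (lerD (ler_normB _ _) (ler_normD _ _)))//.
by rewrite !normrM mulrDl !mulrDr; lra.
Qed.

Lemma norm1Mreal (r : R) z : norm1 (r%:C * z) = `|r| * norm1 z.
Proof. by rewrite /norm1 !reimE /= !mul0r subr0 addr0 !normrM mulrDr. Qed.

Lemma norm1Mdir i z : norm1 (dir R i * z) = norm1 z.
Proof.
rewrite /norm1 /dir; case: (i == 0); first by rewrite mul1r.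
by rewrite !reimE /= !mul0r !mul1r sub0r add0r normrN addrC.
Qed.

Lemma re_norm1 z : `|re z| <= norm1 z. Proof. by rewrite lerDl. Qed.
Lemma im_norm1 z : `|im z| <= norm1 z. Proof. by rewrite lerDr. Qed.

Lemma norm1_sqr z : norm1 z ^+ 2 <= 2 * cnorm2 z.
Proof.
rewrite /norm1 /cnorm2 -[re z ^+ 2]real_normK ?num_real// -[im z ^+ 2]real_normK ?num_real//.
by have := sqr_ge0 (`|re z| - `|im z|); lra.
Qed.

Lemma continuous_norm1 (T : topologicalType) (h : T -> C) (t : T) :
  {for t, continuous h} -> {for t, continuous (fun s => norm1 (h s))}.
Proof.
move=> ht; have hr := cvg_re (nbhs_filter t) ht; have hi := cvg_im (nbhs_filter t) ht.
apply: (@continuousD _ _ _ (fun s => `|re (h s)|) (fun s => `|im (h s)|)).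
  exact: (@continuous_comp _ _ _ (fun s => re (h s)) Num.norm _ hr (@norm_continuous _ _ _)).
exact: (@continuous_comp _ _ _ (fun s => im (h s)) Num.norm _ hi (@norm_continuous _ _ _)).
Qed.

Lemma near_norm1_le (h : C -> C) (b : C) (e : R) : {for b, continuous h} ->
  norm1 (h b) < e -> \forall z \near b, norm1 (h z) <= e.
Proof.
move=> hb he.
exact: (@cvgr_le _ _ (nbhs b) (nbhs_filter b) _ _ (continuous_norm1 hb) _ he).
Qed.

Lemma near_norm1_sub (h : C -> C) (b : C) (e : R) : {for b, continuous h} -> 0 < e ->
  \forall z \near b, norm1 (h z - h b) <= e.
Proof.
move=> hb he; apply: (@near_norm1_le (fun z => h z - h b)).
  have hc : {for b, continuous (fun=> h b : C)} by exact: cst_continuous.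
  exact: (continuousB hb hc).
by rewrite subrr /norm1 /= normr0 addr0.
Qed.

End TaxicabNorm.

(** * A weight with power behaviour at a puncture *)

Section WeightAtEnd.
Variable R : realType.
Local Notation C := (Cplane R).
Variables (b : C) (s : R) (j : C -> R) (dj : 'I_2 -> C -> R) (B : R).
Hypotheses (jc : {for b, continuous j}) (j0 : 0 < j b)
  (pdj : \forall z \near b, forall i, has_pd i j z (dj i z) /\ `|dj i z| <= B).

(** Model near an end of the quotient of the squared moduli of the bottom entries of the frame:
    |z-b|^{2s} times a positive regular factor. The associated [weight] is the share of the second
    Gauss map in a mean of the two. *)
Definition ratio (z : C) : R := expR (s * ln (cnorm2 (z - b))) * j z.
Definition weight (z : C) : R := ratio z / (1 + ratio z).
(** The limit of [weight] at [b]: the ratio tends to 0, to infinity or to [j b] according to the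
    sign of [s]. *)
Definition end_weight : R :=
  if 0 < s then 0 else if s < 0 then 1 else j b / (1 + j b).

Lemma near_ratio_gt0 : \forall z \near b, 0 < ratio z.
Proof.
have := @cvgr_gt _ _ (nbhs b) (nbhs_filter b) _ _ jc _ j0.
by apply: (@filterS _ (nbhs b) (nbhs_filter b)) => z jz; rewrite mulr_gt0// expR_gt0.
Qed.

Lemma weight_itv z : 0 < ratio z -> 0 <= weight z <= 1.
Proof.
move=> r0; rewrite /weight divr_ge0 ?(ltW r0) ?addr_ge0 ?(ltW r0)//=.
by rewrite ler_pdivrMr ?addr_gt0// mul1r lerDr.
Qed.

(** The second bound, needed for the derivatives, holds since r/(1+r)^2 is at most both r and 1/r
    when [s] is nonzero, and thanks to the factor [s] when it is 0. *)
Lemma weight_limit (e : R) : 0 < e -> \forall z \near b, z != b ->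
  `|weight z - end_weight| <= e /\ `|s| * (ratio z / (1 + ratio z) ^+ 2) <= e.
Proof.
move=> e0.
have n1 : \forall z \near b, j b / 2 <= j z.
  have := @cvgr_ge _ _ (nbhs b) (nbhs_filter b) _ _ jc (j b / 2).
  by apply; rewrite ltr_pdivrMr// ltr_pMr// ltr1n.
have n2 : \forall z \near b, j z <= 2 * j b.
  have := @cvgr_le _ _ (nbhs b) (nbhs_filter b) _ _ jc (2 * j b).
  by apply; rewrite ltr_pMl// ltr1n.
pose e' := Num.min e (e / (`|s| + 1)).
have s1 : 0 < `|s| + 1 by rewrite ltr_wpDl.
have e'0 : 0 < e' by rewrite lt_min e0 divr_gt0.
have e'e : e' <= e by rewrite ge_min lexx.
have e's : `|s| * e' <= e.
  rewrite (le_trans (_ : _ <= (`|s| + 1) * (e / (`|s| + 1)))) //.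
    by rewrite ler_pM ?(ltW e'0)// ?lerDl// ge_min lexx orbT.
  by rewrite mulrC divfK// gt_eqF.
have kap (r : R) : 0 < r -> r / (1 + r) ^+ 2 <= r /\ r / (1 + r) ^+ 2 <= r^-1.
  move=> r0; have r1 : 0 < 1 + r by rewrite addr_gt0.
  rewrite !ler_pdivrMr ?exprn_gt0//; split.
    by rewrite ler_peMr ?(ltW r0)// expr2; have := mulr_gt0 r0 r0; lra.
  rewrite mulrC -ler_pdivrMr ?invr_gt0// invrK.
  by have := mulr_gt0 r0 r0; rewrite !expr2; lra.
rewrite /end_weight; have [sn|sp|s0] := ltgtP s 0.
- pose h := e' * (j b / 2).
  have h0 : 0 < h by rewrite mulr_gt0// divr_gt0.
  have n3 := near_small_power b (ltac:(by rewrite oppr_gt0) : 0 < - s) h0.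
  apply: (@filterS3 _ (nbhs b) (nbhs_filter b) _ _ _ _ _ n1 near_ratio_gt0 n3) => z jz r0 Pz zb.
  have {}Pz := Pz zb; rewrite mulNr expRN in Pz.
  have P0 := expR_gt0 (s * ln (cnorm2 (z - b))).
  have rV : (ratio z)^-1 <= e'.
    rewrite /ratio invfM -ler_pdivlMr ?invr_gt0 ?(lt_le_trans _ jz) ?divr_gt0// invrK.
    by rewrite (le_trans Pz)// /h ler_pM2l.
  have r1 : 0 < 1 + ratio z by rewrite addr_gt0.
  split; last by rewrite (le_trans _ e's)// ler_wpM2l// (le_trans (kap _ r0).2).
  have -> : weight z - 1 = - (1 + ratio z)^-1 by rewrite /weight; field; rewrite gt_eqF.
  rewrite normrN gtr0_norm ?invr_gt0// (le_trans _ e'e)// (le_trans _ rV)//.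
  by rewrite lef_pV2 ?posrE// lerDr.
- pose h := e' / (2 * j b).
  have h0 : 0 < h by rewrite divr_gt0// mulr_gt0.
  have n3 := near_small_power b sp h0.
  apply: (@filterS3 _ (nbhs b) (nbhs_filter b) _ _ _ _ _ n2 near_ratio_gt0 n3) => z jz r0 Pz zb.
  have {}Pz := Pz zb.
  have rV : ratio z <= e'.
    rewrite /ratio (le_trans (_ : _ <= h * (2 * j b)))//; last first.
      by rewrite /h divfK// mulf_neq0// gt_eqF.
    rewrite ler_pM ?expR_ge0//.
    by move: r0; rewrite /ratio pmulr_rgt0 ?expR_gt0// => /ltW.
  have r1 : 0 < 1 + ratio z by rewrite addr_gt0.
  split; last by rewrite (le_trans _ e's)// ler_wpM2l// (le_trans (kap _ r0).1).
  rewrite subr0 ger0_norm; last by case/andP: (weight_itv r0).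
  rewrite (le_trans _ e'e)// (le_trans _ rV)// /weight ler_pdivrMr// ler_peMr ?(ltW r0)//.
  by rewrite lerDl ltW.
- have E z : ratio z = j z by rewrite /ratio s0 mul0r expR0 mul1r.
  have wc : {for b, continuous (fun z => j z * (1 + j z)^-1)}.
    apply: (continuousM jc); apply: continuousV; first by rewrite gt_eqF// addr_gt0.
    have c1 : {for b, continuous (fun=> 1 : R)} by exact: cst_continuous.
    exact: (continuousD c1 jc).
  have := (@cvgrPdist_le _ _ _ (nbhs b) (nbhs_filter b) _ _).1 wc e e0.
  apply: (@filterS _ (nbhs b) (nbhs_filter b)) => z hz _; split.
    by rewrite distrC /weight E.
  by rewrite s0 normr0 mul0r ltW.
Qed.

(** The weight has logarithmic behaviour at [b], but |z-b| times its derivative tends to 0: that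
    derivative is r/(1+r)^2 times (s d ln|z-b|^2 + dj/j), where the first term is controlled by
    [weight_limit] and the second is bounded. *)
Lemma weight_pd (e : R) : 0 < e -> \forall z \near b, z != b -> forall i,
  exists2 l, has_pd i weight z l & norm1 (z - b) * `|l| <= e.
Proof.
move=> e0.
have B0 : 0 <= B by have [_ h] := nbhs_singleton pdj 0; exact: le_trans (normr_ge0 _) h.
have n1 : \forall z \near b, j b / 2 <= j z.
  have := @cvgr_ge _ _ (nbhs b) (nbhs_filter b) _ _ jc (j b / 2).
  by apply; rewrite ltr_pdivrMr// ltr_pMr// ltr1n.
pose h := e / 2 / (B + 1) * (j b / 2).
have h0 : 0 < h by rewrite !mulr_gt0 ?invr_gt0// ?ltr_wpDl.
have n2 : \forall z \near b, norm1 (z - b) <= h.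
  exact: (near_norm1_sub (h := id) (@cvg_id _ _) h0).
(* The logarithmic term costs a factor 4 (see [NL]), which turns e/8 into e/2. *)
have n3 := weight_limit (divr_gt0 e0 (ltr0n _ 8)).
have N := nbhs_andC (nbhs_andC n1 n2) (nbhs_andC n3 (nbhs_andC pdj near_ratio_gt0)).
apply: (@filterS _ (nbhs b) (nbhs_filter b) _ _ _ N) => z [[jz nz] [wz [dz r0]]] zb i.
have [_ {}wz] := wz zb; move: (dz i) => {dz}; set dz0 := dj i z => -[dz djB].
have c0 : 0 < cnorm2 (z - b) by rewrite cnorm2_gt0 subr_eq0.
have jp : 0 < j z by rewrite (lt_le_trans _ jz)// divr_gt0.
have r1 : 0 < 1 + ratio z by rewrite addr_gt0.
set L := 2 * (re (z - b) * re (dir R i * 1) + im (z - b) * im (dir R i * 1)).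
have pl : has_pd i (fun w => ln (cnorm2 (w - b))) z ((cnorm2 (z - b))^-1 * L).
  apply: has_pd_eq.
    by apply: has_pd_ln => //; apply: has_pd_cnorm2; exact: is_derive_addr.
  by rewrite subr0.
have pr : has_pd i ratio z (ratio z * (s * ((cnorm2 (z - b))^-1 * L) + dz0 / j z)).
  apply: has_pd_eq; first exact: (has_pdM (has_pd_expR (has_pdMl s pl)) dz).
  by rewrite /ratio; field; rewrite !gt_eqF.
set l0 := s * _ + _ in pr.
exists (ratio z / (1 + ratio z) ^+ 2 * l0).
  have rn : 1 + ratio z != 0 by rewrite gt_eqF.
  have pv := @has_pdV R i (fun w => 1 + ratio w) z _ rn (has_pdD (has_pd_cst i z (1 : R)) pr).
  apply: has_pd_eq; first exact: (has_pdM pr pv).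
  by rewrite /=; field.
set ka := ratio z / _ in wz *.
have ka0 : 0 <= ka by rewrite divr_ge0 ?exprn_ge0 ?ltW.
have ka1 : ka <= 1.
  rewrite ler_pdivrMr ?exprn_gt0// mul1r expr2.
  by have := mulr_gt0 r0 r0; lra.
have Lb : `|L| <= 2 * norm1 (z - b).
  rewrite /L normrM ger0_norm// ler_pM2l// (le_trans (ler_normD _ _))//.
  rewrite !normrM mulr1 /norm1 lerD// ler_piMr// /dir; case: (i == 0) => /=;
    by rewrite ?normr0 ?normr1.
have NL : norm1 (z - b) * `|(cnorm2 (z - b))^-1 * L| <= 4.
  rewrite normrM (gtr0_norm (_ : 0 < (cnorm2 (z - b))^-1)) ?invr_gt0// mulrCA.
  rewrite ler_pdivrMl// (le_trans (ler_wpM2l (norm1_ge0 _) Lb))//.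
  by have := norm1_sqr (z - b); rewrite expr2; lra.
have Nj : norm1 (z - b) * `|dz0 / j z| <= e / 2.
  rewrite normrM (gtr0_norm (_ : 0 < (j z)^-1)) ?invr_gt0//.
  have jV : (j z)^-1 <= (j b / 2)^-1 by rewrite lef_pV2 ?posrE// divr_gt0.
  have dzB : `|dz0| / j z <= B * (j b / 2)^-1 by rewrite ler_pM// invr_ge0 ltW.
  rewrite (le_trans (ler_pM (norm1_ge0 _) _ nz dzB)) ?divr_ge0 ?(ltW jp)//.
  have -> : h * (B * (j b / 2)^-1) = e / 2 * (B / (B + 1)).
    by rewrite /h; field; rewrite !gt_eqF// ltr_wpDl.
  rewrite ler_piMr ?divr_ge0 ?(ltW e0)// ler_pdivrMr ?ltr_wpDl// mul1r.
  by rewrite lerDl.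
rewrite normrM (ger0_norm ka0) mulrCA.
have step : norm1 (z - b) * `|l0| <= `|s| * 4 + e / 2.
  rewrite (le_trans (ler_wpM2l (norm1_ge0 _) (ler_normD _ _)))// mulrDr lerD//.
  by rewrite normrM mulrCA ler_wpM2l.
rewrite (le_trans (ler_wpM2l ka0 step))// mulrDr.
have h1 : ka * (`|s| * 4) <= e / 2 by rewrite mulrA [ka * _]mulrC; lra.
have h2 : ka * (e / 2) <= e / 2 by rewrite ler_piMl// divr_ge0 ?ltW.
lra.
Qed.

End WeightAtEnd.

(** * First-order expansion of a weighted mean at a puncture *)

Section EndExpansion.
Variable R : realType.
Local Notation C := (Cplane R).
Variables (b : C) (s : R) (j : C -> R) (dj : 'I_2 -> C -> R) (B : R).
Hypotheses (jc : {for b, continuous j}) (j0 : 0 < j b)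
  (pdj : \forall z \near b, forall i, has_pd i j z (dj i z) /\ `|dj i z| <= B).
Variables (g dg D dD E : C -> C).
Hypotheses (gd : \forall z \near b, cderiv g z (dg z))
  (Dd : \forall z \near b, cderiv D z (dD z))
  (DE : \forall z \near b, D z = (z - b) * E z)
  (dgc : {for b, continuous dg}) (dDc : {for b, continuous dD})
  (Ec : {for b, continuous E}) (dDb : dD b = E b).

Local Notation tau := (weight b s j).
Local Notation tau0 := (end_weight b s j).

(** The mean of [g] and [g - D] with weight [tau]. As [D] vanishes at [b], the weight enters the
    first-order term [slope] only through its limit. *)
Definition blend (z : C) : C := g z - D z * (tau z)%:C.
Definition slope : C := dg b - E b * tau0%:C.

Let Db : D b = 0. Proof. by rewrite (nbhs_singleton DE) subrr mul0r. Qed.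

Let cz (c : C) : {for b, continuous (fun=> c)}. Proof. exact: cst_continuous. Qed.

Let blendE z : blend z - slope * z = g z - slope * z - D z * (tau z)%:C.
Proof. by rewrite /blend addrAC. Qed.

Let lind z : cderiv (fun w => slope * w) z slope.
Proof.
by apply: cderiv_eq; [exact: (cderivM (cderiv_cst slope z) (cderiv_id z))|rewrite mulr0 addr0 mulr1].
Qed.

(** The derivative of the difference splits into the error [X] made with the limit weight, the
    change of weight times D', and D times the derivative of the weight; the last is small because
    [D] is O(|z-b|). Each gets a third of [e]. *)
Lemma blend_pd (e : R) : 0 < e -> \forall z \near b, z != b -> forall i,
  (exists2 l, has_pd i (fun w => re (blend w - slope * w)) z l & `|l| <= e) /\
  (exists2 l, has_pd i (fun w => im (blend w - slope * w)) z l & `|l| <= e).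
Proof.
move=> e0.
pose X z := dg z - slope - dD z * tau0%:C.
have Xc : {for b, continuous X}.
  have c1 : {for b, continuous (fun z => dg z - slope)} := continuousB dgc (@cz slope).
  have c2 : {for b, continuous (fun z => dD z * tau0%:C)} := continuousM dDc (@cz (tau0%:C : C)).
  exact: (continuousB c1 c2).
have Xb : X b = 0 by rewrite /X /slope dDb; ring.
pose c1 := norm1 (dD b) + 1; pose c2 := norm1 (E b) + 1.
have c10 : 0 < c1 by rewrite ltr_wpDl ?norm1_ge0.
have c20 : 0 < c2 by rewrite ltr_wpDl ?norm1_ge0.
have e3 : 0 < e / 3 by rewrite divr_gt0.
have n1 : \forall z \near b, norm1 (X z) <= e / 3.
  by apply: near_norm1_le Xc _; rewrite Xb /norm1 /= normr0 addr0.
have n2 : \forall z \near b, norm1 (dD z) <= c1.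
  by apply: near_norm1_le dDc _; rewrite ltrDl.
have n3 : \forall z \near b, norm1 (E z) <= c2.
  by apply: near_norm1_le Ec _; rewrite ltrDl.
have n4 := weight_limit s jc j0 (divr_gt0 e3 c10).
have n5 := weight_pd s jc j0 pdj (divr_gt0 e3 c20).
have N := nbhs_andC (nbhs_andC (nbhs_andC n1 n2) (nbhs_andC n3 DE))
  (nbhs_andC (nbhs_andC n4 n5) (nbhs_andC gd Dd)).
apply: (@filterS _ (nbhs b) (nbhs_filter b) _ _ _ N) => z.
move=> [[[Xz dDz] [Ez DEz]] [[wz pz] [gz Dz]]] zb i.
have [{}wz _] := wz zb; have [l hl lz] := pz zb i.
have [gr gi] := is_derive_has_pd i (cderivB gz (lind z)).
have [Dr Di] := is_derive_has_pd i Dz.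
have Yz : norm1 (dir R i * (dg z - slope - dD z * (tau z)%:C)) <= e / 3 + e / 3.
  rewrite norm1Mdir.
  have -> : dg z - slope - dD z * (tau z)%:C = X z + (tau0 - tau z)%:C * dD z.
    by rewrite /X rmorphB /=; ring.
  rewrite (le_trans (norm1D _ _))// lerD// norm1Mreal distrC.
  have -> : e / 3 = e / 3 / c1 * c1 by rewrite divfK// gt_eqF.
  by rewrite ler_pM// norm1_ge0.
have Dl : norm1 (D z) * `|l| <= e / 3.
  rewrite DEz (le_trans (ler_wpM2r (normr_ge0 l) (norm1M _ _)))// mulrAC.
  have -> : e / 3 = e / 3 / c2 * c2 by rewrite divfK// gt_eqF.
  by rewrite ler_pM ?mulr_ge0 ?norm1_ge0.
have fin (u v : R) : `|u| <= e / 3 + e / 3 -> `|v| <= e / 3 -> `|u - v| <= e.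
  by move=> hu hv; rewrite (le_trans (ler_normB _ _))//; lra.
split.
- exists (re (dir R i * (dg z - slope - dD z * (tau z)%:C)) - re (D z) * l).
    apply: (@has_pd_near _ _ _ (fun w => re (g w - slope * w) - re (D w) * tau w)).
      apply: (@filterE _ (nbhs z) (nbhs_filter z)) => w.
      by rewrite blendE !reimE /=; ring.
    apply: has_pd_eq; first exact: (has_pdB gr (has_pdM Dr hl)).
    by rewrite !reimE /=; ring.
  apply: fin; first exact: le_trans (re_norm1 _) Yz.
  by rewrite normrM (le_trans _ Dl)// ler_wpM2r// re_norm1.
- exists (im (dir R i * (dg z - slope - dD z * (tau z)%:C)) - im (D z) * l).
    apply: (@has_pd_near _ _ _ (fun w => im (g w - slope * w) - im (D w) * tau w)).
      apply: (@filterE _ (nbhs z) (nbhs_filter z)) => w.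
      by rewrite blendE !reimE /=; ring.
    apply: has_pd_eq; first exact: (has_pdB gi (has_pdM Di hl)).
    by rewrite !reimE /=; ring.
  apply: fin; first exact: le_trans (im_norm1 _) Yz.
  by rewrite normrM (le_trans _ Dl)// ler_wpM2r// im_norm1.
Qed.

Lemma blend_continuous : {for b, continuous (fun w => blend w - slope * w)}.
Proof.
have Dc : {for b, continuous D} := is_derive_continuous (nbhs_singleton Dd).
have gc : {for b, continuous (fun w => g w - slope * w)}.
  exact: is_derive_continuous (cderivB (nbhs_singleton gd) (lind b)).
have Tc : {for b, continuous (fun w => D w * (tau w)%:C)}.
  have small (e : R) : 0 < e -> \forall z \near b, `|re (D z * (tau z)%:C)| <= e /\
      `|im (D z * (tau z)%:C)| <= e.
    move=> e0; have n1 : \forall z \near b, norm1 (D z) <= e.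
      by apply: near_norm1_le Dc _; rewrite Db /norm1 /= normr0 addr0.
    have n2 := near_ratio_gt0 s jc j0.
    apply: (@filterS2 _ (nbhs b) (nbhs_filter b) _ _ _ _ n1 n2) => z Dz /weight_itv/andP[t0 t1].
    have le : norm1 (D z * (tau z)%:C) <= e.
      by rewrite mulrC norm1Mreal ger0_norm// (le_trans _ Dz)// ler_piMl// norm1_ge0.
    by split; apply: le_trans le; [exact: re_norm1|exact: im_norm1].
  apply: continuous_reim.
    apply/(@cvgrPdist_le _ _ _ (nbhs b) (nbhs_filter b)) => e /small.
    apply: (@filterS _ (nbhs b) (nbhs_filter b)) => z [h _].
    by rewrite Db mul0r sub0r normrN.
  apply/(@cvgrPdist_le _ _ _ (nbhs b) (nbhs_filter b)) => e /small.
  apply: (@filterS _ (nbhs b) (nbhs_filter b)) => z [_ h].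
  by rewrite Db mul0r sub0r normrN.
rewrite (_ : (fun w => _) = fun w => g w - slope * w - D w * (tau w)%:C).
  exact: (continuousB gc Tc).
by apply: funext => w; rewrite blendE.
Qed.

(** Perturbing an invertible linear map by a map of small Lipschitz constant keeps it expanding by a
    definite factor. *)
Lemma blend_lower : slope != 0 -> exists r de : R, [/\ 0 < r, 0 < de &
  forall z1 z2 : C, `|re z1 - re b| < r -> `|im z1 - im b| < r ->
    `|re z2 - re b| < r -> `|im z2 - im b| < r ->
    de * norm1 (z2 - z1) <= norm1 (blend z2 - blend z1)].
Proof.
move=> sl0; pose c := norm1 slope^-1.
have c0 : 0 < c.
  rewrite lt0r norm1_ge0 andbT; apply: contra sl0 => /eqP/norm1_eq0 h.
  by rewrite -[slope]invrK h invr0.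
(* The real and imaginary errors add up to 1/(2c), half of the expansion 1/c of the linear map. *)
have e0 : 0 < (4 * c)^-1 by rewrite invr_gt0 mulr_gt0.
have [r r0 rP] := (nbhs_square b _).1 (blend_pd e0).
exists r, (2 * c)^-1; split=> //; first by rewrite invr_gt0 mulr_gt0.
have bc := blend_continuous.
have rc : {for b, continuous (fun w => re (blend w - slope * w))}.
  exact: (cvg_re (nbhs_filter b) bc).
have ic : {for b, continuous (fun w => im (blend w - slope * w))}.
  exact: (cvg_im (nbhs_filter b) bc).
move=> z1 z2 x1 y1 x2 y2.
have L1 := square_lipschitz (fun z zx zy zb i => (rP z zx zy zb i).1) rc x1 y1 x2 y2.
have L2 := square_lipschitz (fun z zx zy zb i => (rP z zx zy zb i).2) ic x1 y1 x2 y2.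
pose d := z2 - z1; pose P := (blend z2 - slope * z2) - (blend z1 - slope * z1).
have NP : norm1 P <= (2 * c)^-1 * norm1 d.
  have -> : (2 * c)^-1 * norm1 d = (4 * c)^-1 * norm1 d + (4 * c)^-1 * norm1 d.
    by field; rewrite gt_eqF.
  rewrite {1}/norm1 /P /d lerD//.
    by move: L1; rewrite /norm1 !reimE.
  by move: L2; rewrite /norm1 !reimE.
have Nd : norm1 d <= c * norm1 (slope * d).
  have {1}-> : d = slope^-1 * (slope * d) by rewrite mulKf.
  exact: norm1M.
have Nl : norm1 (slope * d) <= norm1 (blend z2 - blend z1) + norm1 P.
  have -> : slope * d = (blend z2 - blend z1) + - P by rewrite /P /d; ring.
  by rewrite (le_trans (norm1D _ _))// norm1N.
have h : c^-1 * norm1 d <= norm1 (slope * d) by rewrite ler_pdivrMl.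
have h2 : c^-1 * norm1 d = (2 * c)^-1 * norm1 d + (2 * c)^-1 * norm1 d.
  by field; rewrite gt_eqF.
rewrite -/d; lra.
Qed.

End EndExpansion.

(** * Embeddedness through a coordinate on hyperbolic space *)

Section StereographicChart.
Variable R : realType.
Local Notation C := (Cplane R).

(* For x = b b^* in H3 this is the ratio of the first-row off-diagonal entry
   to the second diagonal entry of herm x. *)
Definition chart (x : 'rV[R]_4) : C :=
  (x 0 1 / (x 0 0 - x 0 3)) +i* (x 0 2 / (x 0 0 - x 0 3)).

Lemma chart_continuous (x : 'rV[R]_4) : x 0 0 - x 0 3 != 0 -> {for x, continuous chart}.
Proof.
move=> x0.
have co (i : 'I_4) : {for x, continuous (fun y : 'rV[R]_4 => y 0 i)} by exact: coord_continuous.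
have cd : {for x, continuous (fun y : 'rV[R]_4 => (y 0 0 - y 0 3)^-1)}.
  by apply: continuousV => //; exact: (continuousB (co 0) (co 3)).
apply: continuous_reim; first exact: (continuousM (co 1) cd).
exact: (continuousM (co 2) cd).
Qed.

(** The chart is continuous, and by the lower bound its value at [f z] determines [z] in a Lipschitz
    way: [f] is injective with continuous inverse on its image. *)
Lemma embedding_of_chart (V : set C) (f : C -> 'rV[R]_4) (W : C -> C) (de : R) :
  0 < de -> (forall z, V z -> immersion_at f z) ->
  (forall z, V z -> f z 0 0 - f z 0 3 != 0 /\ chart (f z) = W z) ->
  (forall z1 z2, V z1 -> V z2 -> de * norm1 (z2 - z1) <= norm1 (W z2 - W z1)) ->
  embedding_on V f.
Proof.
move=> de0 Vi Vc Vl; split=> //.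
  move=> z1 z2; rewrite !inE => V1 V2 fE; apply/esym/eqP; rewrite -subr_eq0; apply/eqP.
  apply: norm1_eq0; apply: le_anti; rewrite norm1_ge0 andbT -(ler_pM2l de0) mulr0.
  have := Vl _ _ V1 V2; rewrite -(Vc _ V1).2 -(Vc _ V2).2 fE subrr.
  by rewrite {2}/norm1 /= normr0 addr0.
move=> z A Vz /(nbhs_square z)[r r0 rA]; have [x0 cz] := Vc z Vz.
have cc : {for f z, continuous (fun x => chart x - chart (f z))}.
  have cst : {for f z, continuous (fun=> chart (f z) : C)} by exact: cst_continuous.
  exact: (continuousB (chart_continuous x0) cst).
have lt0 : norm1 (chart (f z) - chart (f z)) < de * r.
  by rewrite subrr /norm1 /= normr0 addr0 mulr_gt0.
have := @cvgr_lt _ _ (nbhs (f z)) (nbhs_filter _) _ _ (continuous_norm1 cc) _ lt0.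
apply: (@filterS _ (nbhs (f z)) (nbhs_filter _)) => x xs w Vw fw.
have : de * norm1 (w - z) < de * r.
  by rewrite (le_lt_trans (Vl _ _ Vz Vw))// -cz -(Vc _ Vw).2 fw.
rewrite ltr_pM2l// => nw; apply: rA.
  by apply: le_lt_trans nw; have := re_norm1 (w - z); rewrite !reimE.
by apply: le_lt_trans nw; have := im_norm1 (w - z); rewrite !reimE.
Qed.

Lemma embedding_onS (V W : set C) (f : C -> 'rV[R]_4) : V `<=` W ->
  embedding_on W f -> embedding_on V f.
Proof.
move=> VW [Wi Winj Wc]; split; first by move=> z /VW; exact: Wi.
  move=> z1 z2; rewrite !inE => /VW V1 /VW V2; apply: Winj; exact: mem_set.
move=> z A /VW Wz /(Wc _ _ Wz); apply: (@filterS _ (nbhs (f z)) (nbhs_filter _)).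
by move=> x H w /VW; exact: H.
Qed.

Definition punctured_square (b : C) (r : R) : set C :=
  [set z | [/\ z != b, `|re z - re b| < r & `|im z - im b| < r]].

Lemma embedded_end_finite (M : set C) (f : C -> 'rV[R]_4) (b : C) (r : R) : 0 < r ->
  punctured_square b r `<=` M -> embedding_on (punctured_square b r) f ->
  embedded_end M f (Some b).
Proof.
move=> r0 VM Vf.
pose U : set (sphere R) :=
  Some @` [set z : C | `|re z - re b| < r /\ `|im z - im b| < r].
have UE z : (U `\ (Some b : sphere R)) (Some z) -> punctured_square b r z.
  move=> [[w [wx wy] [wz]] zb]; rewrite -wz; split=> //.
  by apply/eqP => wb; apply: zb; rewrite -wz wb.
exists U; split.
- apply: one_point_compactification_some_nbhs.
  by apply/nbhs_square; exists r.
- move=> _ [[w [wx wy] <-] zb]; exists w => //; apply: VM; split=> //.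
  by apply/eqP => wb; apply: zb; rewrite /= wb.
- exact: embedding_onS UE Vf.
Qed.

End StereographicChart.

(** * The chart of the front near the punctures 0 and 1 *)

Section Ends.
Variable R : realType.
Local Notation C := (Cplane R).
Local Notation M := (thrice_punctured_plane R).

Lemma Ck1_bound (A : set C) (b : C) (j : C -> R) : open A -> Ck 1 A j -> A b ->
  exists B, \forall z \near b, forall i, has_pd i j z (pd i j z) /\ `|pd i j z| <= B.
Proof.
move=> oA Cj Ab.
have ci i : {for b, continuous (fun z => `|pd i j z|)}.
  have c0 : {for b, continuous (pd i j)} := Ck_continuous (CkS_pd i Cj) Ab.
  exact: (@continuous_comp _ _ _ (pd i j) Num.norm _ c0 (@norm_continuous _ _ _)).
pose B := `|pd 0 j b| + `|pd 1 j b| + 1.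
exists B.
have n0 : \forall z \near b, `|pd 0 j z| <= B.
  have := @cvgr_le _ _ (nbhs b) (nbhs_filter b) _ _ (ci 0) B; apply.
  by rewrite /B -addrA ltrDl ltr_wpDl.
have n1 : \forall z \near b, `|pd 1 j z| <= B.
  have := @cvgr_le _ _ (nbhs b) (nbhs_filter b) _ _ (ci 1) B; apply.
  by rewrite /B [`|pd 0 j b| + _]addrC -addrA ltrDl ltr_wpDl.
have n2 := open_nbhs_nbhs (conj oA Ab).
apply: (@filterS3 _ (nbhs b) (nbhs_filter b) _ _ _ _ _ n0 n1 n2) => z h0 h1 Az.
by apply: ord2P; split=> //; exact: CkS_has_pd Cj Az.
Qed.

Variable k : R.
Local Notation K := (k%:C : C).
Local Notation f := (surf k 1 1).

(** The quotient |e22|^2/|e21|^2 for the frame; [gauss_diff] below is the difference of the two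
    Gauss maps. *)
Definition frame_ratio (z : C) : R :=
  qfun k z ^+ 2 * cnorm2 (z ^+ 2 - 1) * cnorm2 (z + K) / cnorm2 z.
Definition gauss_diff (z : C) : C := z * (z ^+ 2 - 1) / (z + K).

(** From E E^* the chart is (e11 conj(e21) + e12 conj(e22)) / (|e21|^2 + |e22|^2), the mean of
    e11/e21 and e12/e22 with weights |e21|^2 and |e22|^2. *)
Lemma surf_chart z : M z -> z + K != 0 -> f z 0 0 - f z 0 3 != 0 /\
  chart (f z) = z ^+ 2 - gauss_diff z * (frame_ratio z / (1 + frame_ratio z))%:C.
Proof.
move=> /thriceP[z0 z1] zk; rewrite /f.
have n0 : 0 < cnorm2 z by rewrite cnorm2_gt0.
have n1 : 0 < cnorm2 (z ^+ 2 - 1) by rewrite cnorm2_gt0.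
have nk : 0 < cnorm2 (z + K) by rewrite cnorm2_gt0.
have q0 := qfun_gt0 k z.
pose al := (cnorm2 (z ^+ 2 - 1) * qfun k z)^-1.
pose c := cnorm2 (z + K) / cnorm2 z.
have al0 : 0 < al by rewrite invr_gt0 mulr_gt0.
have c0 : 0 < c by rewrite divr_gt0.
have cE : cnorm2 ((z + K) / z) = c by rewrite cnorm2M cnorm2V.
have c1 : cnorm2 (1 : C) = 1 by rewrite /cnorm2 /= expr1n expr0n addr0.
have fE i : f z 0 i = al * nullv (z ^+ 2) 1 0 i +
    qfun k z * nullv (K * z + 1) ((z + K) / z) 0 i.
  by rewrite /surf !scale1r /mu /nu !mxE.
have d : f z 0 0 - f z 0 3 = al + qfun k z * c.
  by rewrite !fE !vec4E -!/(cnorm2 _) c1 cE; field.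
have d0 : 0 < al + qfun k z * c by rewrite addr_gt0// mulr_gt0.
split; first by rewrite d gt_eqF.
have rE : frame_ratio z = qfun k z * c / al.
  by rewrite /frame_ratio /al /c invrK expr2; field; rewrite gt_eqF.
have tE : frame_ratio z / (1 + frame_ratio z) = qfun k z * c / (al + qfun k z * c).
  rewrite rE; field; rewrite ?gt_eqF//=.
set P := K * z + 1 in fE *; set Q := (z + K) / z in cE fE *.
have Q0 : Q != 0 by rewrite mulf_neq0// invr_eq0.
have PQ : P = (z ^+ 2 - gauss_diff z) * Q.
  by rewrite /P /Q /gauss_diff; field; rewrite z0 zk.
have gen (a q e : R) (Z u v : C) :
    ((a * nullv Z 1 0 1 + q * nullv u v 0 1) / e) +i*
    ((a * nullv Z 1 0 2 + q * nullv u v 0 2) / e) =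
    (e^-1)%:C * (a%:C * Z + q%:C * (u * conjc v)) :> C.
  case: Z u v => [Z1 Z2] [u1 u2] [v1 v2].
  by apply: eqC; rewrite ?reimE /= ?vec4E /=; ring.
have QQ : Q * conjc Q = c%:C.
  by rewrite -cE; case: (Q) => q1 q2; apply: eqC; rewrite /cnorm2 ?reimE /=; ring.
rewrite /chart d !fE gen tE PQ -[_ * Q * _]mulrA QQ.
set D := gauss_diff z.
have sE : (al + qfun k z * c)%:C = al%:C + (qfun k z)%:C * c%:C :> C.
  by rewrite -rmorphM -rmorphD.
have sV : (al + qfun k z * c)^-1%:C = (al%:C + (qfun k z)%:C * c%:C)^-1 :> C.
  by rewrite -sE; exact: fmorphV.
have dC : al%:C + (qfun k z)%:C * c%:C != 0 :> C by rewrite -sE fmorph_eq0 gt_eqF.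
have tC : (qfun k z * c / (al + qfun k z * c))%:C =
    (qfun k z)%:C * c%:C / (al%:C + (qfun k z)%:C * c%:C) :> C.
  by rewrite -sV -!rmorphM.
have fin (a q e Z : C) : a + q * e != 0 ->
    (a + q * e)^-1 * (a * Z + q * ((Z - D) * e)) = Z - D * (q * e / (a + q * e)).
  by move=> h; field.
by rewrite tC sV fin.
Qed.

End Ends.

Section EndsAtPunctures.
Variable R : realType.
Local Notation C := (Cplane R).
Local Notation M := (thrice_punctured_plane R).
Variable k : R.
Hypotheses (k0 : k != 0) (k1 : k != 1) (kN1 : k != -1).
Local Notation K := (k%:C : C).
Local Notation f := (surf k 1 1).

Lemma immersion_of_gap z : M z -> 0 < gap2 k z -> immersion_at f z.
Proof.
move=> Mz g0; apply: immersion_of_quad => v qv.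
have := gap2_le_quad k v Mz; rewrite qv pmulr_rle0// => h.
apply: row2_eq0; apply/eqP; rewrite -cnorm2_eq0; apply/eqP/le_anti.
by rewrite cnorm2_ge0 andbT.
Qed.

Lemma near_puncture_immersion b : b \in punctures R ->
  \forall z \near b, M z -> immersion_at f z.
Proof.
move=> bP; have [e [de [e0 _ de0 H]]] := gap_lower k0 k1 kN1.
have lt : cnorm2 (b - b) < e by rewrite subrr /cnorm2 /= expr0n addr0.
have := @cvgr_lt _ _ (nbhs b) (nbhs_filter b) _ _ (@continuous_cnorm2 R (- b) b) _ lt.
apply: (@filterS _ (nbhs b) (nbhs_filter b)) => z zb Mz; apply: immersion_of_gap => //.
have [|g _] := H z Mz; first by left; exists b.
exact: lt_le_trans g.
Qed.

Lemma near_puncture_thrice b : \forall z \near b, z != b -> M z.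
Proof.
have sep (c : C) : \forall z \near b, z != b -> z != c.
  have [->|bc] := eqVneq b c; first exact: (@filterE _ (nbhs c) (nbhs_filter c)).
  apply: (@filterS _ (nbhs b) (nbhs_filter b) _ _ _ (open_nbhs_nbhs (conj (@open_neq R c) bc))).
  by [].
apply: (@filterS3 _ (nbhs b) (nbhs_filter b) _ _ _ _ _ (sep 0) (sep 1) (sep (-1))) => z h0 h1 h2 zb.
by split; auto.
Qed.

Lemma cderiv_num (z : C) : cderiv (fun w : C => w * (w ^+ 2 - 1)) z (3 * z ^+ 2 - 1).
Proof.
apply: cderiv_eq; first exact: (cderivM (cderiv_id z) (cderiv_sqr_sub1 z)).
by rewrite /=; ring.
Qed.

Lemma near_shift_neq0 (c b : C) : b + c != 0 -> \forall z \near b, z + c != 0.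
Proof. exact: (near_nonzero (is_derive_addr c b)). Qed.

Definition dgauss_diff (z : C) : C :=
  (3 * z ^+ 2 - 1) / (z + K) - z * (z ^+ 2 - 1) / (z + K) ^+ 2.

Lemma cderiv_gauss_diff z : z + K != 0 -> cderiv (gauss_diff k) z (dgauss_diff z).
Proof.
move=> zk; apply: cderiv_eq.
  exact: (cderivM (cderiv_num z) (@cderivV _ (fun w => w + K) z _ zk (is_derive_addr K z))).
by rewrite /dgauss_diff /=; field.
Qed.

Lemma continuous_div_shift (u : C -> C) (b l : C) n : b + K != 0 -> cderiv u b l ->
  {for b, continuous (fun z => u z / (z + K) ^+ n)}.
Proof.
move=> bk du; apply: (continuousM (is_derive_continuous du)); apply: continuousV.
  by rewrite expf_neq0.
exact: is_derive_continuous (cderivX n (is_derive_addr K b)).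
Qed.

Lemma dgauss_diff_continuous b : b + K != 0 -> {for b, continuous dgauss_diff}.
Proof.
move=> bk.
have d1 : cderiv (fun z => 3 * z ^+ 2 - 1) b _ :=
  cderivB (cderivM (cderiv_cst 3 b) (cderivX 2 (cderiv_id b))) (cderiv_cst 1 b).
exact: (continuousB (continuous_div_shift (n := 1) bk d1)
  (continuous_div_shift (n := 2) bk (cderiv_num b))).
Qed.

(** Near [b] the gap makes the front an immersion and its chart is a [blend]. Embeddedness is thus
    reduced to one number, the slope [2 * b - E b * end_weight], being nonzero. *)
Lemma embedded_end_of_ratio (b : C) (s B : R) (j : C -> R) (dj : 'I_2 -> C -> R) (E : C -> C) :
  b \in punctures R -> b + K != 0 ->
  {for b, continuous j} -> 0 < j b ->
  (\forall z \near b, forall i, has_pd i j z (dj i z) /\ `|dj i z| <= B) ->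
  (\forall z \near b, z != b -> frame_ratio k z = ratio b s j z) ->
  (forall z, gauss_diff k z = (z - b) * E z) -> {for b, continuous E} ->
  dgauss_diff b = E b -> 2 * b - E b * (end_weight b s j)%:C != 0 ->
  embedded_end M f (Some b).
Proof.
move=> bP bk jc j0 pdj rE DE Ec dDb sl.
have gd : \forall z \near b, cderiv (fun w : C => w ^+ 2) z (2 * z).
  apply: (@filterE _ (nbhs b) (nbhs_filter b)) => z.
  by apply: cderiv_eq; [exact: (cderivX 2 (cderiv_id z))|rewrite /= expr1 mulr1].
have Dd : \forall z \near b, cderiv (gauss_diff k) z (dgauss_diff z).
  apply: (@filterS _ (nbhs b) (nbhs_filter b) _ _ _ (near_shift_neq0 bk)) => z.
  exact: cderiv_gauss_diff.
have DE' : \forall z \near b, gauss_diff k z = (z - b) * E z.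
  exact: (@filterE _ (nbhs b) (nbhs_filter b)).
have gc : {for b, continuous (fun z : C => 2 * z)}.
  exact: is_derive_continuous (cderivM (cderiv_cst 2 b) (cderiv_id b)).
have [r1 [de [r10 de0 low]]] := blend_lower jc j0 pdj gd Dd DE' gc
  (dgauss_diff_continuous bk) Ec dDb sl.
have N := nbhs_andC (nbhs_andC (near_puncture_immersion bP) (near_puncture_thrice b))
  (nbhs_andC (near_shift_neq0 bk) rE).
have [r2 r20 rP] := (nbhs_square b _).1 N.
pose r := Num.min r1 r2; have r0 : 0 < r by rewrite lt_min r10.
have rV z : punctured_square b r z -> [/\ z != b, `|re z - re b| < r1, `|im z - im b| < r1 &
    [/\ M z, immersion_at f z, z + K != 0 & frame_ratio k z = ratio b s j z]].
  move=> [zb]; rewrite !lt_min => /andP[x1 x2] /andP[y1 y2]; split=> //.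
  by have [[imm Mz] [zk zr]] := rP z x2 y2; split; auto.
apply: (embedded_end_finite r0); first by move=> z /rV[_ _ _ []].
apply: (embedding_of_chart (W := blend b s j (fun w => w ^+ 2) (gauss_diff k)) de0).
- by move=> z /rV[_ _ _ []].
- move=> z /rV[_ _ _ [Mz _ zk zr]]; have [h ->] := surf_chart Mz zk; split=> //.
  by rewrite /blend /weight zr.
- by move=> z1 z2 /rV[_ x1 y1 _] /rV[_ x2 y2 _]; exact: low.
Qed.

End EndsAtPunctures.

Section FourEnds.
Variable R : realType.
Local Notation C := (Cplane R).
Local Notation M := (thrice_punctured_plane R).

Lemma frame_ratioE (k : R) z : M z -> frame_ratio k z =
  expR ((1 + 2 * k) * ln (cnorm2 (z - 1))) * expR ((1 - 2 * k) * ln (cnorm2 (z + 1))) *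
  cnorm2 (z + k%:C) / cnorm2 z.
Proof.
move=> Mz; have [A0 B0] := twice_puncturedP (thrice_twice Mz).
rewrite /frame_ratio /qfun /logq sqr_sub1 cnorm2M; congr (_ * _ / _).
set LA := ln (cnorm2 (z - 1)); set LB := ln (cnorm2 (z + 1)).
have -> : cnorm2 (z - 1) = expR LA by rewrite lnK.
have -> : cnorm2 (z + 1) = expR LB by rewrite lnK.
by rewrite expr2 -!expRD; congr expR; ring.
Qed.

Lemma Ck_expR_ln_cnorm2 (A : set C) (e : R) (c : C) n : open A ->
  (forall z, A z -> z + c != 0) -> Ck n A (fun z => expR (e * ln (cnorm2 (z + c)))).
Proof.
move=> oA Ac; apply: (Ck_expR oA); apply: (CkM oA); first exact: (Ck_cst oA).
apply: (Ck_ln oA); first by move=> z /Ac; rewrite cnorm2_gt0.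
exact: (smooth_cnorm2 oA (csmoothD oA (csmooth_id oA) (csmooth_cst oA c))).
Qed.

Lemma Ck_cnorm2_shift (A : set C) (c : C) n : open A -> Ck n A (fun z => cnorm2 (z + c)).
Proof.
by move=> oA; exact: (smooth_cnorm2 oA (csmoothD oA (csmooth_id oA) (csmooth_cst oA c))).
Qed.

Lemma realC_shift_neq0 (x y : R) : x + y != 0 -> (x%:C : C) + y%:C != 0.
Proof. by rewrite -rmorphD fmorph_eq0. Qed.

Variable k : R.
Hypotheses (k0 : k != 0) (k1 : k != 1) (kN1 : k != -1).
Local Notation K := (k%:C : C).
Local Notation f := (surf k 1 1).

(** The exponent is s = 1 + 2k and E 1 = 2/(1+k). The slope is 2 for s > 0, 2k/(1+k) for s < 0, and
    -6/5 for s = 0, where k = -1/2 and j 1 = 4. *)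
Lemma embedded_end_one : embedded_end M f (Some 1).
Proof.
pose A : set C := [set z | z != 0] `&` [set z | z != -1].
have oA : open A by apply: openI; exact: open_neq.
have A1 : A 1.
  by split; rewrite /= ?oner_neq0// -subr_eq0 opprK -mulr2n pnatr_eq0.
have bk : 1 + K != 0 by apply: (@realC_shift_neq0 1); rewrite addrC addr_eq0.
pose j (z : C) := expR ((1 - 2 * k) * ln (cnorm2 (z + 1))) * cnorm2 (z + K) * (cnorm2 (z + 0))^-1.
have Cj : Ck 1 A j.
  apply: (CkM oA).
    apply: (CkM oA); last exact: Ck_cnorm2_shift.
    by apply: Ck_expR_ln_cnorm2 => // z [_ zN1]; rewrite addr_eq0.
  apply: (CkV oA); last exact: Ck_cnorm2_shift.
  by move=> z [z0 _]; rewrite addr0 cnorm2_eq0.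
have n1 : cnorm2 (1 : C) = 1 by rewrite /cnorm2 /= expr1n expr0n addr0.
have jb : 0 < j 1.
  by rewrite /j addr0 n1 invr1 mulr1 mulr_gt0 ?expR_gt0// cnorm2_gt0.
have [B HB] := Ck1_bound oA Cj A1.
pose E (z : C) := z * (z + 1) / (z + K).
have dE : cderiv (fun z : C => z * (z + 1)) 1 _ :=
  cderivM (cderiv_id 1) (is_derive_addr 1 1).
have E1 : E 1 = 2 / (1 + K) by rewrite /E mul1r.
apply: (@embedded_end_of_ratio _ k k0 k1 kN1 1 (1 + 2 * k) B j (fun i z => pd i j z) E).
- by rewrite !inE eqxx orbT.
- exact: bk.
- exact: Ck_continuous Cj A1.
- exact: jb.
- exact: HB.
- apply: (@filterS _ (nbhs (1 : C)) (nbhs_filter _) _ _ _ (near_puncture_thrice 1)) => z Mz z1.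
  by rewrite (frame_ratioE k (Mz z1)) /ratio /j addr0 !mulrA.
- by move=> z; rewrite /gauss_diff /E sqr_sub1; ring.
- exact: (continuous_div_shift (n := 1) bk dE).
- by rewrite /dgauss_diff E1; field.
- rewrite E1 /end_weight; have [s0|s0|s0] := ltgtP (1 + 2 * k) 0.
  + have -> : 2 * 1 - 2 / (1 + K) * (1 : R)%:C = 2 * K / (1 + K) by field.
    by rewrite !mulf_neq0 ?invr_eq0// ?pnatr_eq0// fmorph_eq0.
  + by rewrite mulr0 subr0 mulr1 pnatr_eq0.
  + have kE : k = - 2^-1 by lra.
    have jE : j 1 = 4.
      have n2 : cnorm2 (1 + 1 : C) = 4 by rewrite /cnorm2 /=; ring.
      rewrite /j addr0 n1 n2 invr1 mulr1 kE.
      have -> : 1 - 2 * - 2^-1 = 1 + 1 :> R by field.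
      rewrite mulrDl mul1r expRD lnK ?posrE//.
      by rewrite /cnorm2 /=; field.
    rewrite jE kE.
    have -> : 2 * 1 - 2 / (1 + (- 2^-1 : R)%:C) * (4 / (1 + 4) : R)%:C = (- (6 / 5) : R)%:C :> C.
      have -> : 1 + (- 2^-1 : R)%:C = (2^-1 : R)%:C :> C.
        by apply: eqC => /=; field.
      rewrite -fmorphV invrK.
      by apply: eqC => /=; field.
    by rewrite fmorph_eq0 oppr_eq0 mulf_neq0 ?invr_eq0 ?pnatr_eq0.
Qed.

(** The ratio grows like |z|^{-2}, so the exponent is -1, the limit weight 1, and the slope [- E 0]
    = 1/k. *)
Lemma embedded_end_zero : embedded_end M f (Some 0).
Proof.
pose A : set C := [set z | z != 1] `&` [set z | z != -1].
have oA : open A by apply: openI; exact: open_neq.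
have A0 : A 0.
  by split; rewrite /= eq_sym ?oner_neq0// oppr_eq0 oner_neq0.
have bk : 0 + K != 0 by rewrite add0r fmorph_eq0.
pose j (z : C) := expR ((1 + 2 * k) * ln (cnorm2 (z - 1))) *
  expR ((1 - 2 * k) * ln (cnorm2 (z + 1))) * cnorm2 (z + K).
have Cj : Ck 1 A j.
  apply: (CkM oA); last exact: Ck_cnorm2_shift.
  apply: (CkM oA); apply: Ck_expR_ln_cnorm2 => // z [z1 zN1].
    by rewrite subr_eq0.
  by rewrite addr_eq0.
have jb : 0 < j 0 by rewrite /j !mulr_gt0 ?expR_gt0// cnorm2_gt0.
have [B HB] := Ck1_bound oA Cj A0.
pose E (z : C) := (z ^+ 2 - 1) / (z + K).
have K0 : K != 0 by rewrite fmorph_eq0.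
have E0 : E 0 = - 1 / K by rewrite /E expr0n /= sub0r add0r.
apply: (@embedded_end_of_ratio _ k k0 k1 kN1 0 (-1) B j (fun i z => pd i j z) E).
- by rewrite !inE eqxx.
- exact: bk.
- exact: Ck_continuous Cj A0.
- exact: jb.
- exact: HB.
- apply: (@filterS _ (nbhs (0 : C)) (nbhs_filter _) _ _ _ (near_puncture_thrice 0)) => z Mz z0.
  rewrite (frame_ratioE k (Mz z0)) /ratio /j subr0 mulN1r expRN lnK ?posrE ?cnorm2_gt0//.
  by rewrite mulrC.
- by move=> z; rewrite /gauss_diff /E subr0 mulrA.
- exact: (continuous_div_shift (n := 1) bk (cderiv_sqr_sub1 0)).
- by rewrite /dgauss_diff E0; rewrite add0r; field.
- rewrite E0 /end_weight ltr0N1 ltrN10 mulr1 mulr0 sub0r mulN1r opprK invr_eq0 //.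
Qed.

(** Inverting (z-1)/(z+1) and changing the sign of the exponent cancel, and in the second column
    both signs drop out. *)
Lemma surfN z : surf (- k) 1 1 (- z) = f z.
Proof.
have E : ((- k)%:C : C) = - K by rewrite rmorphN.
rewrite /surf /mu /nu /qfun logqN mulrNN E.
have -> : (- z) ^+ 2 = z ^+ 2 by ring.
have -> : - K * - z + 1 = K * z + 1 by ring.
have -> // : (- z + - K) / - z = (z + K) / z.
by rewrite -opprD invrN mulrNN.
Qed.


(** Carries injectivity and continuity of the inverse through a change of parameter and an
    involution of the target; the immersion property comes separately, from the gap estimates. *)
Lemma embedding_on_conj (V W : set C) (g h : C -> 'rV[R]_4) (phi : C -> C)
    (S : 'rV[R]_4 -> 'rV[R]_4) :
  (forall z, W z -> [/\ V (phi z), phi (phi z) = z & h z = S (g (phi z))]) ->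
  involutive S -> continuous S -> (forall z, W z -> {for phi z, continuous phi}) ->
  (forall z, W z -> immersion_at h z) -> embedding_on V g -> embedding_on W h.
Proof.
move=> WV SS Sc pc Wi [_ Vinj Vc]; split=> //.
  move=> z1 z2; rewrite !inE => W1 W2.
  have [V1 p1 ->] := WV _ W1; have [V2 p2 ->] := WV _ W2.
  move=> /(inv_inj SS)/Vinj E; rewrite -p1 -p2 E //; exact: mem_set.
move=> z A Wz zA; have [Vz pz hz] := WV _ Wz.
have A' : nbhs (phi z) (phi @^-1` A) by apply: (pc z Wz); rewrite pz.
have H := Vc _ _ Vz A'.
have Sz : S (h z) = g (phi z) by rewrite hz SS.
have : nbhs (h z) (S @^-1` [set x | forall w, V w -> g w = x -> (phi @^-1` A) w]).
  by apply: Sc; rewrite Sz.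
apply: (@filterS _ (nbhs (h z)) (nbhs_filter _)) => x Hx w Ww hw.
have [Vw pw hw'] := WV _ Ww.
rewrite -pw; apply: (Hx (phi w) Vw).
by rewrite -hw hw' SS.
Qed.

Lemma embedded_end_square (h : C -> 'rV[R]_4) (b : C) : embedded_end M h (Some b) ->
  exists2 r : R, 0 < r & punctured_square b r `<=` M /\ embedding_on (punctured_square b r) h.
Proof.
move=> [U [nU UM Uh]].
have [r r0 rP] := (nbhs_square b _).1 (nU : nbhs b (Some @^-1` U)).
have sub z : punctured_square b r z -> (U `\ (Some b : sphere R)) (Some z).
  move=> [zb zx zy]; split; first exact: rP.
  by move=> [] /eqP; rewrite (negPf zb).
exists r => //; split; last exact: embedding_onS sub Uh.
by move=> z /sub/UM[w Mw [<-]].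
Qed.

End FourEnds.

(** * The ends -1 and infinity by symmetry *)

Section RemainingEnds.
Variable R : realType.
Local Notation C := (Cplane R).
Local Notation M := (thrice_punctured_plane R).
Variable k : R.
Hypotheses (k0 : k != 0) (k1 : k != 1) (kN1 : k != -1).
Local Notation K := (k%:C : C).
Local Notation f := (surf k 1 1).

Lemma embedded_end_minus_one : embedded_end M f (Some (-1)).
Proof.
have kN0 : - k != 0 by rewrite oppr_eq0.
have kN1' : - k != 1 by rewrite eqr_oppLR.
have kNN1 : - k != -1 by rewrite eqr_opp.
have [r1 r10 [VM Ve]] := embedded_end_square (embedded_end_one kN0 kN1' kNN1).
have bP : (-1 : C) \in punctures R by rewrite !inE eqxx !orbT.
have N := nbhs_andC (near_puncture_immersion k0 k1 kN1 bP) (near_puncture_thrice (-1)).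
have [r2 r20 rP] := (nbhs_square (-1 : C) _).1 N.
pose r := Num.min r1 r2; have r0 : 0 < r by rewrite lt_min r10.
have sub z : punctured_square (-1) r z ->
    [/\ punctured_square 1 r1 (- z), M z & immersion_at f z].
  move=> [zb]; rewrite !lt_min => /andP[x1 x2] /andP[y1 y2].
  have [imm Mz] := rP z x2 y2; split; [|exact: Mz|exact: imm (Mz zb)].
  split; first by rewrite eqr_oppLR.
    have -> : re (- z) - re (1 : C) = - (re z - re (-1 : C)) by rewrite !reimE /=; ring.
    by rewrite normrN.
  have -> : im (- z) - im (1 : C) = - (im z - im (-1 : C)) by rewrite !reimE /=; ring.
  by rewrite normrN.
apply: (embedded_end_finite r0); first by move=> z /sub[].
apply: (embedding_on_conj (phi := fun z : C => - z) (S := id) _ _ _ _ _ Ve) => //.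
- move=> z Wz; have [h1 _ _] := sub z Wz.
  by split; [exact: h1|exact: opprK|rewrite surfN].
- by move=> x; exact: cvg_id.
- by move=> z _; exact: is_derive_continuous (cderivN (cderiv_id _)).
- by move=> z /sub[].
Qed.

(** On Hermitian matrices: exchange of the two rows and of the two columns. *)
Definition flip (x : 'rV[R]_4) : 'rV[R]_4 := vec4 (x 0 0) (x 0 1) (- x 0 2) (- x 0 3).

Lemma flipK : involutive flip.
Proof.
by move=> x; apply/matrixP => r; rewrite ord1; apply: ord4P; rewrite !vec4E ?opprK.
Qed.

Lemma flip_continuous : continuous flip.
Proof.
move=> x; have co (i : 'I_4) : {for x, continuous (fun y : 'rV[R]_4 => y 0 i)}.
  exact: coord_continuous.
apply: continuous_mx => r; rewrite ord1; apply: ord4P.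
- rewrite (_ : (fun w => flip w 0 0) = fun w => w 0 0); first exact: co 0.
  by apply: funext => w; rewrite vec4E.
- rewrite (_ : (fun w => flip w 0 1) = fun w => w 0 1); first exact: co 1.
  by apply: funext => w; rewrite vec4E.
- rewrite (_ : (fun w => flip w 0 2) = fun w => - w 0 2); first exact: (continuousN (co 2)).
  by apply: funext => w; rewrite vec4E.
- rewrite (_ : (fun w => flip w 0 3) = fun w => - w 0 3); first exact: (continuousN (co 3)).
  by apply: funext => w; rewrite vec4E.
Qed.

Lemma flip_nullv (u v : C) : flip (nullv u v) = nullv v u.
Proof.
by apply/matrixP => r; rewrite ord1; apply: ord4P; rewrite !vec4E; field.
Qed.

Lemma flipD x y : flip (x + y) = flip x + flip y.
Proof.
by apply/matrixP => r; rewrite ord1; apply: ord4P; rewrite [RHS]mxE !vec4E ?mxE ?opprD.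
Qed.

Lemma flipZ a x : flip (a *: x) = a *: flip x.
Proof.
by apply/matrixP => r; rewrite ord1; apply: ord4P; rewrite [RHS]mxE !vec4E ?mxE ?mulrN.
Qed.

(** Under z -> 1/z the column (z^2, 1) becomes its own exchange up to a scalar, and (kz+1, (z+k)/z)
    exactly; |h| is unchanged by [logqV]. *)
Lemma surfV z : M z -> f z = flip (f z^-1).
Proof.
move=> Mz; have [z0 z1] := thriceP Mz.
have nz : cnorm2 z != 0 by rewrite cnorm2_eq0.
rewrite /surf !scale1r flipD /mu /nu !flipZ !flip_nullv /qfun (logqV Mz).
congr (_ + _ *: _).
  have E : nullv 1 (z^-1 ^+ 2) = cnorm2 (z^-1 ^+ 2) *: nullv (z ^+ 2) 1.
    by rewrite -nullvZ mulr1 exprVn mulVf// expf_neq0.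
  rewrite E scalerA; congr (_ *: _).
  have -> : z^-1 ^+ 2 - 1 = - (z ^+ 2 - 1) * z^-1 ^+ 2 by field.
  rewrite [cnorm2 (_ * _)]cnorm2M cnorm2N.
  have n1 : cnorm2 (z^-1 ^+ 2) != 0 by rewrite cnorm2_eq0 expf_neq0// invr_eq0.
  have n2 : cnorm2 (z ^+ 2 - 1) != 0 by rewrite cnorm2_eq0.
  have n3 := qfun_gt0 k z; rewrite /qfun in n3.
  by field; rewrite n1 n2 gt_eqF.
by congr nullv; field.
Qed.

Lemma embedded_end_infinity : embedded_end M f None.
Proof.
have [r r0 [VM Ve]] := embedded_end_square (embedded_end_zero k0 k1 kN1).
have [e [de [e0 e16 de0 gap]]] := gap_lower k0 k1 kN1.
(* For |z|^2 > L: 1/z lies in the square about 0 where the front is embedded, the gap at [z] is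
   bounded below, and |z| > 1 keeps [z] in [M]. *)
pose L := r ^- 2 + e^-1 + 1.
have L1 : 1 < L by rewrite /L ltrDr addr_gt0// invr_gt0 ?exprn_gt0.
have Le : e^-1 <= L by rewrite /L; have := exprn_gt0 2 r0; rewrite -invr_gt0; lra.
have Lr : r ^- 2 <= L by rewrite /L; move: e0; rewrite -invr_gt0; lra.
have L0 : 0 < L by lra.
pose W : set C := [set z | L < cnorm2 z].
have WM z : W z -> M z.
  rewrite /W /= => Lz; have h : 1 < cnorm2 z by exact: lt_trans Lz.
  by split; apply: contraTneq h => ->; rewrite -leNgt /cnorm2 /=; lra.
have sub z : W z -> punctured_square 0 r z^-1.
  move=> Wz; have [z0 _ _] := WM _ Wz.
  have small : cnorm2 z^-1 < r ^+ 2.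
    rewrite cnorm2V -[r ^+ 2]invrK ltf_pV2 ?posrE ?invr_gt0 ?exprn_gt0 ?cnorm2_gt0//.
    exact: le_lt_trans Wz.
  have aux (x y : R) : x ^+ 2 + y ^+ 2 < r ^+ 2 -> `|x - 0| < r.
    move=> h; rewrite subr0 -(gtr0_norm r0) -!sqrtr_sqr ltr_sqrt ?exprn_gt0//.
    by rewrite (le_lt_trans _ h)// lerDl sqr_ge0.
  split; first by rewrite invr_eq0.
    exact: aux small.
  by apply: (aux _ (re z^-1)); rewrite addrC.
have Wimm z : W z -> immersion_at f z.
  move=> Wz; apply: immersion_of_gap (WM _ Wz) _.
  have [|g _] := gap z (WM _ Wz); first by right; exact: le_lt_trans Wz.
  exact: lt_le_trans g.
have We : embedding_on W f.
  apply: (embedding_on_conj (phi := fun z : C => z^-1) (S := flip) _ _ _ _ _ Ve) => //.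
  - by move=> z Wz; split; [exact: sub|exact: invrK|exact: surfV (WM _ Wz)].
  - exact: flipK.
  - exact: flip_continuous.
  - move=> z Wz; have [z0 _ _] := WM _ Wz.
    have zV0 : z^-1 != 0 by rewrite invr_eq0.
    exact: is_derive_continuous (@cderivV _ id z^-1 _ zV0 (cderiv_id _)).
exists (Some @` W `|` [set None]); split.
(* A neighbourhood of infinity contains the complement of a closed compact set, here a disc. *)
- exists [set z : C | cnorm2 z <= L].
    by split; [exact: compact_disc|exact: closed_cnorm2_le].
  move=> p [[z zL <-]|->]; last by right.
  by left; exists z => //; rewrite /W /= ltNge; apply/negP.
- by move=> p [[[z Wz <-]|->] pN]; [exists z => //; exact: WM|case: pN].
- apply: embedding_onS We => z [[[w Ww [<-]]|//] _]; exact: Ww.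
Qed.

End RemainingEnds.

Theorem proposition3p4 (R : realType) (a : R)
    (a_neq0 : a != 0) (a_neq1 : a != 1) (a_neqN1 : a != -1) :
  let M := thrice_punctured_plane R in
  let G := fun z : Cplane R => Some (z ^+ 2) : sphere R in
  let Gs := fun z : Cplane R => sphere_div (z * (z + a%:C)) (a%:C * z + 1) in
  exists f n : Cplane R -> 'rV[R]_4,
    [/\ flat_front M f n,
        complete_front M f,
        hyperbolic_gauss_maps M f n G Gs,
        totally_ramified_value_number M G = (3 : R)%:E /\
        totally_ramified_value_number M Gs = (2 : R)%:E &
        forall p : sphere R, p \in [:: Some 0; Some 1; Some (-1); None] ->
          regular_end M G p /\ embedded_end M f p].
Proof.
move=> M G Gs.
(* The frame is built with k = 1/a; the three excluded values correspond under inversion. *)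
have k0 : a^-1 != 0 by rewrite invr_eq0.
have k1 : a^-1 != 1 by rewrite invr_eq1.
have kN1 : a^-1 != -1 by rewrite -[-1]invrN1 (inj_eq invr_inj).
exists (surf a^-1 1 1), (surf a^-1 1 (-1)); split.
- exact: surf_flat.
- exact: surf_complete.
- exact: surf_gauss_maps.
- by split; [exact: ramification_square|exact: ramification_Gs].
- move=> p; rewrite !inE => Hp; split; first exact: regular_end_square.
  move: Hp => /or4P[] /eqP ->.
  + exact: embedded_end_zero.
  + exact: embedded_end_one.
  + exact: embedded_end_minus_one.
  + exact: embedded_end_infinity.
Qed.
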